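(* Let $\alpha\in(0,\pi/2)$, let $\mathcal{E}_1$ be the evolutoid of the surface $S$ given in Monge form, assumed regular at $(0,0)$, let $\psi:(\mathbb{R}^2,0)\to(\mathbb{R}^3,p)$ be the Monge form parametrization of $\mathcal{E}_1$, $p=\psi(0,0)$, and let $\mathbf{v}=(0,0,1)\in T_p\mathcal{E}_1$. Assume that the origin is not a flat umbilic point of $S$. If $p$ is a parabolic point of $\mathcal{E}_1$ and $\mathbf{v}$ is an asymptotic direction of $\mathcal{E}_1$ at $p$, then the height function $h_{N_0}(x,y)=\langle\psi(x,y),N_0\rangle$ of $\mathcal{E}_1$ along the unit normal $N_0$ to $\mathcal{E}_1$ at $p$ has a singularity at $p$ of type $$A_2\iff a_{31}\neq0,$$ $$A_3\iff a_{31}=0\ \text{ and }\ a_{41}\neq0.$$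
   Context: $S$ is (locally) the image of the Monge form parametrization $\phi(u,v)=(u,v,f(u,v))$ near $(0,0)$, with $f$ smooth and Taylor expansion at the origin $$f(u,v)=\tfrac12\big(\kappa_1(0)u^2+\kappa_2(0)v^2\big)+\sum_{s\ge 3}\ \sum_{i+j=s}\frac{a_{ij}}{i!\,j!}u^iv^j .$$ The origin is neither a parabolic nor an umbilic point of $S$: $\kappa_1(0)\kappa_2(0)\neq0$ and $\kappa_1(0)>\kappa_2(0)$ (a flat umbilic would be a point with both principal curvatures zero). The evolutoid $\mathcal{E}_1$ is given, for $(u,v)$ near $(0,0)$, by the formula $$\mathcal{E}_1(u,v)=\phi(u,v)+r\Big(\frac{\cos\alpha}{\sqrt E}\,\phi_u+\sin\alpha\,N\Big),\qquad r=-\frac{2\sqrt E\,G}{\cos(\alpha)G_u-2\sin(\alpha)\sqrt E\,G\,\kappa_2},$$ in which the Monge form parametrization $\phi$ is used, $E=\langle\phi_u,\phi_u\rangle$, $G=\langle\phi_v,\phi_v\rangle$, $N=\phi_u\times\phi_v/\|\phi_u\times\phi_v\|$, and $\kappa_2=\kappa_2(u,v)$ is the principal curvature function of $S$ with value $\kappa_2(0)$ at the origin. When $\mathcal{E}_1$ is regular at $(0,0)$ (derivative of rank $2$), its tangent plane at $p=\mathcal{E}_1(0,0)$ is parallel to the $xz$-plane and its normal direction is $N_0=(0,1,0)$; after translating $p$ to the origin and reparametrizing, it is written in Monge form $\psi(x,y)=(x,g(x,y),y)$ with $g(0,0)=0$, $dg(0,0)=0$, so that $h_{N_0}=g$. A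 point of $\mathcal{E}_1$ is parabolic if the Gaussian curvature of $\mathcal{E}_1$ vanishes there; a tangent direction is asymptotic if the normal curvature in that direction vanishes. A function germ $g:(\mathbb{R}^2,0)\to\mathbb{R}$ has an $A_k$-singularity at the origin if it is $\mathcal{A}$-equivalent to $\pm x_1^{k+1}\pm x_2^2$, where two map germs $g_1,g_2$ are $\mathcal{A}$-equivalent if $g_1=\xi\circ g_2\circ h^{-1}$ for germs of diffeomorphisms $h$ of the source and $\xi$ of the target. *)

(* Defs.v *)
From Stdlib Require Import Reals Factorial.
From Coquelicot Require Import Coquelicot.

Open Scope R_scope.

(* ** Vectors of R^3 *)

Definition R3 : Type := (R * R * R)%type.

Definition c1 (w : R3) : R := fst (fst w).
Definition c2 (w : R3) : R := snd (fst w).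
Definition c3 (w : R3) : R := snd w.

Definition add3 (w z : R3) : R3 := (c1 w + c1 z, c2 w + c2 z, c3 w + c3 z).
Definition scale3 (a : R) (w : R3) : R3 := (a * c1 w, a * c2 w, a * c3 w).
Definition dot3 (w z : R3) : R := c1 w * c1 z + c2 w * c2 z + c3 w * c3 z.
Definition cross3 (w z : R3) : R3 :=
  (c2 w * c3 z - c3 w * c2 z,
   c3 w * c1 z - c1 w * c3 z,
   c1 w * c2 z - c2 w * c1 z).
Definition norm3 (w : R3) : R := sqrt (dot3 w w).
Definition zero3 : R3 := (0, 0, 0).

(* ** Smooth germs and germs of diffeomorphisms

   A germ is represented by a total function of which only the restriction to
   a neighbourhood of the base point matters. *)

Definition smooth_germ1 (xi : R -> R) (x0 : R) : Prop :=
  locally x0 (fun x => forall n, ex_derive_n xi n x).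

Definition smooth_germ2 (f : R -> R -> R) : Prop :=
  locally_2d (fun u v => forall n, ex_diff_n f n u v) 0 0.

Definition smooth_map_germ2 (h : R -> R -> R * R) : Prop :=
  smooth_germ2 (fun x y => fst (h x y)) /\ smooth_germ2 (fun x y => snd (h x y)).

(* [k] is the inverse germ of [h : (R^2,0) -> (R^2,0)]. *)
Definition diffeo_germ2 (h k : R -> R -> R * R) : Prop :=
  smooth_map_germ2 h /\ smooth_map_germ2 k /\
  h 0 0 = (0, 0) /\ k 0 0 = (0, 0) /\
  locally_2d (fun x y => k (fst (h x y)) (snd (h x y)) = (x, y)) 0 0 /\
  locally_2d (fun x y => h (fst (k x y)) (snd (k x y)) = (x, y)) 0 0.

(* [eta] is the inverse germ of [xi : (R,a) -> (R,b)]. *)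
Definition diffeo_germ1 (xi eta : R -> R) (a b : R) : Prop :=
  smooth_germ1 xi a /\ smooth_germ1 eta b /\
  xi a = b /\ eta b = a /\
  locally a (fun x => eta (xi x) = x) /\
  locally b (fun y => xi (eta y) = y).

(* g1 = xi o g2 o h^-1, where [k] is h^-1. *)
Definition A_equivalent (g1 g2 : R -> R -> R) : Prop :=
  exists (h k : R -> R -> R * R) (xi eta : R -> R),
    diffeo_germ2 h k /\
    diffeo_germ1 xi eta (g2 0 0) (g1 0 0) /\
    locally_2d (fun x y => g1 x y = xi (g2 (fst (k x y)) (snd (k x y)))) 0 0.

Definition A_singularity (n : nat) (g : R -> R -> R) : Prop :=
  exists s1 s2 : R,
    (s1 = 1 \/ s1 = -1) /\ (s2 = 1 \/ s2 = -1) /\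
    A_equivalent g (fun x1 x2 => s1 * x1 ^ (n + 1) + s2 * x2 ^ 2).

(* ** Parametrized surfaces in R^3 *)

Definition Du (X : R -> R -> R3) (u v : R) : R3 :=
  (Derive (fun t => c1 (X t v)) u,
   Derive (fun t => c2 (X t v)) u,
   Derive (fun t => c3 (X t v)) u).

Definition Dv (X : R -> R -> R3) (u v : R) : R3 :=
  (Derive (fun t => c1 (X u t)) v,
   Derive (fun t => c2 (X u t)) v,
   Derive (fun t => c3 (X u t)) v).

(* The derivative of [X] at (u,v) has rank 2. *)
Definition regular_at (X : R -> R -> R3) (u v : R) : Prop :=
  forall a b : R,
    add3 (scale3 a (Du X u v)) (scale3 b (Dv X u v)) = zero3 -> a = 0 /\ b = 0.

Definition first_E (X : R -> R -> R3) (u v : R) : R := dot3 (Du X u v) (Du X u v).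
Definition first_F (X : R -> R -> R3) (u v : R) : R := dot3 (Du X u v) (Dv X u v).
Definition first_G (X : R -> R -> R3) (u v : R) : R := dot3 (Dv X u v) (Dv X u v).

Definition unit_normal (X : R -> R -> R3) (u v : R) : R3 :=
  scale3 (/ norm3 (cross3 (Du X u v) (Dv X u v))) (cross3 (Du X u v) (Dv X u v)).

Definition second_L (X : R -> R -> R3) (u v : R) : R :=
  dot3 (Du (Du X) u v) (unit_normal X u v).
Definition second_M (X : R -> R -> R3) (u v : R) : R :=
  dot3 (Dv (Du X) u v) (unit_normal X u v).
Definition second_N (X : R -> R -> R3) (u v : R) : R :=
  dot3 (Dv (Dv X) u v) (unit_normal X u v).

Definition gauss_curvature (X : R -> R -> R3) (u v : R) : R :=
  (second_L X u v * second_N X u v - second_M X u v ^ 2) /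
  (first_E X u v * first_G X u v - first_F X u v ^ 2).

(* Normal curvature in the direction a X_u + b X_v. *)
Definition normal_curvature (X : R -> R -> R3) (u v a b : R) : R :=
  (second_L X u v * a ^ 2 + 2 * second_M X u v * a * b + second_N X u v * b ^ 2) /
  (first_E X u v * a ^ 2 + 2 * first_F X u v * a * b + first_G X u v * b ^ 2).

Definition parabolic_at (X : R -> R -> R3) (u v : R) : Prop :=
  gauss_curvature X u v = 0.

Definition asymptotic_direction (X : R -> R -> R3) (u v : R) (w : R3) : Prop :=
  w <> zero3 /\
  exists a b : R,
    w = add3 (scale3 a (Du X u v)) (scale3 b (Dv X u v)) /\
    normal_curvature X u v a b = 0.

(* [k] is an eigenvalue of the shape operator: dN(w) = - k w for some nonzero
   tangent vector w = a X_u + b X_v. *)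
Definition is_principal_curvature (X : R -> R -> R3) (u v k : R) : Prop :=
  exists a b : R,
    (a, b) <> (0, 0) /\
    add3 (scale3 a (Du (unit_normal X) u v)) (scale3 b (Dv (unit_normal X) u v)) =
    scale3 (- k) (add3 (scale3 a (Du X u v)) (scale3 b (Dv X u v))).

(* ** The surface in Monge form and its evolutoid *)

Definition monge (f : R -> R -> R) (u v : R) : R3 := (u, v, f u v).

(* Coefficient of u^i v^j in the Taylor series of [f] at the origin. *)
Definition taylor_coef (f : R -> R -> R) (i j : nat) : R :=
  partial_derive i j f 0 0 / (INR (fact i) * INR (fact j)).

(* The Taylor series of [f] at the origin is
   (k1 u^2 + k2 v^2)/2 + sum over i+j >= 3 of (a i j)/(i! j!) u^i v^j;
   the values [a i j] with i + j < 3 are irrelevant. *)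
Definition monge_expansion (f : R -> R -> R) (k1 k2 : R) (a : nat -> nat -> R) : Prop :=
  taylor_coef f 0 0 = 0 /\
  taylor_coef f 1 0 = 0 /\ taylor_coef f 0 1 = 0 /\
  taylor_coef f 2 0 = k1 / 2 /\ taylor_coef f 1 1 = 0 /\ taylor_coef f 0 2 = k2 / 2 /\
  forall i j : nat, (3 <= i + j)%nat ->
    taylor_coef f i j = a i j / (INR (fact i) * INR (fact j)).

(* [kappa] is the (continuous) principal curvature function near the origin of
   the surface parametrized by [X] that takes the value [k] at the origin. *)
Definition principal_curvature_branch
    (X : R -> R -> R3) (k : R) (kappa : R -> R -> R) : Prop :=
  kappa 0 0 = k /\
  locally_2d (fun u v => continuity_2d_pt kappa u v) 0 0 /\
  locally_2d (fun u v => is_principal_curvature X u v (kappa u v)) 0 0.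

Definition evolutoid_radius
    (f : R -> R -> R) (kappa2 : R -> R -> R) (alpha u v : R) : R :=
  let E := first_E (monge f) in
  let G := first_G (monge f) in
  let G_u := Derive (fun t => G t v) u in
  - (2 * sqrt (E u v) * G u v /
     (cos alpha * G_u - 2 * sin alpha * sqrt (E u v) * G u v * kappa2 u v)).

Definition evolutoid
    (f : R -> R -> R) (kappa2 : R -> R -> R) (alpha u v : R) : R3 :=
  add3 (monge f u v)
    (scale3 (evolutoid_radius f kappa2 alpha u v)
       (add3
          (scale3 (cos alpha / sqrt (first_E (monge f) u v)) (Du (monge f) u v))
          (scale3 (sin alpha) (unit_normal (monge f) u v)))).

(* [psi : (R^2,0) -> (R^3,p)], p = X(0,0), is a reparametrization of the surface
   germ [X] that is a graph over the plane through p parallel to the xz-plane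
   and is tangent to that plane at p. *)
Definition monge_parametrization_xz (X psi : R -> R -> R3) : Prop :=
  (exists g : R -> R -> R,
     smooth_germ2 g /\
     g 0 0 = 0 /\
     Derive (fun t => g t 0) 0 = 0 /\ Derive (fun t => g 0 t) 0 = 0 /\
     locally_2d (fun x y => psi x y = add3 (X 0 0) (x, g x y, y)) 0 0) /\
  (exists h k : R -> R -> R * R,
     diffeo_germ2 h k /\
     locally_2d (fun x y => psi x y = X (fst (h x y)) (snd (h x y))) 0 0).

Definition normal0 : R3 := (0, 1, 0).

Definition height_function (psi : R -> R -> R3) (n : R3) (x y : R) : R :=
  dot3 (psi x y) n.

(* Main.v *)
From Stdlib Require Import Reals Ranalysis5 Lra Lia Factorial ClassicalEpsilon.
From Coquelicot Require Import Coquelicot.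
Require Import Defs.
Open Scope R_scope.

(** The height of the evolutoid along [N_0] is, in the coordinates (u,v) of
    the surface, the second coordinate of the evolutoid, and this is a germ
      Y = v - s f_v,    s = r sin(alpha) / W,    W = sqrt (1 + f_u^2 + f_v^2).
    Passing from the Monge parametrization of the evolutoid to (u,v) is a
    diffeomorphism of the source, so it is the singularity of [Y] that counts.

    The identity behind the theorem is [shift_defect]: near the origin
      1 - s f_vv = e1 f_uv^2 + e2 f_uv f_v + e3 f_v^2
    with continuous [e1], [e2], [e3].  It holds because [1/s] is [W kappa_2] up
    to a multiple of [f_v f_uv], and because the eigenvalue equation of the
    shape operator,
      (f_uu - K E)(f_vv - K G) = (f_uv - K F)^2,    K = W kappa_2,
    makes [f_vv - K G] quadratic in [(f_uv, f_v)], its other factor being close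
    to [kappa_1 - kappa_2], which is not zero.  The derivative
    Y_v = (1 - s f_vv) - s_v f_v is therefore small wherever [f_v] and [f_uv] are.
    Only continuity of [kappa_2] enters here; smoothness of [s] comes from that of
    the evolutoid, whose points lie on lines with unit direction
    ([evolutoid_shift_smooth]).

    This gives the 2-jet of [Y]: Y_uv = 0, Y_uu = - s a_21 and Y_vv = - s_v kappa_2.
    Regularity of the evolutoid says that [s_v], hence [Y_vv], is not zero
    ([regular_shift_pdv]); the point being parabolic, the Hessian of [Y] is
    degenerate ([parabolic_hessian]), and so a_21 = 0.  Then
    f_v(u,0) = a_31 u^3 / 6 + a_41 u^4 / 24 + ..., so
      Y(u,0) = - s (a_31 u^3 / 6 + a_41 u^4 / 24 + ...),   Y_v(u,0) = O(u^3).
    Since [Y_vv] is not zero, the square in [v] can be completed, and as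
    [Y_v(u,0)] is of order 3 this changes [Y(u,0)] only from order 6 on.  The
    type of the singularity is read off from the first nonzero coefficient of
    [Y(u,0)]; this is [A2_A3_criterion].

    The criterion asks for actual smooth changes of coordinates and for
    the distinctness of the types.  The changes of coordinates are explicit up to
    Hadamard's lemma ([hadamard_v]), which divides smooth germs by [v], and
    the inverse function theorem for plane germs ([inverse_function_germ2]).
    Conversely, an equivalence of [Y] with a normal form is compared with [Y] by
    orders of vanishing on the axis v = 0 ([A_singularity_axis]). *)

(** * Neighbourhoods in the plane *)
Lemma locally_2d_mono (P Q : R -> R -> Prop) x y :
  (forall u v, P u v -> Q u v) -> locally_2d P x y -> locally_2d Q x y.
Proof. intros H [d Hd]. exists d. auto. Qed.

Lemma locally_2d_nested (P : R -> R -> Prop) x y :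
  locally_2d P x y -> locally_2d (locally_2d P) x y.
Proof.
  apply locally_2d_impl_strong. apply locally_2d_forall. auto.
Qed.

Lemma locally_2d_comp (P : R -> R -> Prop) a b x y :
  continuity_2d_pt a x y -> continuity_2d_pt b x y ->
  locally_2d P (a x y) (b x y) ->
  locally_2d (fun u v => P (a u v) (b u v)) x y.
Proof.
  intros Ha Hb [d Hd].
  generalize (locally_2d_and _ _ _ _ (Ha d) (Hb d)).
  apply locally_2d_mono. intros u v [H1 H2]. auto.
Qed.

Ltac near_and H1 H2 := generalize (locally_2d_and _ _ _ _ H1 H2).

Lemma continuity_2d_pt_gt_0 (F : R -> R -> R) x y :
  continuity_2d_pt F x y -> 0 < F x y -> locally_2d (fun u v => 0 < F u v) x y.
Proof.
  intros HF Hp. generalize (HF (mkposreal _ Hp)). apply locally_2d_mono.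
  simpl. intros u v H. apply Rabs_lt_between in H. lra.
Qed.

(** * Functions of class C^n near a point *)

Definition pdu (F : R -> R -> R) (u v : R) : R := Derive (fun z => F z v) u.
Definition pdv (F : R -> R -> R) (u v : R) : R := Derive (fun z => F u z) v.

(** The condition is imposed near the point and not only at it, so that it is
    inherited by every germ that equals a given partial derivative near the point. *)
Definition Ck (n : nat) (F : R -> R -> R) (x y : R) : Prop :=
  locally_2d (ex_diff_n F n) x y.

Lemma ex_diff_n_continuity F n x y : ex_diff_n F n x y -> continuity_2d_pt F x y.
Proof. destruct n; simpl; tauto. Qed.

Lemma Ck_ex_diff_n n F x y : Ck n F x y -> ex_diff_n F n x y.
Proof. apply locally_2d_singleton. Qed.

Lemma Ck_continuity n F x y : Ck n F x y -> continuity_2d_pt F x y.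
Proof. intros H. apply (ex_diff_n_continuity F n), Ck_ex_diff_n, H. Qed.

Lemma Ck_nested n F x y : Ck n F x y -> locally_2d (Ck n F) x y.
Proof. apply locally_2d_nested. Qed.

Lemma Ck_ext n F G x y :
  locally_2d (fun u v => F u v = G u v) x y -> Ck n F x y -> Ck n G x y.
Proof.
  intros H1 H2. near_and (locally_2d_nested _ _ _ H1) H2.
  apply locally_2d_mono. intros u v [E1 E2].
  apply ex_diff_n_ext_loc with (1 := E1); assumption.
Qed.

Lemma Ck_le n m F x y : (m <= n)%nat -> Ck n F x y -> Ck m F x y.
Proof.
  intros L. apply locally_2d_mono. intros u v. apply ex_diff_n_m; assumption.
Qed.

Lemma Ck_pdu n F x y : Ck (S n) F x y -> Ck n (pdu F) x y.
Proof. apply locally_2d_mono. simpl. unfold pdu. tauto. Qed.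

Lemma Ck_pdv n F x y : Ck (S n) F x y -> Ck n (pdv F) x y.
Proof. apply locally_2d_mono. simpl. unfold pdv. tauto. Qed.

Lemma Ck_is_derive_u n F x y :
  Ck (S n) F x y -> is_derive (fun z => F z y) x (pdu F x y).
Proof.
  intros H. apply Ck_ex_diff_n in H. simpl in H. apply Derive_correct. tauto.
Qed.

Lemma Ck_is_derive_v n F x y :
  Ck (S n) F x y -> is_derive (fun z => F x z) y (pdv F x y).
Proof.
  intros H. apply Ck_ex_diff_n in H. simpl in H. apply Derive_correct. tauto.
Qed.

Lemma Ck_differentiable n F x y :
  Ck (S n) F x y -> differentiable_pt_lim F x y (pdu F x y) (pdv F x y).
Proof.
  intros H. apply filterdiff_differentiable_pt_lim.
  assert (K := is_derive_filterdiff F x y (pdu F) (pdv F x y)).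
  eapply filterdiff_ext_lin. apply K.
  - apply (locally_2d_locally (fun a b => is_derive (fun z => F z b) a (pdu F a b))).
    generalize (Ck_nested _ _ _ _ H). apply locally_2d_mono.
    intros u v. apply Ck_is_derive_u.
  - eapply Ck_is_derive_v; eassumption.
  - apply (proj1 (continuity_2d_pt_filterlim (pdu F) x y)).
    eapply Ck_continuity, Ck_pdu, H.
  - intros [a b]. reflexivity.
Qed.

(** The partial derivatives need only be known through [is_derive] on a
    neighbourhood; this is what drives the inductions on the order below. *)
Lemma Ck_intro n F Fu Fv x y :
  locally_2d (fun u v => continuity_2d_pt F u v) x y ->
  locally_2d (fun u v => is_derive (fun z => F z v) u (Fu u v)) x y ->
  locally_2d (fun u v => is_derive (fun z => F u z) v (Fv u v)) x y ->
  Ck n Fu x y -> Ck n Fv x y -> Ck (S n) F x y.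
Proof.
  intros Hc Hu Hv Cu Cv.
  assert (Eu : Ck n (pdu F) x y).
  { apply Ck_ext with (2 := Cu). revert Hu. apply locally_2d_mono.
    intros u v H. symmetry. apply is_derive_unique, H. }
  assert (Ev : Ck n (pdv F) x y).
  { apply Ck_ext with (2 := Cv). revert Hv. apply locally_2d_mono.
    intros u v H. symmetry. apply is_derive_unique, H. }
  near_and (locally_2d_and _ _ _ _ Hc Hu)
    (locally_2d_and _ _ _ _ Hv (locally_2d_and _ _ _ _ Eu Ev)).
  apply locally_2d_mono. intros u v [[H1 H2] [H3 [H4 H5]]].
  simpl. repeat split; try assumption.
  - eexists; exact H2.
  - eexists; exact H3.
Qed.

Lemma Ck_0 F x y : locally_2d (fun u v => continuity_2d_pt F u v) x y -> Ck 0 F x y.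
Proof. apply locally_2d_mono. simpl. tauto. Qed.

Lemma Ck_near_continuity n F x y :
  Ck n F x y -> locally_2d (fun u v => continuity_2d_pt F u v) x y.
Proof. apply locally_2d_mono. intros u v. apply ex_diff_n_continuity. Qed.

Lemma Ck_const n c x y : Ck n (fun _ _ => c) x y.
Proof.
  revert c. induction n as [|n IH]; intros c.
  - apply Ck_0, locally_2d_forall. intros. apply continuity_2d_pt_const.
  - apply Ck_intro with (fun _ _ => 0) (fun _ _ => 0); try apply IH;
      apply locally_2d_forall; intros.
    + apply continuity_2d_pt_const.
    + apply (is_derive_const (K := R_AbsRing) (V := R_NormedModule)).
    + apply (is_derive_const (K := R_AbsRing) (V := R_NormedModule)).
Qed.

Lemma Ck_fst n x y : Ck n (fun u _ => u) x y.
Proof.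
  destruct n as [|n].
  - apply Ck_0, locally_2d_forall. intros. apply continuity_2d_pt_id1.
  - apply Ck_intro with (fun _ _ => 1) (fun _ _ => 0); try apply Ck_const;
      apply locally_2d_forall; intros.
    + apply continuity_2d_pt_id1.
    + apply (is_derive_id (K := R_AbsRing)).
    + apply (is_derive_const (K := R_AbsRing) (V := R_NormedModule)).
Qed.

Lemma Ck_snd n x y : Ck n (fun _ v => v) x y.
Proof.
  destruct n as [|n].
  - apply Ck_0, locally_2d_forall. intros. apply continuity_2d_pt_id2.
  - apply Ck_intro with (fun _ _ => 0) (fun _ _ => 1); try apply Ck_const;
      apply locally_2d_forall; intros.
    + apply continuity_2d_pt_id2.
    + apply (is_derive_const (K := R_AbsRing) (V := R_NormedModule)).
    + apply (is_derive_id (K := R_AbsRing)).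
Qed.

Lemma Ck_plus n F G x y :
  Ck n F x y -> Ck n G x y -> Ck n (fun u v => F u v + G u v) x y.
Proof.
  revert F G. induction n as [|n IH]; intros F G HF HG.
  - apply Ck_0. near_and (Ck_near_continuity _ _ _ _ HF) (Ck_near_continuity _ _ _ _ HG).
    apply locally_2d_mono. intros u v [A B]. apply continuity_2d_pt_plus; assumption.
  - apply Ck_intro with (fun u v => pdu F u v + pdu G u v)
      (fun u v => pdv F u v + pdv G u v).
    1-3: near_and (Ck_nested _ _ _ _ HF) (Ck_nested _ _ _ _ HG);
      apply locally_2d_mono; intros u v [A B].
    + apply continuity_2d_pt_plus; eapply Ck_continuity; eassumption.
    + apply (is_derive_plus (K := R_AbsRing) (V := R_NormedModule));
        eapply Ck_is_derive_u; eassumption.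
    + apply (is_derive_plus (K := R_AbsRing) (V := R_NormedModule));
        eapply Ck_is_derive_v; eassumption.
    + apply IH; apply Ck_pdu; assumption.
    + apply IH; apply Ck_pdv; assumption.
Qed.

Lemma Ck_mult n F G x y :
  Ck n F x y -> Ck n G x y -> Ck n (fun u v => F u v * G u v) x y.
Proof.
  revert F G. induction n as [|n IH]; intros F G HF HG.
  - apply Ck_0. near_and (Ck_near_continuity _ _ _ _ HF) (Ck_near_continuity _ _ _ _ HG).
    apply locally_2d_mono. intros u v [A B]. apply continuity_2d_pt_mult; assumption.
  - assert (HF' := Ck_le _ n _ _ _ (Nat.le_succ_diag_r n) HF).
    assert (HG' := Ck_le _ n _ _ _ (Nat.le_succ_diag_r n) HG).
    apply Ck_intro with (fun u v => pdu F u v * G u v + F u v * pdu G u v)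
      (fun u v => pdv F u v * G u v + F u v * pdv G u v).
    1-3: near_and (Ck_nested _ _ _ _ HF) (Ck_nested _ _ _ _ HG);
      apply locally_2d_mono; intros u v [A B].
    + apply continuity_2d_pt_mult; eapply Ck_continuity; eassumption.
    + apply (is_derive_mult (fun z => F z v) (fun z => G z v));
        [eapply Ck_is_derive_u; eassumption.. | exact Rmult_comm].
    + apply (is_derive_mult (fun z => F u z) (fun z => G u z));
        [eapply Ck_is_derive_v; eassumption.. | exact Rmult_comm].
    + apply Ck_plus; apply IH; try apply Ck_pdu; assumption.
    + apply Ck_plus; apply IH; try apply Ck_pdv; assumption.
Qed.

Lemma continuity_2d_pt_comp F a b x y :
  continuity_2d_pt F (a x y) (b x y) ->
  continuity_2d_pt a x y -> continuity_2d_pt b x y ->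
  continuity_2d_pt (fun u v => F (a u v) (b u v)) x y.
Proof.
  intros HF Ha Hb eps.
  apply (locally_2d_comp (fun s t => Rabs (F s t - F (a x y) (b x y)) < eps)); auto.
Qed.

Lemma is_derive_comp_2d n F a b x da db :
  Ck (S n) F (a x) (b x) -> is_derive a x da -> is_derive b x db ->
  is_derive (fun t => F (a t) (b t)) x
    (pdu F (a x) (b x) * da + pdv F (a x) (b x) * db).
Proof.
  intros HF Ha Hb. apply is_derive_Reals. apply derivable_pt_lim_comp_2d.
  - eapply Ck_differentiable, HF.
  - apply is_derive_Reals, Ha.
  - apply is_derive_Reals, Hb.
Qed.

Lemma Ck_comp n F a b x y :
  Ck n F (a x y) (b x y) -> Ck n a x y -> Ck n b x y ->
  Ck n (fun u v => F (a u v) (b u v)) x y.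
Proof.
  assert (Hnear : forall m G, Ck m G (a x y) (b x y) -> Ck m a x y -> Ck m b x y ->
    locally_2d (fun u v => Ck m G (a u v) (b u v)) x y).
  { intros m G H1 H2 H3. apply (locally_2d_comp (fun s t => Ck m G s t));
      [eapply Ck_continuity; eassumption .. |]. apply Ck_nested, H1. }
  revert F. induction n as [|n IH]; intros F HF Ha Hb;
    assert (HFS := Hnear _ _ HF Ha Hb).
  - apply Ck_0. near_and HFS (locally_2d_and _ _ _ _ (Ck_nested _ _ _ _ Ha) (Ck_nested _ _ _ _ Hb)).
    apply locally_2d_mono. intros u v [A [B C]].
    apply continuity_2d_pt_comp; eapply Ck_continuity; eassumption.
  - assert (Ha' := Ck_le _ n _ _ _ (Nat.le_succ_diag_r n) Ha).
    assert (Hb' := Ck_le _ n _ _ _ (Nat.le_succ_diag_r n) Hb).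
    apply Ck_intro with
      (fun u v => pdu F (a u v) (b u v) * pdu a u v + pdv F (a u v) (b u v) * pdu b u v)
      (fun u v => pdu F (a u v) (b u v) * pdv a u v + pdv F (a u v) (b u v) * pdv b u v).
    1-3: near_and HFS (locally_2d_and _ _ _ _ (Ck_nested _ _ _ _ Ha) (Ck_nested _ _ _ _ Hb));
      apply locally_2d_mono; intros u v [A [B C]].
    + apply continuity_2d_pt_comp; eapply Ck_continuity; eassumption.
    + apply (is_derive_comp_2d n F (fun z => a z v) (fun z => b z v)); auto;
        eapply Ck_is_derive_u; eassumption.
    + apply (is_derive_comp_2d n F (fun z => a u z) (fun z => b u z)); auto;
        eapply Ck_is_derive_v; eassumption.
    + apply Ck_plus; apply Ck_mult; try (apply Ck_pdu; assumption);
        apply IH; try assumption; [apply Ck_pdu | apply Ck_pdv]; assumption.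
    + apply Ck_plus; apply Ck_mult; try (apply Ck_pdv; assumption);
        apply IH; try assumption; [apply Ck_pdu | apply Ck_pdv]; assumption.
Qed.

Lemma Ck_inv n F x y : F x y <> 0 -> Ck n F x y -> Ck n (fun u v => / F u v) x y.
Proof.
  intros H0. induction n as [|n IH]; intros HF;
    assert (HN := continuity_2d_pt_neq_0 _ _ _ (Ck_continuity _ _ _ _ HF) H0).
  - apply Ck_0. near_and HN (Ck_near_continuity _ _ _ _ HF).
    apply locally_2d_mono. intros u v [A B]. apply continuity_2d_pt_inv; assumption.
  - assert (HI : Ck n (fun u v => / F u v) x y) by (apply IH, (Ck_le (S n)); auto).
    apply Ck_intro with (fun u v => (-1) * (pdu F u v * (/ F u v * / F u v)))
      (fun u v => (-1) * (pdv F u v * (/ F u v * / F u v))).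
    1-3: near_and HN (Ck_nested _ _ _ _ HF); apply locally_2d_mono; intros u v [A B].
    + apply continuity_2d_pt_inv; [eapply Ck_continuity|]; eassumption.
    + replace (-1 * _) with (- pdu F u v / F u v ^ 2) by (field; assumption).
      apply (is_derive_inv (fun z => F z v)); [eapply Ck_is_derive_u; eassumption | assumption].
    + replace (-1 * _) with (- pdv F u v / F u v ^ 2) by (field; assumption).
      apply (is_derive_inv (fun z => F u z)); [eapply Ck_is_derive_v; eassumption | assumption].
    + apply Ck_mult; [apply Ck_const|]. apply Ck_mult; [apply Ck_pdu, HF|].
      apply Ck_mult; assumption.
    + apply Ck_mult; [apply Ck_const|]. apply Ck_mult; [apply Ck_pdv, HF|].
      apply Ck_mult; assumption.
Qed.

Lemma is_derive_Rpower c (h : R -> R) x dh :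
  is_derive h x dh -> 0 < h x ->
  is_derive (fun z => Rpower (h z) c) x (c * (dh * (Rpower (h x) c * / h x))).
Proof.
  intros Hh Hp. unfold Rpower.
  evar_last.
  - apply (is_derive_comp exp (fun z => c * ln (h z))).
    + apply is_derive_exp.
    + apply (is_derive_scal (fun z => ln (h z))).
      apply (is_derive_comp ln h); [apply is_derive_ln, Hp | exact Hh].
  - unfold scal; simpl; unfold mult; simpl. field. lra.
Qed.

Lemma Ck_Rpower n c F x y :
  0 < F x y -> Ck n F x y -> Ck n (fun u v => Rpower (F u v) c) x y.
Proof.
  intros H0. induction n as [|n IH]; intros HF;
    assert (HN := continuity_2d_pt_gt_0 _ _ _ (Ck_continuity _ _ _ _ HF) H0);
    assert (HC : locally_2d (fun u v =>
      continuity_2d_pt (fun u v => Rpower (F u v) c) u v) x y)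
    by (near_and HN (Ck_nested _ _ _ _ HF); apply locally_2d_mono; intros u v [A B];
        apply (continuity_1d_2d_pt_comp (fun t => Rpower t c));
        [ apply derivable_continuous_pt; eexists; apply derivable_pt_lim_power, A
        | eapply Ck_continuity; eassumption ]).
  - apply Ck_0, HC.
  - assert (HI : Ck n (fun u v => Rpower (F u v) c) x y) by (apply IH, (Ck_le (S n)); auto).
    assert (HJ : Ck n (fun u v => / F u v) x y) by (apply Ck_inv, (Ck_le (S n)); auto; lra).
    apply Ck_intro with (fun u v => c * (pdu F u v * (Rpower (F u v) c * / F u v)))
      (fun u v => c * (pdv F u v * (Rpower (F u v) c * / F u v))).
    1: exact HC.
    1, 2: near_and HN (Ck_nested _ _ _ _ HF); apply locally_2d_mono; intros u v [A B].
    + apply (is_derive_Rpower c (fun z => F z v)); [eapply Ck_is_derive_u; eassumption | assumption].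
    + apply (is_derive_Rpower c (fun z => F u z)); [eapply Ck_is_derive_v; eassumption | assumption].
    + apply Ck_mult; [apply Ck_const|]. apply Ck_mult; [apply Ck_pdu, HF|].
      apply Ck_mult; assumption.
    + apply Ck_mult; [apply Ck_const|]. apply Ck_mult; [apply Ck_pdv, HF|].
      apply Ck_mult; assumption.
Qed.

(** * Smooth germs *)

(** One neighbourhood serves all orders, as in [smooth_germ2]. *)
Definition smooth_at (F : R -> R -> R) (x y : R) : Prop :=
  locally_2d (fun u v => forall n, Ck n F u v) x y.

Lemma smooth_germ2_iff F : smooth_germ2 F <-> smooth_at F 0 0.
Proof.
  split; intros H.
  - apply locally_2d_nested in H. revert H. apply locally_2d_mono.
    intros u v H n. revert H. apply locally_2d_mono. auto.
  - revert H. apply locally_2d_mono. intros u v H n. apply Ck_ex_diff_n, H.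
Qed.

Lemma smooth_at_Ck n F x y : smooth_at F x y -> Ck n F x y.
Proof. intros H. apply locally_2d_singleton in H. apply H. Qed.

Lemma smooth_at_continuity F x y : smooth_at F x y -> continuity_2d_pt F x y.
Proof. intros H. apply (Ck_continuity 0), smooth_at_Ck, H. Qed.

Lemma smooth_at_nested F x y : smooth_at F x y -> locally_2d (smooth_at F) x y.
Proof. apply locally_2d_nested. Qed.

Lemma smooth_at_is_derive_u F x y :
  smooth_at F x y -> is_derive (fun z => F z y) x (pdu F x y).
Proof. intros H. apply (Ck_is_derive_u 0), smooth_at_Ck, H. Qed.

Lemma smooth_at_is_derive_v F x y :
  smooth_at F x y -> is_derive (fun z => F x z) y (pdv F x y).
Proof. intros H. apply (Ck_is_derive_v 0), smooth_at_Ck, H. Qed.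

Lemma smooth_at_is_derive_comp F a b x da db :
  smooth_at F (a x) (b x) -> is_derive a x da -> is_derive b x db ->
  is_derive (fun t => F (a t) (b t)) x
    (pdu F (a x) (b x) * da + pdv F (a x) (b x) * db).
Proof. intros H. apply (is_derive_comp_2d 0), smooth_at_Ck, H. Qed.

Lemma smooth_at_ext F G x y :
  locally_2d (fun u v => F u v = G u v) x y -> smooth_at F x y -> smooth_at G x y.
Proof.
  intros H1 H2. near_and (locally_2d_nested _ _ _ H1) H2.
  apply locally_2d_mono. intros u v [A B] n. apply Ck_ext with (1 := A), B.
Qed.

Lemma smooth_at_pdu F x y : smooth_at F x y -> smooth_at (pdu F) x y.
Proof. apply locally_2d_mono. intros u v H n. apply Ck_pdu, H. Qed.

Lemma smooth_at_pdv F x y : smooth_at F x y -> smooth_at (pdv F) x y.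
Proof. apply locally_2d_mono. intros u v H n. apply Ck_pdv, H. Qed.

Lemma smooth_at_const c x y : smooth_at (fun _ _ => c) x y.
Proof. apply locally_2d_forall. intros. apply Ck_const. Qed.

Lemma smooth_at_fst x y : smooth_at (fun u _ => u) x y.
Proof. apply locally_2d_forall. intros. apply Ck_fst. Qed.

Lemma smooth_at_snd x y : smooth_at (fun _ v => v) x y.
Proof. apply locally_2d_forall. intros. apply Ck_snd. Qed.

Lemma smooth_at_plus F G x y :
  smooth_at F x y -> smooth_at G x y -> smooth_at (fun u v => F u v + G u v) x y.
Proof.
  intros HF HG. near_and HF HG. apply locally_2d_mono.
  intros u v [A B] n. apply Ck_plus; auto.
Qed.

Lemma smooth_at_mult F G x y :
  smooth_at F x y -> smooth_at G x y -> smooth_at (fun u v => F u v * G u v) x y.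
Proof.
  intros HF HG. near_and HF HG. apply locally_2d_mono.
  intros u v [A B] n. apply Ck_mult; auto.
Qed.

Lemma smooth_at_scal c F x y : smooth_at F x y -> smooth_at (fun u v => c * F u v) x y.
Proof. apply smooth_at_mult, smooth_at_const. Qed.

Lemma smooth_at_opp F x y : smooth_at F x y -> smooth_at (fun u v => - F u v) x y.
Proof.
  intros H. apply smooth_at_ext with (fun u v => (-1) * F u v).
  - apply locally_2d_forall. intros. ring.
  - apply smooth_at_scal, H.
Qed.

Lemma smooth_at_minus F G x y :
  smooth_at F x y -> smooth_at G x y -> smooth_at (fun u v => F u v - G u v) x y.
Proof. intros HF HG. apply smooth_at_plus; [|apply smooth_at_opp]; assumption. Qed.

Lemma smooth_at_pow F k x y : smooth_at F x y -> smooth_at (fun u v => F u v ^ k) x y.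
Proof.
  intros H. induction k as [|k IH]; simpl.
  - apply smooth_at_const.
  - apply smooth_at_mult; assumption.
Qed.

Lemma smooth_at_inv F x y :
  F x y <> 0 -> smooth_at F x y -> smooth_at (fun u v => / F u v) x y.
Proof.
  intros H0 HF.
  near_and (continuity_2d_pt_neq_0 _ _ _ (smooth_at_continuity _ _ _ HF) H0) HF.
  apply locally_2d_mono. intros u v [A B] n. apply Ck_inv; auto.
Qed.

Lemma smooth_at_div F G x y :
  G x y <> 0 -> smooth_at F x y -> smooth_at G x y ->
  smooth_at (fun u v => F u v / G u v) x y.
Proof. intros H0 HF HG. apply smooth_at_mult; [|apply smooth_at_inv]; assumption. Qed.

Lemma smooth_at_Rpower c F x y :
  0 < F x y -> smooth_at F x y -> smooth_at (fun u v => Rpower (F u v) c) x y.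
Proof.
  intros H0 HF.
  near_and (continuity_2d_pt_gt_0 _ _ _ (smooth_at_continuity _ _ _ HF) H0) HF.
  apply locally_2d_mono. intros u v [A B] n. apply Ck_Rpower; auto.
Qed.

Lemma smooth_at_sqrt F x y :
  0 < F x y -> smooth_at F x y -> smooth_at (fun u v => sqrt (F u v)) x y.
Proof.
  intros H0 HF. apply smooth_at_ext with (fun u v => Rpower (F u v) (/ 2)).
  - generalize (continuity_2d_pt_gt_0 _ _ _ (smooth_at_continuity _ _ _ HF) H0).
    apply locally_2d_mono. intros u v A. apply Rpower_sqrt, A.
  - apply smooth_at_Rpower; assumption.
Qed.

Lemma smooth_at_comp F a b x y :
  smooth_at F (a x y) (b x y) -> smooth_at a x y -> smooth_at b x y ->
  smooth_at (fun u v => F (a u v) (b u v)) x y.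
Proof.
  intros HF Ha Hb.
  assert (H : locally_2d (fun u v => forall n, Ck n F (a u v) (b u v)) x y).
  { apply (locally_2d_comp (fun s t => forall n, Ck n F s t));
      try apply smooth_at_continuity; assumption. }
  near_and H (locally_2d_and _ _ _ _ Ha Hb). apply locally_2d_mono.
  intros u v [A [B C]] n. apply Ck_comp; auto.
Qed.

(** * Hadamard's division lemma *)

Definition box (d : R) (u v : R) : Prop := Rabs u < d /\ Rabs v < d.

Lemma box_open d u v : box d u v -> locally_2d (box d) u v.
Proof.
  intros [Hu Hv].
  assert (H : 0 < Rmin (d - Rabs u) (d - Rabs v)) by (apply Rmin_glb_lt; lra).
  exists (mkposreal _ H). simpl. intros s t Hs Ht.
  assert (A := Rmin_l (d - Rabs u) (d - Rabs v)).
  assert (B := Rmin_r (d - Rabs u) (d - Rabs v)).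
  assert (C := Rabs_triang (s - u) u). replace (s - u + u) with s in C by ring.
  assert (D := Rabs_triang (t - v) v). replace (t - v + v) with t in D by ring.
  split; lra.
Qed.

Lemma locally_2d_box (P : R -> R -> Prop) :
  locally_2d P 0 0 <-> exists d, 0 < d /\ forall u v, box d u v -> P u v.
Proof.
  split.
  - intros [d Hd]. exists d. split; [apply cond_pos|]. intros u v [Hu Hv].
    apply Hd; rewrite Rminus_0_r; assumption.
  - intros [d [Hd H]]. exists (mkposreal d Hd). simpl. intros u v Hu Hv.
    rewrite Rminus_0_r in Hu, Hv. apply H. split; assumption.
Qed.

Lemma box_scale d u v t : 0 <= t <= 1 -> box d u v -> box d u (t * v).
Proof.
  intros Ht [Hu Hv]. split; [exact Hu|]. rewrite Rabs_mult, (Rabs_pos_eq t) by lra.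
  apply Rle_lt_trans with (2 := Hv). rewrite <- (Rmult_1_l (Rabs v)) at 2.
  apply Rmult_le_compat_r; [apply Rabs_pos | lra].
Qed.

(** The quotient in Hadamard's lemma is the moment of order 0 of a partial
    derivative.  The weight [t ^ j] makes the family of moments stable under
    differentiation: the derivative in [v] of the j-th moment of [H] is the
    moment of order [j + 1] of the [v]-derivative of [H]. *)
Definition fiber_moment (j : nat) (H : R -> R -> R) (u v : R) : R :=
  RInt (fun t => t ^ j * H u (t * v)) 0 1.

Section FiberMoment.
Variables (d : R) (H : R -> R -> R).
Hypothesis Hcont : forall u v, box d u v -> continuity_2d_pt H u v.

Lemma fiber_continuity_2d j u v t :
  box d u (t * v) ->
  continuity_2d_pt (fun z s => s ^ j * H z (s * v)) u t /\
  continuity_2d_pt (fun z s => s ^ j * H u (s * z)) v t.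
Proof.
  intros Hb. assert (Hs : forall a b, continuity_2d_pt (fun _ s => s ^ j) a b).
  { intros. apply smooth_at_continuity, smooth_at_pow, smooth_at_snd. }
  split; apply continuity_2d_pt_mult; try apply Hs.
  - apply (continuity_2d_pt_comp H (fun z s => z) (fun z s => s * v)).
    + apply Hcont, Hb.
    + apply continuity_2d_pt_id1.
    + apply continuity_2d_pt_mult; [apply continuity_2d_pt_id2 | apply continuity_2d_pt_const].
  - apply (continuity_2d_pt_comp H (fun z s => u) (fun z s => s * z)).
    + apply Hcont, Hb.
    + apply continuity_2d_pt_const.
    + apply continuity_2d_pt_mult; [apply continuity_2d_pt_id2 | apply continuity_2d_pt_id1].
Qed.

Lemma continuity_2d_pt_continuous_r F x y :
  continuity_2d_pt F x y -> continuous (fun t => F x t) y.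
Proof.
  intros HF. apply continuity_pt_filterlim, continuity_pt_locally. intros eps.
  exact (locally_2d_1d_const_x _ _ _ (HF eps)).
Qed.

Lemma ex_RInt_fiber j u v : box d u v -> ex_RInt (fun t => t ^ j * H u (t * v)) 0 1.
Proof.
  intros Hb. apply (ex_RInt_continuous (V := R_CompleteNormedModule)).
  rewrite Rmin_left, Rmax_right by lra. intros t Ht.
  apply (continuity_2d_pt_continuous_r (fun z s => s ^ j * H z (s * v))).
  apply fiber_continuity_2d, box_scale; assumption.
Qed.

(** [H] is uniformly continuous on a slightly smaller closed box, and the
    points (u, t v) stay in it for all [t] in [0, 1]. *)
Lemma fiber_moment_continuity j u v :
  box d u v -> continuity_2d_pt (fiber_moment j H) u v.
Proof.
  intros Hb eps. destruct Hb as [Hu Hv].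
  set (e := (d + Rmax (Rabs u) (Rabs v)) / 2).
  assert (Hm : Rmax (Rabs u) (Rabs v) < d) by (apply Rmax_lub_lt; assumption).
  assert (M1 := Rmax_l (Rabs u) (Rabs v)). assert (M2 := Rmax_r (Rabs u) (Rabs v)).
  assert (He : e < d) by (unfold e; lra).
  assert (Hbe : box e u v) by (unfold e; split; lra).
  destruct (uniform_continuity_2d H (- e) e (- e) e) with (eps := pos_div_2 eps)
    as [delta Hdelta].
  { intros x y Hx Hy. apply Hcont. split; apply Rabs_lt_between; lra. }
  near_and (box_open _ _ _ Hbe) (locally_2d_and _ _ _ _
    (continuity_2d_pt_id1 u v delta) (continuity_2d_pt_id2 u v delta)).
  apply locally_2d_mono. intros s t [Hst [Hs Ht]].
  assert (Hst' : box d s t) by (destruct Hst; split; lra).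
  unfold fiber_moment.
  rewrite <- (RInt_minus (V := R_CompleteNormedModule)
    (fun r => r ^ j * H s (r * t)) (fun r => r ^ j * H u (r * v)));
    try (apply ex_RInt_fiber; [assumption || (split; assumption)]).
  apply Rle_lt_trans with ((1 - 0) * (eps / 2)).
  2: { assert (P := cond_pos eps). lra. }
  apply abs_RInt_le_const.
  - lra.
  - apply (ex_RInt_minus (V := R_CompleteNormedModule));
      apply ex_RInt_fiber; [assumption | split; assumption].
  - intros r Hr. unfold minus, plus, opp; simpl.
    replace (r ^ j * H s (r * t) + - (r ^ j * H u (r * v)))
      with (r ^ j * (H s (r * t) - H u (r * v))) by ring.
    rewrite Rabs_mult, <- RPow_abs, (Rabs_pos_eq r) by lra.
    assert (Hp : 0 <= r ^ j <= 1).
    { split; [apply pow_le; lra|]. rewrite <- (pow1 j). apply pow_incr. lra. }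
    assert (Hd : Rabs (H s (r * t) - H u (r * v)) < eps / 2).
    { assert (Hbs := box_scale _ _ _ _ Hr Hst). assert (Hbu := box_scale _ _ _ _ Hr Hbe).
      destruct Hbs as [B1 B2], Hbu as [B3 B4].
      apply Rabs_lt_between in B1, B2, B3, B4.
      apply (Hdelta u (r * v) s (r * t)); try lra.
      replace (r * t - r * v) with (r * (t - v)) by ring.
      rewrite Rabs_mult, (Rabs_pos_eq r) by lra.
      apply Rle_lt_trans with (2 := Ht). rewrite <- (Rmult_1_l (Rabs (t - v))) at 2.
      apply Rmult_le_compat_r; [apply Rabs_pos | lra]. }
    assert (Q := Rabs_pos (H s (r * t) - H u (r * v))). nra.
Qed.

End FiberMoment.

Lemma Ck_fiber_moment d n H :
  (forall u v, box d u v -> Ck n H u v) ->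
  forall j u v, box d u v -> Ck n (fiber_moment j H) u v.
Proof.
  revert H. induction n as [|n IH]; intros H HH j u v Hb;
    assert (Hc : forall x y, box d x y -> continuity_2d_pt H x y)
      by (intros x y Hxy; eapply Ck_continuity, HH, Hxy);
    assert (Hm : locally_2d (fun x y => continuity_2d_pt (fiber_moment j H) x y) u v)
      by (generalize (box_open _ _ _ Hb); apply locally_2d_mono; intros x y Hxy;
          apply (fiber_moment_continuity d); assumption).
  - apply Ck_0, Hm.
  - assert (Hcu : forall x y, box d x y -> continuity_2d_pt (pdu H) x y)
      by (intros x y Hxy; eapply Ck_continuity, Ck_pdu, HH, Hxy).
    assert (Hcv : forall x y, box d x y -> continuity_2d_pt (pdv H) x y)
      by (intros x y Hxy; eapply Ck_continuity, Ck_pdv, HH, Hxy).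
    apply Ck_intro with (fiber_moment j (pdu H)) (fiber_moment (S j) (pdv H)).
    + exact Hm.
    + generalize (box_open _ _ _ Hb). apply locally_2d_mono. intros x y Hxy.
      assert (HD : forall z t, box d z (t * y) ->
        is_derive (fun z => t ^ j * H z (t * y)) z (t ^ j * pdu H z (t * y))).
      { intros z t Hzt. apply (is_derive_scal (fun z => H z (t * y))).
        eapply Ck_is_derive_u, HH, Hzt. }
      assert (Hx : locally x (fun z => box d z y)).
      { exact (locally_2d_1d_const_y _ _ _ (box_open _ _ _ Hxy)). }
      unfold fiber_moment.
      replace (RInt (fun t => t ^ j * pdu H x (t * y)) 0 1)
        with (RInt (fun t => Derive (fun z => t ^ j * H z (t * y)) x) 0 1).
      2: { apply (RInt_ext (V := R_CompleteNormedModule)). rewrite Rmin_left, Rmax_right by lra. intros t Ht.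
           apply is_derive_unique, HD, box_scale; [lra | assumption]. }
      apply (is_derive_RInt_param (fun z t => t ^ j * H z (t * y))).
      * revert Hx. apply filter_imp. rewrite Rmin_left, Rmax_right by lra.
        intros z Hz t Ht. eexists. apply HD, box_scale; assumption.
      * rewrite Rmin_left, Rmax_right by lra. intros t Ht.
        assert (Hb' := box_scale _ _ _ _ Ht Hxy).
        apply continuity_2d_pt_ext_loc with (fun z s => s ^ j * pdu H z (s * y)).
        2: { apply (fiber_continuity_2d d (pdu H)); assumption. }
        assert (Hn : locally_2d (fun z s => box d z (s * y)) x t).
        { apply (locally_2d_comp (box d) (fun z s => z) (fun z s => s * y)).
          - apply continuity_2d_pt_id1.
          - apply continuity_2d_pt_mult; [apply continuity_2d_pt_id2 | apply continuity_2d_pt_const].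
          - apply box_open, Hb'. }
        revert Hn. apply locally_2d_mono. intros z s Hzs.
        symmetry. apply is_derive_unique, HD, Hzs.
      * revert Hx. apply filter_imp. intros z Hz. apply (ex_RInt_fiber d); assumption.
    + generalize (box_open _ _ _ Hb). apply locally_2d_mono. intros x y Hxy.
      assert (HD : forall z t, box d x (t * z) ->
        is_derive (fun z => t ^ j * H x (t * z)) z (t ^ S j * pdv H x (t * z))).
      { intros z t Hzt. evar_last.
        - apply (is_derive_scal (fun z => H x (t * z))).
          apply (is_derive_comp (fun w => H x w) (fun z => t * z)).
          + eapply Ck_is_derive_v, HH, Hzt.
          + apply (is_derive_scal (fun z => z)), (is_derive_id (K := R_AbsRing)).
        - unfold scal, one; simpl; unfold mult; simpl. ring. }
      assert (Hx : locally y (fun z => box d x z)).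
      { exact (locally_2d_1d_const_x _ _ _ (box_open _ _ _ Hxy)). }
      unfold fiber_moment.
      replace (RInt (fun t => t ^ S j * pdv H x (t * y)) 0 1)
        with (RInt (fun t => Derive (fun z => t ^ j * H x (t * z)) y) 0 1).
      2: { apply (RInt_ext (V := R_CompleteNormedModule)). rewrite Rmin_left, Rmax_right by lra. intros t Ht.
           apply is_derive_unique, HD, box_scale; [lra | assumption]. }
      apply (is_derive_RInt_param (fun z t => t ^ j * H x (t * z))).
      * revert Hx. apply filter_imp. rewrite Rmin_left, Rmax_right by lra.
        intros z Hz t Ht. eexists. apply HD, box_scale; assumption.
      * rewrite Rmin_left, Rmax_right by lra. intros t Ht.
        assert (Hb' := box_scale _ _ _ _ Ht Hxy).
        apply continuity_2d_pt_ext_loc with (fun z s => s ^ S j * pdv H x (s * z)).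
        2: { apply (fiber_continuity_2d d (pdv H)); assumption. }
        assert (Hn : locally_2d (fun z s => box d x (s * z)) y t).
        { apply (locally_2d_comp (box d) (fun z s => x) (fun z s => s * z)).
          - apply continuity_2d_pt_const.
          - apply continuity_2d_pt_mult; [apply continuity_2d_pt_id2 | apply continuity_2d_pt_id1].
          - apply box_open, Hb'. }
        revert Hn. apply locally_2d_mono. intros z s Hzs.
        symmetry. apply is_derive_unique, HD, Hzs.
      * revert Hx. apply filter_imp. intros z Hz. apply (ex_RInt_fiber d); assumption.
    + apply IH; [|assumption]. intros x y Hxy. apply Ck_pdu, HH, Hxy.
    + apply IH; [|assumption]. intros x y Hxy. apply Ck_pdv, HH, Hxy.
Qed.

(** F(u,v) - F(u,0) is the integral over [0, 1] of the derivative
    v F_v(u, t v) of F(u, t v) in [t]. *)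
Lemma hadamard_v F :
  smooth_at F 0 0 ->
  exists F1, smooth_at F1 0 0 /\
    locally_2d (fun u v => F u v = F u 0 + v * F1 u v) 0 0.
Proof.
  intros HF. destruct (proj1 (locally_2d_box _) HF) as [d [Hd HC]].
  exists (fiber_moment 0 (pdv F)). split; apply locally_2d_box; exists d; split; auto.
  - intros u v Hb n. apply (Ck_fiber_moment d); [|assumption].
    intros x y Hxy. apply Ck_pdv, HC, Hxy.
  - intros u v Hb. unfold fiber_moment.
    assert (E : is_RInt (fun t => v * (t ^ 0 * pdv F u (t * v))) 0 1
      (minus (F u (1 * v)) (F u (0 * v)))).
    { apply (is_RInt_derive (fun t => F u (t * v))); rewrite Rmin_left, Rmax_right by lra;
        intros t Ht; assert (Hb' := box_scale _ _ _ _ Ht Hb).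
      - evar_last.
        + apply (is_derive_comp (fun w => F u w) (fun t => t * v)).
          * apply (Ck_is_derive_v 0), HC, Hb'.
          * apply (is_derive_ext (fun t => v * t)); [intros; apply Rmult_comm|].
            apply (is_derive_scal (fun z => z)), (is_derive_id (K := R_AbsRing)).
        + unfold scal, one; simpl; unfold mult; simpl. ring.
      - apply (continuity_2d_pt_continuous_r (fun z s => v * (s ^ 0 * pdv F z (s * v)))).
        apply continuity_2d_pt_mult; [apply continuity_2d_pt_const|].
        apply (fiber_continuity_2d d (pdv F)); [|assumption].
        intros x y Hxy. eapply (Ck_continuity 0), Ck_pdv, HC, Hxy. }
    apply (is_RInt_unique (V := R_CompleteNormedModule)) in E.
    rewrite (RInt_scal (V := R_CompleteNormedModule) (fun t => t ^ 0 * pdv F u (t * v))) in E.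
    2: { apply (ex_RInt_fiber d); [|assumption].
         intros x y Hxy. eapply (Ck_continuity 0), Ck_pdv, HC, Hxy. }
    unfold scal, minus, plus, opp in E; simpl in E; unfold mult in E; simpl in E.
    rewrite Rmult_1_l, Rmult_0_l in E. simpl. rewrite E. ring.
Qed.

Lemma locally_2d_swap (P : R -> R -> Prop) x y :
  locally_2d P x y -> locally_2d (fun u v => P v u) y x.
Proof. intros [d Hd]. exists d. auto. Qed.

Lemma hadamard_u F :
  smooth_at F 0 0 ->
  exists F1, smooth_at F1 0 0 /\
    locally_2d (fun u v => F u v = F 0 v + u * F1 u v) 0 0.
Proof.
  assert (Hswap : forall G, smooth_at G 0 0 -> smooth_at (fun u v => G v u) 0 0).
  { intros G HG. apply (smooth_at_comp G (fun _ v => v) (fun u _ => u));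
      [assumption | apply smooth_at_snd | apply smooth_at_fst]. }
  intros HF. destruct (hadamard_v _ (Hswap _ HF)) as [G [HG E]].
  exists (fun u v => G v u). split; [apply Hswap, HG|].
  apply locally_2d_swap in E. exact E.
Qed.

(** * The inverse function theorem for plane germs *)
Lemma differentiable_pt_lim_is_derive_u F x y l1 l2 :
  differentiable_pt_lim F x y l1 l2 -> is_derive (fun z => F z y) x l1.
Proof.
  intros H. apply is_derive_Reals. replace l1 with (l1 * 1 + l2 * 0) by ring.
  apply (derivable_pt_lim_comp_2d F (fun t => t) (fun _ => y)); auto.
  - apply derivable_pt_lim_id.
  - apply derivable_pt_lim_const.
Qed.

Lemma differentiable_pt_lim_is_derive_v F x y l1 l2 :
  differentiable_pt_lim F x y l1 l2 -> is_derive (fun z => F x z) y l2.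
Proof.
  intros H. apply is_derive_Reals. replace l2 with (l1 * 0 + l2 * 1) by ring.
  apply (derivable_pt_lim_comp_2d F (fun _ => x) (fun t => t)); auto.
  - apply derivable_pt_lim_const.
  - apply derivable_pt_lim_id.
Qed.

(** The first-order expansion of [F] at (phi(s,v), v) determines the increment of
    [phi] up to an error that is small compared with the increments of all the
    arguments; the increment of [phi] itself is absorbed in the left-hand side,
    which bounds it by a multiple [C] of those of [s] and [v]. *)
Lemma differentiable_pt_lim_implicit F phi s0 v0 l1 l2 :
  differentiable_pt_lim F (phi s0 v0) v0 l1 l2 -> 0 < l1 ->
  continuity_2d_pt phi s0 v0 ->
  locally_2d (fun s v => F (phi s v) v = s) s0 v0 ->
  differentiable_pt_lim phi s0 v0 (/ l1) (- l2 / l1).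
Proof.
  intros HF Hl Hc HE eps.
  assert (E0 := locally_2d_singleton _ _ _ HE). simpl in E0.
  set (u0 := phi s0 v0) in *.
  set (C := 2 * (1 + Rabs l2 + l1) / l1 + 1).
  assert (Hl2 := Rabs_pos l2).
  assert (HC : 0 < C).
  { unfold C. assert (0 < 2 * (1 + Rabs l2 + l1) / l1); [|lra].
    apply Rdiv_lt_0_compat; lra. }
  assert (He : 0 < Rmin (l1 / 2) (eps * l1 / C)).
  { apply Rmin_glb_lt; [lra|]. apply Rdiv_lt_0_compat; [|exact HC].
    apply Rmult_lt_0_compat; [apply cond_pos | exact Hl]. }
  assert (He1 := Rmin_l (l1 / 2) (eps * l1 / C)).
  assert (He2 := Rmin_r (l1 / 2) (eps * l1 / C)).
  set (e := Rmin (l1 / 2) (eps * l1 / C)) in *.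
  assert (HD := HF (mkposreal e He)). simpl in HD.
  apply (locally_2d_comp _ phi (fun _ v => v) s0 v0) in HD;
    [|exact Hc | apply continuity_2d_pt_id2].
  near_and HD HE. apply locally_2d_mono. intros s v [H1 H2].
  rewrite H2 in H1. fold u0. rewrite E0 in H1.
  set (u := phi s v) in *.
  set (a := u - u0) in *. set (b := v - v0) in *. set (c := s - s0) in *.
  set (M := Rmax (Rabs c) (Rabs b)).
  assert (M1 := Rmax_l (Rabs c) (Rabs b) : Rabs c <= M).
  assert (M2 := Rmax_r (Rabs c) (Rabs b) : Rabs b <= M).
  assert (M0 : 0 <= M) by (eapply Rle_trans; [apply Rabs_pos | exact M1]).
  set (D := c - (l1 * a + l2 * b)) in *.
  (* the increment of [phi] is controlled by those of its arguments *)
  assert (Ha : Rabs a <= C * M).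
  { assert (Ea : l1 * a = c - l2 * b - D) by (unfold D; ring).
    assert (La : l1 * Rabs a <= Rabs c + Rabs l2 * Rabs b + Rabs D).
    { rewrite <- (Rabs_pos_eq l1) at 1 by lra. rewrite <- Rabs_mult, Ea, <- Rabs_mult.
      unfold Rminus. eapply Rle_trans; [apply Rabs_triang|]. rewrite Rabs_Ropp.
      apply Rplus_le_compat_r. eapply Rle_trans; [apply Rabs_triang|].
      rewrite Rabs_Ropp. lra. }
    assert (Lm : Rmax (Rabs a) (Rabs b) <= Rabs a + Rabs b).
    { apply Rmax_lub; assert (A1 := Rabs_pos a); assert (A2 := Rabs_pos b); lra. }
    assert (P1 : e * Rmax (Rabs a) (Rabs b) <= l1 / 2 * (Rabs a + Rabs b)).
    { apply Rmult_le_compat; try lra.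
      eapply Rle_trans; [apply Rabs_pos | apply Rmax_l]. }
    assert (P2 : Rabs l2 * Rabs b <= Rabs l2 * M) by (apply Rmult_le_compat_l; lra).
    assert (P3 : l1 * Rabs b <= l1 * M) by (apply Rmult_le_compat_l; lra).
    apply Rmult_le_reg_l with l1; [exact Hl|].
    replace (l1 * (C * M)) with ((2 * (1 + Rabs l2 + l1) + l1) * M)
      by (unfold C; field; lra).
    assert (P4 : 0 <= l1 * M) by (apply Rmult_le_pos; lra). nra. }
  assert (HC1 : 1 <= C).
  { unfold C. assert (0 < 2 * (1 + Rabs l2 + l1) / l1); [|lra].
    apply Rdiv_lt_0_compat; lra. }
  replace (a - (/ l1 * c + - l2 / l1 * b)) with (- (D / l1)) by (unfold D; field; lra).
  rewrite Rabs_Ropp. unfold Rdiv. rewrite Rabs_mult, (Rabs_pos_eq (/ l1))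
    by (left; apply Rinv_0_lt_compat, Hl).
  apply Rmult_le_reg_r with l1; [exact Hl|].
  rewrite Rmult_assoc, Rinv_l, Rmult_1_r by lra.
  apply Rle_trans with (1 := H1).
  assert (Lm : Rmax (Rabs a) (Rabs b) <= C * M).
  { apply Rmax_lub; [exact Ha|]. apply Rle_trans with (1 := M2). nra. }
  apply Rle_trans with (eps * l1 / C * (C * M)).
  - apply Rmult_le_compat; try lra.
    eapply Rle_trans; [apply Rabs_pos | apply Rmax_l].
  - right. field. lra.
Qed.

(** On a small box [F] increases in its first variable with slope at least [m], so
    the intermediate value theorem solves [F u v = s] uniquely, and the lower bound on
    the slope makes the solution continuous.  Smoothness follows by induction on
    the order: the derivatives 1 / F_u and - F_v / F_u of the solution are
    evaluated along the solution, hence as regular as the solution itself. *)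
Lemma implicit_function_pos F :
  smooth_at F 0 0 -> F 0 0 = 0 -> 0 < pdu F 0 0 ->
  exists phi, smooth_at phi 0 0 /\
    locally_2d (fun s v => F (phi s v) v = s) 0 0 /\
    locally_2d (fun u v => phi (F u v) v = u) 0 0.
Proof.
  intros HF F0 Hp.
  set (m := pdu F 0 0 / 2). assert (Hm : 0 < m) by (unfold m; lra).
  assert (Hgt : locally_2d (fun u v => m < pdu F u v) 0 0).
  { generalize (smooth_at_continuity _ _ _ (smooth_at_pdu _ _ _ HF) (mkposreal m Hm)).
    apply locally_2d_mono. simpl. intros u v H. apply Rabs_lt_between in H.
    unfold m in *. lra. }
  destruct (proj1 (locally_2d_box _) (locally_2d_and _ _ _ _ HF Hgt)) as [d [Hd HC]].
  set (e := d / 2). assert (He : 0 < e) by (unfold e; lra).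
  assert (Hed : e < d) by (unfold e; lra).
  assert (HCe : forall u v, Rabs u <= e -> Rabs v <= e ->
    (forall n, Ck n F u v) /\ m < pdu F u v).
  { intros u v Hu Hv. apply HC. split; lra. }
  assert (Hmono : forall a b v, - e <= a -> a <= b -> b <= e -> Rabs v <= e ->
    m * (b - a) <= F b v - F a v).
  { intros a b v Ha Hab Hb Hv.
    destruct (MVT_gen (fun z => F z v) a b (fun z => pdu F z v)) as [c [Hc Ec]].
    - rewrite Rmin_left, Rmax_right by lra. intros x Hx.
      apply (Ck_is_derive_u 0), HCe; [apply Rabs_le_between; lra | assumption].
    - rewrite Rmin_left, Rmax_right by lra. intros x Hx.
      apply derivable_continuous_pt. exists (pdu F x v). apply is_derive_Reals.
      apply (Ck_is_derive_u 0), HCe; [apply Rabs_le_between; lra | assumption].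
    - rewrite Rmin_left, Rmax_right in Hc by lra. rewrite Ec.
      apply Rmult_le_compat_r; [lra|]. left. apply HCe; [apply Rabs_le_between; lra|assumption]. }
  assert (Hlip : forall a b v, Rabs a <= e -> Rabs b <= e -> Rabs v <= e ->
    m * Rabs (b - a) <= Rabs (F b v - F a v)).
  { intros a b v Ha Hb Hv. apply Rabs_le_between in Ha, Hb.
    destruct (Rle_dec a b) as [L|L].
    - rewrite Rabs_pos_eq by lra. eapply Rle_trans; [|apply Rle_abs]. apply Hmono; lra.
    - rewrite Rabs_minus_sym, (Rabs_minus_sym (F b v)), Rabs_pos_eq by lra.
      eapply Rle_trans; [|apply Rle_abs]. apply Hmono; lra. }
  assert (Hme : 0 < m * e / 2) by (apply Rdiv_lt_0_compat; [apply Rmult_lt_0_compat|]; lra).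
  assert (He0 : Rabs e <= e) by (rewrite Rabs_pos_eq; lra).
  assert (He1 : Rabs (- e) <= e) by (rewrite Rabs_Ropp; exact He0).
  assert (H00 : Rabs 0 <= e) by (rewrite Rabs_R0; lra).
  destruct (Ck_continuity 0 F e 0 (proj1 (HCe e 0 He0 H00) _) (mkposreal _ Hme)) as [r1 Hr1].
  destruct (Ck_continuity 0 F (- e) 0 (proj1 (HCe (- e) 0 He1 H00) _) (mkposreal _ Hme))
    as [r2 Hr2]. simpl in Hr1, Hr2.
  set (dl := Rmin (Rmin r1 r2) (Rmin e (m * e / 2))).
  assert (Hdl : 0 < dl).
  { apply Rmin_glb_lt; apply Rmin_glb_lt; try assumption; apply cond_pos. }
  assert (L12 : dl <= r1 /\ dl <= r2 /\ dl <= e /\ dl <= m * e / 2).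
  { assert (A1 := Rmin_l (Rmin r1 r2) (Rmin e (m * e / 2))).
    assert (A2 := Rmin_r (Rmin r1 r2) (Rmin e (m * e / 2))).
    assert (A3 := Rmin_l r1 r2). assert (A4 := Rmin_r r1 r2).
    assert (A5 := Rmin_l e (m * e / 2)). assert (A6 := Rmin_r e (m * e / 2)).
    unfold dl. repeat split; lra. }
  destruct L12 as [L1 [L2 [L3 L4]]].
  set (phi := fun s v => epsilon (inhabits 0) (fun u => Rabs u <= e /\ F u v = s)).
  assert (Hex : forall s v, box dl s v -> Rabs (phi s v) <= e /\ F (phi s v) v = s).
  { intros s v [Hs Hv]. unfold phi. apply epsilon_spec.
    assert (Hve : Rabs v <= e) by lra.
    assert (Q1 := Hmono 0 e 0 ltac:(lra) ltac:(lra) ltac:(lra) H00).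
    assert (Q2 := Hmono (- e) 0 0 ltac:(lra) ltac:(lra) ltac:(lra) H00).
    assert (Q3 : Rabs (F e v - F e 0) < m * e / 2)
      by (apply Hr1; unfold Rminus; rewrite ?Rplus_opp_r, ?Ropp_0, ?Rplus_0_r, ?Rabs_R0;
          try apply cond_pos; lra).
    assert (Q4 : Rabs (F (- e) v - F (- e) 0) < m * e / 2)
      by (apply Hr2; unfold Rminus; rewrite ?Rplus_opp_r, ?Ropp_0, ?Rplus_0_r, ?Rabs_R0;
          try apply cond_pos; lra).
    apply Rabs_lt_between in Q3, Q4, Hs. rewrite F0 in Q1, Q2.
    destruct (IVT_interv (fun u => F u v - s) (- e) e) as [u [Hu Eu]].
    - intros a Ha. apply continuity_pt_minus; [|apply continuity_pt_const; intros ? ?; reflexivity].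
      apply derivable_continuous_pt. exists (pdu F a v). apply is_derive_Reals.
      apply (Ck_is_derive_u 0), HCe; [apply Rabs_le_between; lra | assumption].
    - lra.
    - lra.
    - lra.
    - exists u. split; [apply Rabs_le_between; lra | lra]. }
  assert (Hcont : forall s v, box dl s v -> continuity_2d_pt phi s v).
  { intros s v Hb eps. destruct (Hex s v Hb) as [X1 X2].
    assert (Heps : 0 < m * eps / 2).
    { assert (P := cond_pos eps). apply Rdiv_lt_0_compat; [apply Rmult_lt_0_compat|]; lra. }
    assert (Hve : Rabs v <= e) by (destruct Hb; lra).
    assert (Hf : continuity_2d_pt (fun _ w => F (phi s v) w) s v).
    { apply (continuity_2d_pt_comp F (fun _ _ => phi s v) (fun _ w => w)).
      - apply (Ck_continuity 0), HCe; assumption.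
      - apply continuity_2d_pt_const.
      - apply continuity_2d_pt_id2. }
    near_and (box_open _ _ _ Hb) (locally_2d_and _ _ _ _ (Hf (mkposreal _ Heps))
      (continuity_2d_pt_id1 s v (mkposreal _ Heps))).
    apply locally_2d_mono. simpl. intros t w [B1 [B2 B3]].
    destruct (Hex t w B1) as [Y1 Y2].
    assert (Hwe : Rabs w <= e) by (destruct B1; lra).
    assert (Q := Hlip (phi s v) (phi t w) w X1 Y1 Hwe). rewrite Y2 in Q.
    apply Rmult_lt_reg_l with m; [exact Hm|]. apply Rle_lt_trans with (1 := Q).
    rewrite X2 in B2.
    replace (t - F (phi s v) w) with ((t - s) - (F (phi s v) w - s)) by ring.
    unfold Rminus at 1. eapply Rle_lt_trans; [apply Rabs_triang|]. rewrite Rabs_Ropp. lra. }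
  assert (Hdiff : forall s v, box dl s v -> differentiable_pt_lim phi s v
    (/ pdu F (phi s v) v) (- pdv F (phi s v) v / pdu F (phi s v) v)).
  { intros s v Hb. destruct (Hex s v Hb) as [X1 X2].
    assert (Hve : Rabs v <= e) by (destruct Hb; lra).
    destruct (HCe _ _ X1 Hve) as [Z1 Z2].
    apply (differentiable_pt_lim_implicit F).
    - apply (Ck_differentiable 0), Z1.
    - lra.
    - apply Hcont, Hb.
    - generalize (box_open _ _ _ Hb). apply locally_2d_mono. intros t w Hw.
      apply Hex, Hw. }
  assert (HCk : forall n s v, box dl s v -> Ck n phi s v).
  { induction n as [|n IH]; intros s v Hb;
      assert (Hc : locally_2d (fun t w => continuity_2d_pt phi t w) s v)
        by (generalize (box_open _ _ _ Hb); apply locally_2d_mono; exact Hcont).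
    - apply Ck_0, Hc.
    - destruct (Hex s v Hb) as [X1 X2].
      assert (Hve : Rabs v <= e) by (destruct Hb; lra).
      destruct (HCe _ _ X1 Hve) as [Z1 Z2].
      assert (Hi : Ck n (fun t w => / pdu F (phi t w) w) s v).
      { apply (Ck_inv n (fun t w => pdu F (phi t w) w)); [lra|].
        apply (Ck_comp n (pdu F) phi (fun _ w => w)); [apply Ck_pdu, Z1 | apply IH, Hb | apply Ck_snd]. }
      apply Ck_intro with (fun t w => / pdu F (phi t w) w)
        (fun t w => (- 1) * pdv F (phi t w) w * / pdu F (phi t w) w).
      + exact Hc.
      + generalize (box_open _ _ _ Hb). apply locally_2d_mono. intros t w Hw.
        eapply differentiable_pt_lim_is_derive_u, Hdiff, Hw.
      + generalize (box_open _ _ _ Hb). apply locally_2d_mono. intros t w Hw.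
        replace (-1 * pdv F (phi t w) w * / pdu F (phi t w) w)
          with (- pdv F (phi t w) w / pdu F (phi t w) w) by (unfold Rdiv; ring).
        eapply differentiable_pt_lim_is_derive_v, Hdiff, Hw.
      + exact Hi.
      + apply Ck_mult; [|exact Hi]. apply Ck_mult; [apply Ck_const|].
        apply (Ck_comp n (pdv F) phi (fun _ w => w)); [apply Ck_pdv, Z1 | apply IH, Hb | apply Ck_snd]. }
  exists phi. repeat split.
  - apply locally_2d_box. exists dl. split; [assumption|]. intros u v Hb n. apply HCk, Hb.
  - apply locally_2d_box. exists dl. split; [assumption|]. intros u v Hb. apply Hex, Hb.
  - assert (Hb0 : locally_2d (box dl) (F 0 0) 0).
    { rewrite F0. apply box_open. split; rewrite Rabs_R0; lra. }
    assert (Hb1 := locally_2d_comp (box dl) F (fun _ v => v) 0 0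
      (smooth_at_continuity _ _ _ HF) (continuity_2d_pt_id2 0 0) Hb0).
    assert (Hb2 : locally_2d (box e) 0 0).
    { apply box_open. split; rewrite Rabs_R0; lra. }
    near_and Hb1 Hb2. apply locally_2d_mono. intros u v [B1 [B2 B3]].
    destruct (Hex _ _ B1) as [X1 X2].
    assert (Q := Hlip u (phi (F u v) v) v ltac:(lra) X1 ltac:(lra)).
    rewrite X2 in Q. unfold Rminus at 2 in Q. rewrite Rplus_opp_r, Rabs_R0 in Q.
    assert (Q0 := Rabs_pos (phi (F u v) v - u)).
    assert (Q1 : Rabs (phi (F u v) v - u) = 0) by nra.
    apply Rabs_eq_0 in Q1. lra.
Qed.

Lemma implicit_function F :
  smooth_at F 0 0 -> F 0 0 = 0 -> pdu F 0 0 <> 0 ->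
  exists phi, smooth_at phi 0 0 /\ phi 0 0 = 0 /\
    locally_2d (fun s v => F (phi s v) v = s) 0 0 /\
    locally_2d (fun u v => phi (F u v) v = u) 0 0.
Proof.
  intros HF F0 Hp.
  assert (H : exists phi, smooth_at phi 0 0 /\
    locally_2d (fun s v => F (phi s v) v = s) 0 0 /\
    locally_2d (fun u v => phi (F u v) v = u) 0 0).
  { destruct (Rdichotomy _ _ Hp) as [Hn|Hn]; [|apply implicit_function_pos; assumption].
    destruct (implicit_function_pos (fun u v => - F u v)) as [phi [H1 [H2 H3]]].
    - apply smooth_at_opp, HF.
    - rewrite F0. ring.
    - unfold pdu. rewrite Derive_opp. unfold pdu in Hn. lra.
    - assert (Ho : smooth_at (fun s _ => - s) 0 0) by apply smooth_at_opp, smooth_at_fst.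
      exists (fun s v => phi (- s) v). repeat split.
      + apply (smooth_at_comp phi (fun s _ => - s) (fun _ v => v));
          [rewrite Ropp_0; assumption | exact Ho | apply smooth_at_snd].
      + assert (H2' : locally_2d (fun s v => - F (phi (- s) v) v = - s) 0 0).
        { apply (locally_2d_comp (fun s v => - F (phi s v) v = s) (fun s _ => - s) (fun _ v => v));
            [apply smooth_at_continuity, Ho | apply continuity_2d_pt_id2
            | rewrite Ropp_0; exact H2]. }
        revert H2'. apply locally_2d_mono. intros. lra.
      + exact H3. }
  destruct H as [phi [H1 [H2 H3]]]. exists phi. repeat split; try assumption.
  apply locally_2d_singleton in H3. rewrite F0 in H3. exact H3.
Qed.

(** The equation [B u v = y] is solved for [v] first.  Substituting the solution in
    [A u v = x] leaves an equation in [u] whose derivative is the Jacobian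
    determinant divided by [B_v]. *)
Lemma inverse_function_germ2 A B :
  smooth_at A 0 0 -> smooth_at B 0 0 -> A 0 0 = 0 -> B 0 0 = 0 ->
  pdv B 0 0 <> 0 -> pdu A 0 0 * pdv B 0 0 - pdv A 0 0 * pdu B 0 0 <> 0 ->
  exists k, diffeo_germ2 (fun u v => (A u v, B u v)) k.
Proof.
  intros HA HB A0 B0 HBv Hdet.
  assert (HB' : smooth_at (fun v u => B u v) 0 0).
  { apply (smooth_at_comp B (fun _ u => u) (fun v _ => v));
      [assumption | apply smooth_at_snd | apply smooth_at_fst]. }
  destruct (implicit_function (fun v u => B u v) HB' B0 HBv) as [b [Hb [b0 [Hb1 Hb2]]]].
  set (C := fun u y => A u (b y u)).
  assert (Hb' : smooth_at (fun u y => b y u) 0 0).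
  { apply (smooth_at_comp b (fun _ y => y) (fun u _ => u));
      [assumption | apply smooth_at_snd | apply smooth_at_fst]. }
  assert (HC : smooth_at C 0 0).
  { apply (smooth_at_comp A (fun u _ => u) (fun u y => b y u));
      [rewrite b0; assumption | apply smooth_at_fst | exact Hb']. }
  assert (C0 : C 0 0 = 0) by (unfold C; rewrite b0; exact A0).
  assert (Did : is_derive (fun z : R => z) 0 1) by apply (is_derive_id (K := R_AbsRing)).
  assert (Db := smooth_at_is_derive_v _ _ _ Hb).
  assert (HCu : pdu C 0 0 <> 0).
  { assert (E1 : pdu C 0 0 = pdu A 0 0 * 1 + pdv A 0 0 * pdv b 0 0).
    { apply is_derive_unique. unfold C.
      assert (D := smooth_at_is_derive_comp A (fun z => z) (fun z => b 0 z) 0 1 (pdv b 0 0)).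
      cbv beta in D. rewrite b0 in D. apply D; assumption. }
    assert (E2 : pdu B 0 0 * 1 + pdv B 0 0 * pdv b 0 0 = 0).
    { assert (D := smooth_at_is_derive_comp B (fun z => z) (fun z => b 0 z) 0 1 (pdv b 0 0)).
      cbv beta in D. rewrite b0 in D. specialize (D HB Did Db).
      apply is_derive_unique in D. rewrite <- D.
      rewrite (Derive_ext_loc _ (fun _ => 0)); [apply Derive_const|].
      exact (locally_2d_1d_const_x _ _ _ Hb1). }
    rewrite E1. intros E3. apply Hdet.
    assert (X : pdu A 0 0 = - (pdv A 0 0 * pdv b 0 0)) by lra.
    assert (Y : pdu B 0 0 = - (pdv B 0 0 * pdv b 0 0)) by lra.
    rewrite X, Y. ring. }
  destruct (implicit_function C HC C0 HCu) as [c [Hc [c0 [Hc1 Hc2]]]].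
  assert (Hbc : smooth_at (fun x y => b y (c x y)) 0 0).
  { apply (smooth_at_comp b (fun _ y => y) c);
      [rewrite c0; assumption | apply smooth_at_snd | exact Hc]. }
  exists (fun x y => (c x y, b y (c x y))).
  unfold diffeo_germ2, smooth_map_germ2. rewrite !smooth_germ2_iff. cbn [fst snd].
  repeat split; try assumption.
  - rewrite A0, B0. reflexivity.
  - rewrite c0, b0. reflexivity.
  - assert (H1 : locally_2d (fun u v => b (B u v) u = v) 0 0)
      by exact (locally_2d_swap _ _ _ Hb2).
    assert (H2 : locally_2d (fun u v => c (C u (B u v)) (B u v) = u) 0 0).
    { apply (locally_2d_comp (fun u y => c (C u y) y = u) (fun u _ => u) B);
        [apply continuity_2d_pt_id1 | apply smooth_at_continuity, HB | rewrite B0; exact Hc2]. }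
    near_and H1 H2. apply locally_2d_mono. intros u v [E1 E2].
    unfold C in E2. rewrite E1 in E2. rewrite E2, E1. reflexivity.
  - assert (H1 : locally_2d (fun x y => B (c x y) (b y (c x y)) = y) 0 0).
    { apply (locally_2d_comp (fun y u => B u (b y u) = y) (fun _ y => y) c);
        [apply continuity_2d_pt_id2 | apply smooth_at_continuity, Hc | rewrite c0; exact Hb1]. }
    near_and H1 Hc1. apply locally_2d_mono. intros x y [E1 E2].
    unfold C in E2. rewrite E2, E1. reflexivity.
Qed.

(** * Germs of diffeomorphisms *)
Lemma diffeo_germ2_sym h k : diffeo_germ2 h k -> diffeo_germ2 k h.
Proof. unfold diffeo_germ2. tauto. Qed.

Lemma diffeo_germ2_continuity h k :
  diffeo_germ2 h k -> continuity_2d_pt (fun x y => fst (h x y)) 0 0 /\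
    continuity_2d_pt (fun x y => snd (h x y)) 0 0.
Proof.
  intros [[H1 H2] _]. apply smooth_germ2_iff in H1, H2.
  split; apply smooth_at_continuity; assumption.
Qed.

Lemma locally_2d_diffeo (P : R -> R -> Prop) h k :
  diffeo_germ2 h k -> locally_2d P 0 0 ->
  locally_2d (fun x y => P (fst (h x y)) (snd (h x y))) 0 0.
Proof.
  intros H HP. destruct (diffeo_germ2_continuity _ _ H) as [H1 H2].
  destruct H as [_ [_ [E _]]].
  apply (locally_2d_comp P (fun x y => fst (h x y)) (fun x y => snd (h x y)));
    [assumption.. | rewrite E; exact HP].
Qed.

Lemma smooth_at_diffeo F h k :
  diffeo_germ2 h k -> smooth_at F 0 0 ->
  smooth_at (fun x y => F (fst (h x y)) (snd (h x y))) 0 0.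
Proof.
  intros [[H1 H2] [_ [E _]]] HF. apply smooth_germ2_iff in H1, H2.
  apply (smooth_at_comp F (fun x y => fst (h x y)) (fun x y => snd (h x y)));
    [rewrite E; exact HF | assumption..].
Qed.

Lemma diffeo_germ2_comp h1 k1 h2 k2 :
  diffeo_germ2 h1 k1 -> diffeo_germ2 h2 k2 ->
  diffeo_germ2 (fun x y => h2 (fst (h1 x y)) (snd (h1 x y)))
    (fun x y => k1 (fst (k2 x y)) (snd (k2 x y))).
Proof.
  intros D1 D2. assert (D1' := D1). assert (D2' := D2).
  assert (S1 := diffeo_germ2_sym _ _ D1). assert (S2 := diffeo_germ2_sym _ _ D2).
  destruct D1 as [[A1 A2] [[B1 B2] [Z1 [Z2 [I1 I2]]]]].
  destruct D2 as [[C1 C2] [[E1 E2] [Z3 [Z4 [I3 I4]]]]].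
  unfold diffeo_germ2, smooth_map_germ2. rewrite !smooth_germ2_iff in *.
  repeat split.
  - apply (smooth_at_diffeo (fun x y => fst (h2 x y)) _ _ D1'), C1.
  - apply (smooth_at_diffeo (fun x y => snd (h2 x y)) _ _ D1'), C2.
  - apply (smooth_at_diffeo (fun x y => fst (k1 x y)) _ _ S2), B1.
  - apply (smooth_at_diffeo (fun x y => snd (k1 x y)) _ _ S2), B2.
  - rewrite Z1. exact Z3.
  - rewrite Z4. exact Z2.
  - near_and I1 (locally_2d_diffeo _ _ _ D1' I3). apply locally_2d_mono.
    intros u v [X Y]. rewrite Y. exact X.
  - near_and I4 (locally_2d_diffeo _ _ _ S2 I2). apply locally_2d_mono.
    intros u v [X Y]. rewrite Y. exact X.
Qed.

Lemma A_equivalent_precomp g1 g2 g3 h k :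
  diffeo_germ2 h k ->
  locally_2d (fun x y => g1 x y = g2 (fst (h x y)) (snd (h x y))) 0 0 ->
  A_equivalent g2 g3 -> A_equivalent g1 g3.
Proof.
  intros D E [h' [k' [xi [eta [D' [Dx E']]]]]].
  assert (E0 : g1 0 0 = g2 0 0).
  { apply locally_2d_singleton in E. rewrite E. destruct D as [_ [_ [Z _]]].
    rewrite Z. reflexivity. }
  exists (fun x y => k (fst (h' x y)) (snd (h' x y))),
    (fun x y => k' (fst (h x y)) (snd (h x y))), xi, eta.
  split; [|split; [rewrite E0; exact Dx|]].
  { apply (diffeo_germ2_comp h' k' k h); [assumption | apply diffeo_germ2_sym; assumption]. }
  near_and E (locally_2d_diffeo _ _ _ D E'). apply locally_2d_mono.
  intros x y [X Y]. rewrite X. exact Y.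
Qed.

Lemma A_singularity_precomp n g1 g2 h k :
  diffeo_germ2 h k ->
  locally_2d (fun x y => g1 x y = g2 (fst (h x y)) (snd (h x y))) 0 0 ->
  A_singularity n g2 -> A_singularity n g1.
Proof.
  intros D E [s1 [s2 [H1 [H2 H3]]]]. exists s1, s2. repeat split; try assumption.
  eapply A_equivalent_precomp; eassumption.
Qed.

(** * Orders of vanishing on the axis *)

Definition bigO (m : nat) (phi : R -> R) : Prop :=
  exists M, locally 0 (fun u => Rabs (phi u) <= M * Rabs u ^ m).

Lemma bigO_ext m (phi psi : R -> R) :
  locally 0 (fun u => phi u = psi u) -> bigO m phi -> bigO m psi.
Proof.
  intros E [M H]. exists M. generalize (filter_and _ _ E H). apply filter_imp.
  intros u [A B]. rewrite <- A. exact B.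
Qed.

Lemma locally_Rabs_lt (d : R) : 0 < d -> locally 0 (fun u => Rabs u < d).
Proof.
  intros Hd. exists (mkposreal d Hd). intros u Hu.
  unfold ball in Hu; simpl in Hu; unfold AbsRing_ball, abs, minus, plus, opp in Hu;
    simpl in Hu.
  rewrite Ropp_0, Rplus_0_r in Hu. exact Hu.
Qed.

Lemma bigO_le m k (phi : R -> R) : (k <= m)%nat -> bigO m phi -> bigO k phi.
Proof.
  intros L [M H]. exists (Rabs M). generalize (filter_and _ _ H (locally_Rabs_lt 1 Rlt_0_1)).
  apply filter_imp. intros u [A B]. apply Rle_trans with (1 := A).
  apply Rle_trans with (Rabs M * Rabs u ^ m).
  - apply Rmult_le_compat_r; [apply pow_le, Rabs_pos | apply Rle_abs].
  - apply Rmult_le_compat_l; [apply Rabs_pos|].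
    replace m with (k + (m - k))%nat by lia. rewrite pow_add.
    rewrite <- (Rmult_1_r (Rabs u ^ k)) at 2.
    apply Rmult_le_compat_l; [apply pow_le, Rabs_pos|].
    rewrite <- (pow1 (m - k)). apply pow_incr. split; [apply Rabs_pos | lra].
Qed.

Lemma bigO_plus m phi psi :
  bigO m phi -> bigO m psi -> bigO m (fun u => phi u + psi u).
Proof.
  intros [M H] [N K]. exists (M + N). generalize (filter_and _ _ H K).
  apply filter_imp. intros u [A B]. eapply Rle_trans; [apply Rabs_triang|]. lra.
Qed.

Lemma bigO_mult m k phi psi :
  bigO m phi -> bigO k psi -> bigO (m + k) (fun u => phi u * psi u).
Proof.
  intros [M H] [N K]. exists (M * N). generalize (filter_and _ _ H K).
  apply filter_imp. intros u [A B]. rewrite Rabs_mult, pow_add.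
  replace (M * N * (Rabs u ^ m * Rabs u ^ k))
    with ((M * Rabs u ^ m) * (N * Rabs u ^ k)) by ring.
  apply Rmult_le_compat; try apply Rabs_pos; assumption.
Qed.

Lemma bigO_continuous (phi : R -> R) : continuous phi 0 -> bigO 0 phi.
Proof.
  intros H. exists (Rabs (phi 0) + 1).
  apply continuity_pt_filterlim in H. rewrite continuity_pt_locally in H.
  generalize (H (mkposreal 1 Rlt_0_1)). apply filter_imp. simpl. intros u A.
  assert (B := Rabs_triang (phi u - phi 0) (phi 0)).
  replace (phi u - phi 0 + phi 0) with (phi u) in B by ring. lra.
Qed.

Lemma bigO_pow m : bigO m (fun u => u ^ m).
Proof.
  exists 1. apply filter_forall. intros u. rewrite RPow_abs. lra.
Qed.

Lemma bigO_pow_mult m (phi : R -> R) : continuous phi 0 -> bigO m (fun u => u ^ m * phi u).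
Proof.
  intros H. rewrite <- (Nat.add_0_r m) at 1.
  apply bigO_mult; [apply bigO_pow | apply bigO_continuous, H].
Qed.

(** Coefficients are shown to vanish by this comparison: otherwise division by
    [u ^ m] would leave a function with nonzero limit, bounded by a multiple of [u]. *)
Lemma bigO_leading m (phi : R -> R) :
  continuous phi 0 -> bigO (S m) (fun u => u ^ m * phi u) -> phi 0 = 0.
Proof.
  intros Hc [M H].
  destruct (Req_dec (phi 0) 0) as [E|E]; [exact E|]. exfalso.
  assert (Hp : 0 < Rabs (phi 0) / 2) by (assert (Q := Rabs_pos_lt _ E); lra).
  apply continuity_pt_filterlim in Hc. rewrite continuity_pt_locally in Hc.
  specialize (Hc (mkposreal _ Hp)). simpl in Hc.
  destruct (filter_and _ _ H Hc) as [d Hd].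
  assert (HM : 0 < Rabs M + 1) by (assert (Q := Rabs_pos M); lra).
  set (u := Rmin (d / 2) (Rabs (phi 0) / 2 / (Rabs M + 1))).
  assert (Hu : 0 < u).
  { apply Rmin_glb_lt; [assert (Q := cond_pos d); lra | apply Rdiv_lt_0_compat; assumption]. }
  assert (U1 : u <= d / 2) by apply Rmin_l.
  assert (U2 : u <= Rabs (phi 0) / 2 / (Rabs M + 1)) by apply Rmin_r.
  destruct (Hd u) as [A B].
  { unfold ball; simpl; unfold AbsRing_ball, abs, minus, plus, opp; simpl.
    rewrite Ropp_0, Rplus_0_r, Rabs_pos_eq by lra. assert (Q := cond_pos d). lra. }
  rewrite Rabs_mult, <- RPow_abs, (Rabs_pos_eq u) in A by lra. simpl in A.
  assert (Hm : 0 < u ^ m) by (apply pow_lt, Hu).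
  assert (A' : Rabs (phi u) <= M * u).
  { apply Rmult_le_reg_l with (u ^ m); [exact Hm|]. lra. }
  assert (A2 : M * u < Rabs (phi 0) / 2).
  { apply Rle_lt_trans with (Rabs M * u).
    - apply Rmult_le_compat_r; [lra | apply Rle_abs].
    - apply Rlt_le_trans with ((Rabs M + 1) * u); [nra|].
      apply Rle_trans with ((Rabs M + 1) * (Rabs (phi 0) / 2 / (Rabs M + 1))).
      + apply Rmult_le_compat_l; lra.
      + right. field. lra. }
  assert (T := Rabs_triang (phi u) (- (phi u - phi 0))).
  replace (phi u + - (phi u - phi 0)) with (phi 0) in T by ring.
  rewrite Rabs_Ropp in T. lra.
Qed.

(** Applied to both diffeomorphisms of the target, this shows that orders of
    vanishing on the axis are invariant under a change of target coordinate. *)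
Lemma bigO_comp m (eta phi : R -> R) :
  ex_derive eta 0 -> eta 0 = 0 -> bigO (S m) phi -> bigO (S m) (fun u => eta (phi u)).
Proof.
  intros He E0 [M H].
  assert (HO : locally 0 (fun y => Rabs (eta y) <= (Rabs (Derive eta 0) + 1) * Rabs y)).
  { apply Derive_correct, is_derive_Reals in He. specialize (He 1 Rlt_0_1).
    destruct He as [d Hd]. exists d. intros y Hy.
    unfold ball in Hy; simpl in Hy; unfold AbsRing_ball, abs, minus, plus, opp in Hy;
      simpl in Hy. rewrite Ropp_0, Rplus_0_r in Hy.
    destruct (Req_dec y 0) as [Ey|Ey].
    - rewrite Ey, E0, Rabs_R0. lra.
    - specialize (Hd y Ey Hy). rewrite Rplus_0_l, E0, Rminus_0_r in Hd.
      replace (eta y) with (y * (eta y / y - Derive eta 0) + y * Derive eta 0)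
        by (field; exact Ey).
      eapply Rle_trans; [apply Rabs_triang|]. rewrite !Rabs_mult.
      assert (Q := Rabs_pos y). nra. }
  destruct HO as [d Hd].
  set (e := Rmin 1 (d / (Rabs M + 1))).
  assert (HM : 0 < Rabs M + 1) by (assert (Q := Rabs_pos M); lra).
  assert (He' : 0 < e).
  { apply Rmin_glb_lt; [lra | apply Rdiv_lt_0_compat; [apply cond_pos | exact HM]]. }
  exists ((Rabs (Derive eta 0) + 1) * Rabs M).
  generalize (filter_and _ _ H (locally_Rabs_lt e He')). apply filter_imp.
  intros u [A B].
  assert (B1 : Rabs u < 1) by (eapply Rlt_le_trans; [exact B | apply Rmin_l]).
  assert (B2 : Rabs u < d / (Rabs M + 1)) by (eapply Rlt_le_trans; [exact B | apply Rmin_r]).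
  assert (P0 := Rabs_pos u).
  assert (P1 : Rabs u ^ S m <= Rabs u).
  { simpl. rewrite <- (Rmult_1_r (Rabs u)) at 3. apply Rmult_le_compat_l; [exact P0|].
    rewrite <- (pow1 m). apply pow_incr. lra. }
  assert (P2 : 0 <= Rabs u ^ S m) by (apply pow_le, P0).
  assert (A1 : Rabs (phi u) <= Rabs M * Rabs u ^ S m).
  { eapply Rle_trans; [exact A|]. apply Rmult_le_compat_r; [exact P2 | apply Rle_abs]. }
  assert (A2 : Rabs (phi u) < d).
  { apply Rle_lt_trans with (1 := A1). apply Rle_lt_trans with ((Rabs M + 1) * Rabs u).
    - assert (Q := Rabs_pos M). nra.
    - apply Rlt_le_trans with ((Rabs M + 1) * (d / (Rabs M + 1))).
      + apply Rmult_lt_compat_l; assumption.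
      + right. field. lra. }
  eapply Rle_trans.
  - apply Hd. unfold ball; simpl; unfold AbsRing_ball, abs, minus, plus, opp; simpl.
    rewrite Ropp_0, Rplus_0_r. exact A2.
  - rewrite Rmult_assoc. apply Rmult_le_compat_l; [assert (Q := Rabs_pos (Derive eta 0)); lra | exact A1].
Qed.

Lemma continuity_2d_pt_continuous_l F x y :
  continuity_2d_pt F x y -> continuous (fun t => F t y) x.
Proof.
  intros HF. apply continuity_pt_filterlim, continuity_pt_locally. intros eps.
  exact (locally_2d_1d_const_y _ _ _ (HF eps)).
Qed.

Lemma smooth_at_continuous_axis F : smooth_at F 0 0 -> continuous (fun u => F u 0) 0.
Proof. intros H. apply continuity_2d_pt_continuous_l, smooth_at_continuity, H. Qed.

Lemma smooth_at_axis F : smooth_at F 0 0 -> smooth_at (fun u _ => F u 0) 0 0.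
Proof.
  intros H. apply (smooth_at_comp F (fun u _ => u) (fun _ _ => 0));
    [assumption | apply smooth_at_fst | apply smooth_at_const].
Qed.

Lemma axis_division F :
  smooth_at F 0 0 ->
  exists F1, smooth_at F1 0 0 /\ locally 0 (fun u => F u 0 = F 0 0 + u * F1 u 0).
Proof.
  intros HF. destruct (hadamard_u _ HF) as [F1 [H1 E]]. exists F1. split; [exact H1|].
  exact (locally_2d_1d_const_y _ _ _ E).
Qed.

(** The factors [u] are split off one at a time: after [k < m] divisions the
    quotient vanishes at the origin by [bigO_leading]. *)
Lemma axis_factor m F :
  smooth_at F 0 0 -> bigO m (fun u => F u 0) ->
  exists G, smooth_at G 0 0 /\ locally 0 (fun u => F u 0 = u ^ m * G u 0).
Proof.
  induction m as [|m IH]; intros HF HO.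
  - exists F. split; [assumption|]. apply filter_forall. intros. simpl. ring.
  - destruct (IH HF) as [G [HG E]]; [apply bigO_le with (2 := HO); lia|].
    assert (G0 : G 0 0 = 0).
    { apply (bigO_leading m (fun u => G u 0)).
      - apply smooth_at_continuous_axis, HG.
      - apply bigO_ext with (2 := HO). exact E. }
    destruct (axis_division G HG) as [G1 [HG1 E1]]. exists G1. split; [exact HG1|].
    generalize (filter_and _ _ E E1). apply filter_imp. intros u [A B].
    rewrite A, B, G0. simpl. ring.
Qed.

Lemma is_derive_id_mult K x dK :
  is_derive K x dK -> is_derive (fun z => z * K z) x (K x + x * dK).
Proof.
  intros H. evar_last.
  - apply (is_derive_mult (fun z => z) K); [apply (is_derive_id (K := R_AbsRing)) | exact H
      | exact Rmult_comm].
  - unfold plus, mult, one; simpl. ring.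
Qed.

Lemma derive_id_mult_0 K : ex_derive K 0 -> Derive (fun z => z * K z) 0 = K 0.
Proof.
  intros [l H]. apply is_derive_unique. evar_last; [apply is_derive_id_mult, H|]. ring.
Qed.

(** * Recognizing A_2 and A_3 *)

Lemma sign_exists x : x <> 0 -> exists s, (s = 1 \/ s = -1) /\ 0 < s * x.
Proof.
  intros H. destruct (Rdichotomy _ _ H).
  - exists (-1). split; [auto | lra].
  - exists 1. split; [auto | lra].
Qed.

Lemma sign_sq s : s = 1 \/ s = -1 -> s * s = 1.
Proof. intros [E|E]; rewrite E; ring. Qed.

Lemma Rpower_root n x : 0 < x -> Rpower x (/ INR (S n)) ^ S n = x.
Proof.
  intros H. rewrite <- Rpower_pow by (unfold Rpower; apply exp_pos).
  rewrite Rpower_mult, Rinv_l by (apply not_0_INR; discriminate). apply Rpower_1, H.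
Qed.

(** The remainder [Q] is kept as a smooth germ, and not as an error term, because
    its square root is the new coordinate transversal to the axis. *)
Lemma second_order_expansion Y :
  smooth_at Y 0 0 ->
  exists Q, smooth_at Q 0 0 /\ pdv (pdv Y) 0 0 = 2 * Q 0 0 /\
    locally_2d (fun u v => Y u v = Y u 0 + v * pdv Y u 0 + v ^ 2 * Q u v) 0 0.
Proof.
  intros HY. destruct (hadamard_v _ HY) as [Y1 [HY1 E1]].
  destruct (hadamard_v _ HY1) as [Q [HQ E2]].
  assert (D : locally_2d (fun u v => pdv Y u v = Y1 u v + v * pdv Y1 u v) 0 0).
  { near_and (locally_2d_nested _ _ _ E1) (smooth_at_nested _ _ _ HY1).
    apply locally_2d_mono. intros u v [A B]. apply is_derive_unique.
    apply (is_derive_ext_loc (fun z => Y u 0 + z * Y1 u z)).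
    - apply locally_2d_1d_const_x in A. revert A. apply filter_imp. auto.
    - evar_last.
      + apply (is_derive_plus (K := R_AbsRing) (V := R_NormedModule)).
        * apply (is_derive_const (K := R_AbsRing) (V := R_NormedModule)).
        * apply is_derive_id_mult, (smooth_at_is_derive_v Y1), B.
      + unfold plus, zero; simpl. ring. }
  exists Q. repeat split.
  - exact HQ.
  - assert (D1 : pdv Y1 0 0 = Q 0 0).
    { unfold pdv. rewrite (Derive_ext_loc _ (fun v => Y1 0 0 + v * Q 0 v)).
      - rewrite Derive_plus, Derive_const, (derive_id_mult_0 (fun v => Q 0 v)).
        + ring.
        + eexists. apply smooth_at_is_derive_v, HQ.
        + apply ex_derive_const.
        + eexists. apply is_derive_id_mult, (smooth_at_is_derive_v Q), HQ.
      - exact (locally_2d_1d_const_x _ _ _ E2). }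
    assert (Hp := smooth_at_pdv _ _ _ HY1).
    unfold pdv at 1. rewrite (Derive_ext_loc _ (fun v => Y1 0 v + v * pdv Y1 0 v)).
    + rewrite Derive_plus, (derive_id_mult_0 (fun v => pdv Y1 0 v)).
      * transitivity (pdv Y1 0 0 + pdv Y1 0 0); [reflexivity | rewrite D1; ring].
      * eexists. apply smooth_at_is_derive_v, Hp.
      * eexists. apply smooth_at_is_derive_v, HY1.
      * eexists. apply is_derive_id_mult, (smooth_at_is_derive_v (pdv Y1)), Hp.
    + exact (locally_2d_1d_const_x _ _ _ D).
  - assert (D0 := locally_2d_1d_const_y _ _ _ D). simpl in D0.
    assert (D2 : locally_2d (fun u _ => pdv Y u 0 = Y1 u 0 + 0 * pdv Y1 u 0) 0 0).
    { destruct D as [d Hd]. exists d. intros u v Hu Hv. apply Hd; [exact Hu|].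
      rewrite Rminus_0_r, Rabs_R0. apply cond_pos. }
    near_and D2 (locally_2d_and _ _ _ _ E1 E2). apply locally_2d_mono.
    intros u v [A [B C]]. rewrite A, B, C. ring.
Qed.

Lemma locally_axis_2d (P : R -> Prop) : locally 0 P -> locally_2d (fun u _ => P u) 0 0.
Proof. intros [d Hd]. exists d. intros u v Hu Hv. apply Hd. exact Hu. Qed.

Lemma id_diffeo_germ1 : diffeo_germ1 (fun x => x) (fun x => x) 0 0.
Proof.
  assert (S : smooth_germ1 (fun x => x) 0).
  { unfold smooth_germ1. apply filter_forall. intros x n. apply ex_derive_n_ext with (fun z => z ^ 1).
    - intros. ring.
    - apply ex_derive_n_pow. }
  repeat split; try assumption; apply filter_forall; reflexivity.
Qed.

(** With Y(u,0) = u^(n+1) P(u) and Y_v(u,0) = u^3 R(u), completing the square gives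
      Y = Q (v + u^3 R / (2 Q))^2 + u^(n+1) (P - u^(5-n) R^2 / (4 Q)).
    Both brackets and [Q] are units where a root of them has to be taken, so
    B = sqrt |Q| (v + u^3 R / (2 Q)) and A = u |P - ...|^(1/(n+1)) are new
    coordinates in which [Y] is the normal form. *)
Lemma A_singularity_of_jet n Y P :
  (n <= 4)%nat -> smooth_at Y 0 0 -> smooth_at P 0 0 ->
  locally 0 (fun u => Y u 0 = u ^ S n * P u 0) ->
  bigO 3 (fun u => pdv Y u 0) -> pdv (pdv Y) 0 0 <> 0 -> P 0 0 <> 0 ->
  A_singularity n Y.
Proof.
  intros Hn HY HP EP HO HV HP0.
  destruct (second_order_expansion Y HY) as [Q [HQ [E2 EY]]].
  assert (HQ0 : Q 0 0 <> 0) by (intros Z; apply HV; rewrite E2, Z; ring).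
  destruct (axis_factor 3 (pdv Y) (smooth_at_pdv _ _ _ HY) HO) as [Rr [HR ER]].
  destruct (sign_exists _ HP0) as [s1 [S1 P1]]. destruct (sign_exists _ HQ0) as [s2 [S2 P2]].
  set (T := fun u v => P u 0 - u ^ (5 - n) * Rr u 0 ^ 2 / (4 * Q u v)).
  (* 5 - n >= 1, so the correction to [P] vanishes at the origin *)
  assert (HT : smooth_at T 0 0).
  { apply smooth_at_minus; [apply smooth_at_axis, HP|].
    apply smooth_at_div; [lra| |apply smooth_at_scal, HQ].
    apply smooth_at_mult; [apply (smooth_at_pow (fun u _ => u)), smooth_at_fst|].
    apply (smooth_at_pow (fun u _ => Rr u 0)), smooth_at_axis, HR. }
  assert (T0 : T 0 0 = P 0 0).
  { unfold T. rewrite pow_i by lia. field. exact HQ0. }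
  set (rt := fun u v => Rpower (s1 * T u v) (/ INR (S n))).
  assert (Hrt : smooth_at rt 0 0).
  { apply (smooth_at_Rpower _ (fun u v => s1 * T u v)); [rewrite T0; exact P1|].
    apply smooth_at_scal, HT. }
  set (A := fun u v => u * rt u v).
  assert (HA : smooth_at A 0 0) by (apply smooth_at_mult; [apply smooth_at_fst | exact Hrt]).
  set (sq := fun u v => sqrt (s2 * Q u v)).
  assert (Hsq : smooth_at sq 0 0)
    by (apply (smooth_at_sqrt (fun u v => s2 * Q u v)); [exact P2 | apply smooth_at_scal, HQ]).
  set (B := fun u v => sq u v * (v + u ^ 3 * Rr u 0 / (2 * Q u v))).
  assert (HB : smooth_at B 0 0).
  { apply smooth_at_mult; [exact Hsq|]. apply smooth_at_plus; [apply smooth_at_snd|].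
    apply smooth_at_div; [lra| |apply smooth_at_scal, HQ].
    apply smooth_at_mult; [apply (smooth_at_pow (fun u _ => u)), smooth_at_fst|].
    apply smooth_at_axis, HR. }
  assert (A0 : A 0 0 = 0) by (unfold A; ring).
  assert (B0 : B 0 0 = 0) by (unfold B; rewrite pow_i by lia; unfold Rdiv; ring).
  assert (DAu : pdu A 0 0 = rt 0 0).
  { apply (derive_id_mult_0 (fun u => rt u 0)). eexists. apply smooth_at_is_derive_u, Hrt. }
  assert (DAv : pdv A 0 0 = 0).
  { unfold pdv, A. rewrite (Derive_ext _ (fun _ => 0)); [apply Derive_const|]. intros; ring. }
  assert (DBv : pdv B 0 0 = sq 0 0).
  { unfold pdv, B. rewrite (Derive_ext _ (fun v => v * sq 0 v)).
    - apply (derive_id_mult_0 (fun v => sq 0 v)). eexists. apply smooth_at_is_derive_v, Hsq.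
    - intros t. rewrite pow_i by lia. unfold Rdiv. ring. }
  assert (Hrt0 : 0 < rt 0 0) by (unfold rt, Rpower; apply exp_pos).
  assert (Hsq0 : 0 < sq 0 0) by (apply sqrt_lt_R0, P2).
  destruct (inverse_function_germ2 A B HA HB A0 B0) as [k Hk].
  { rewrite DBv. lra. }
  { rewrite DAu, DAv, DBv. nra. }
  assert (P1' : 0 < s1 * T 0 0) by (rewrite T0; exact P1).
  assert (EN : locally_2d (fun u v => Y u v = s1 * A u v ^ (n + 1) + s2 * B u v ^ 2) 0 0).
  { near_and (locally_2d_and _ _ _ _ EY (locally_2d_and _ _ _ _
        (locally_axis_2d _ EP) (locally_axis_2d _ ER)))
      (locally_2d_and _ _ _ _
        (continuity_2d_pt_gt_0 (fun u v => s1 * T u v) 0 0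
          (smooth_at_continuity _ _ _ (smooth_at_scal _ _ _ _ HT))
          P1')
        (continuity_2d_pt_gt_0 (fun u v => s2 * Q u v) 0 0
          (smooth_at_continuity _ _ _ (smooth_at_scal _ _ _ _ HQ)) P2)).
    apply locally_2d_mono. intros u v [[X1 [X2 X3]] [X4 X5]].
    rewrite X1, X2, X3. replace (n + 1)%nat with (S n) by lia.
    unfold A, B, rt, sq. rewrite !Rpow_mult_distr, Rpower_root by exact X4.
    rewrite pow2_sqrt by lra.
    assert (Qn : Q u v <> 0) by (intros Z; rewrite Z in X5; lra).
    transitivity ((s1 * s1) * (u ^ S n * T u v)
      + (s2 * s2) * (Q u v * (v + u ^ 3 * Rr u 0 / (2 * Q u v)) ^ 2)); [|ring].
    rewrite !sign_sq by assumption. unfold T.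
    replace (1 * (u ^ S n * (P u 0 - u ^ (5 - n) * Rr u 0 ^ 2 / (4 * Q u v))))
      with (u ^ S n * P u 0 - (u ^ S n * u ^ (5 - n)) * Rr u 0 ^ 2 / (4 * Q u v))
      by (field; exact Qn).
    rewrite <- pow_add. replace (S n + (5 - n))%nat with 6%nat by lia. field. exact Qn. }
  assert (Y0 : Y 0 0 = 0).
  { apply locally_2d_singleton in EN. rewrite EN, A0, B0, !pow_i by lia. ring. }
  exists s1, s2. split; [exact S1|]. split; [exact S2|].
  exists k, (fun u v => (A u v, B u v)), (fun x => x), (fun x => x).
  split; [apply diffeo_germ2_sym, Hk|]. split.
  - rewrite Y0, !pow_i by lia. replace (s1 * 0 + s2 * 0) with 0 by ring. apply id_diffeo_germ1.
  - exact EN.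
Qed.

Lemma axis_division_pdu F :
  smooth_at F 0 0 -> F 0 0 = 0 ->
  exists F1, smooth_at F1 0 0 /\ F1 0 0 = pdu F 0 0 /\
    locally 0 (fun u => F u 0 = u * F1 u 0).
Proof.
  intros HF F0. destruct (axis_division F HF) as [F1 [H1 E]].
  assert (E' : locally 0 (fun u => F u 0 = u * F1 u 0)).
  { revert E. apply filter_imp. intros u A. rewrite A, F0. ring. }
  exists F1. repeat split; [exact H1 | | exact E'].
  symmetry. transitivity (Derive (fun u => u * F1 u 0) 0); [apply Derive_ext_loc, E'|].
  apply (derive_id_mult_0 (fun u => F1 u 0)). eexists. apply smooth_at_is_derive_u, H1.
Qed.

(** By the chain rule the product of the Jacobian determinants of [h] and [k] is 1. *)
Lemma diffeo_germ2_jacobian h k :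
  diffeo_germ2 h k ->
  pdu (fun x y => fst (k x y)) 0 0 * pdv (fun x y => snd (k x y)) 0 0 -
  pdv (fun x y => fst (k x y)) 0 0 * pdu (fun x y => snd (k x y)) 0 0 <> 0.
Proof.
  intros [[A1 A2] [[B1 B2] [_ [K0 [_ I]]]]].
  apply smooth_germ2_iff in A1, A2, B1, B2.
  set (p := fun x y => fst (k x y)) in *. set (q := fun x y => snd (k x y)) in *.
  set (a := fun x y => fst (h x y)) in *. set (b := fun x y => snd (h x y)) in *.
  assert (p0 : p 0 0 = 0) by (unfold p; rewrite K0; reflexivity).
  assert (q0 : q 0 0 = 0) by (unfold q; rewrite K0; reflexivity).
  assert (Iu := locally_2d_1d_const_y _ _ _ I). assert (Iv := locally_2d_1d_const_x _ _ _ I).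
  assert (U : forall F, smooth_at F 0 0 ->
    is_derive (fun t => F (p t 0) (q t 0)) 0 (pdu F 0 0 * pdu p 0 0 + pdv F 0 0 * pdu q 0 0)).
  { intros F HF.
    assert (D := smooth_at_is_derive_comp F (fun t => p t 0) (fun t => q t 0) 0
      (pdu p 0 0) (pdu q 0 0)). cbv beta in D. rewrite p0, q0 in D.
    apply D; [assumption | apply smooth_at_is_derive_u, B1 | apply smooth_at_is_derive_u, B2]. }
  assert (V : forall F, smooth_at F 0 0 ->
    is_derive (fun t => F (p 0 t) (q 0 t)) 0 (pdu F 0 0 * pdv p 0 0 + pdv F 0 0 * pdv q 0 0)).
  { intros F HF.
    assert (D := smooth_at_is_derive_comp F (fun t => p 0 t) (fun t => q 0 t) 0
      (pdv p 0 0) (pdv q 0 0)). cbv beta in D. rewrite p0, q0 in D.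
    apply D; [assumption | apply smooth_at_is_derive_v, B1 | apply smooth_at_is_derive_v, B2]. }
  assert (E1 : pdu a 0 0 * pdu p 0 0 + pdv a 0 0 * pdu q 0 0 = 1).
  { rewrite <- (is_derive_unique _ _ _ (U a A1)), <- (Derive_id 0). apply Derive_ext_loc.
    revert Iu. apply filter_imp. intros t E. unfold a, p, q. rewrite E. reflexivity. }
  assert (E2 : pdu b 0 0 * pdv p 0 0 + pdv b 0 0 * pdv q 0 0 = 1).
  { rewrite <- (is_derive_unique _ _ _ (V b A2)), <- (Derive_id 0). apply Derive_ext_loc.
    revert Iv. apply filter_imp. intros t E. unfold b, p, q. rewrite E. reflexivity. }
  assert (E3 : pdu a 0 0 * pdv p 0 0 + pdv a 0 0 * pdv q 0 0 = 0).
  { rewrite <- (is_derive_unique _ _ _ (V a A1)).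
    transitivity (Derive (fun _ : R => 0) 0); [|apply Derive_const]. apply Derive_ext_loc.
    revert Iv. apply filter_imp. intros t E. unfold a, p, q. rewrite E. reflexivity. }
  intros D.
  assert (X : (pdu a 0 0 * pdv b 0 0 - pdv a 0 0 * pdu b 0 0) *
    (pdu p 0 0 * pdv q 0 0 - pdv p 0 0 * pdu q 0 0) =
    (pdu a 0 0 * pdu p 0 0 + pdv a 0 0 * pdu q 0 0) * (pdu b 0 0 * pdv p 0 0 + pdv b 0 0 * pdv q 0 0)
    - (pdu a 0 0 * pdv p 0 0 + pdv a 0 0 * pdv q 0 0) *
      (pdu b 0 0 * pdu p 0 0 + pdv b 0 0 * pdu q 0 0)) by ring.
  rewrite E1, E2, E3, D in X. lra.
Qed.

Lemma locally_axis (P : R -> R -> Prop) : locally_2d P 0 0 -> locally 0 (fun u => P u 0).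
Proof. intros H. exact (locally_2d_1d_const_y _ _ _ H). Qed.

(** Let (p, q) be the change of coordinates that brings [Y] to the form
    [xi] composed with [s1 p^(n+1) + s2 q^2].  If [Y(u,0)] has order at least 3,
    then q(u,0) must have order at least 2, for otherwise the square would
    contribute a term of order 2.  Hence q_u = 0 at the origin, and
    invertibility forces p_u and q_v to be nonzero there.  The germs [p1], [q2]
    are the quotients p(u,0) / u and q(u,0) / u^2, while [pv], [qv] are the
    derivatives of [p], [q] transversal to the axis; the last clause is the
    v-derivative of [s1 p^(n+1) + s2 q^2], which is [eta' (Y)] times that of [Y]. *)
Lemma A_singularity_axis n Y :
  (2 <= n)%nat -> smooth_at Y 0 0 -> Y 0 0 = 0 -> A_singularity n Y ->
  bigO 3 (fun u => Y u 0) ->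
  exists (xi eta : R -> R) (s1 s2 : R) (p1 q2 pv qv : R -> R -> R),
    ex_derive xi 0 /\ xi 0 = 0 /\ ex_derive eta 0 /\ eta 0 = 0 /\
    (s1 = 1 \/ s1 = -1) /\ (s2 = 1 \/ s2 = -1) /\
    smooth_at p1 0 0 /\ smooth_at q2 0 0 /\ smooth_at pv 0 0 /\ smooth_at qv 0 0 /\
    p1 0 0 <> 0 /\ qv 0 0 <> 0 /\
    locally 0 (fun u => Y u 0 =
      xi (s1 * (u * p1 u 0) ^ (n + 1) + s2 * (u ^ 2 * q2 u 0) ^ 2)) /\
    locally 0 (fun u => eta (Y u 0) =
      s1 * (u * p1 u 0) ^ (n + 1) + s2 * (u ^ 2 * q2 u 0) ^ 2) /\
    (forall m, bigO m (fun u => pdv Y u 0) ->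
      bigO m (fun u => s1 * (INR (n + 1) * pv u 0 * (u * p1 u 0) ^ n)
        + s2 * (2 * qv u 0 * (u ^ 2 * q2 u 0)))).
Proof.
  intros Hn HY Y0 [s1 [s2 [S1 [S2 [h [k [xi [eta [D [Dx E]]]]]]]]]] HO.
  rewrite Y0 in Dx. rewrite !pow_i in Dx by lia.
  replace (s1 * 0 + s2 * 0) with 0 in Dx by ring.
  destruct Dx as [X1 [X2 [X3 [X4 [X5 X6]]]]].
  assert (J := diffeo_germ2_jacobian _ _ D).
  destruct D as [_ [[B1 B2] [_ [K0 _]]]]. apply smooth_germ2_iff in B1, B2.
  set (p := fun x y => fst (k x y)) in *. set (q := fun x y => snd (k x y)) in *.
  assert (p0 : p 0 0 = 0) by (unfold p; rewrite K0; reflexivity).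
  assert (q0 : q 0 0 = 0) by (unfold q; rewrite K0; reflexivity).
  set (Phi := fun u v => s1 * p u v ^ (n + 1) + s2 * q u v ^ 2).
  assert (HPhi : smooth_at Phi 0 0).
  { apply smooth_at_plus; apply smooth_at_scal, smooth_at_pow; assumption. }
  assert (Phi0 : Phi 0 0 = 0) by (unfold Phi; rewrite p0, q0, !pow_i by lia; ring).
  assert (EY : locally_2d (fun u v => Y u v = xi (Phi u v)) 0 0) by exact E.
  assert (EPhi : locally_2d (fun u v => eta (Y u v) = Phi u v) 0 0).
  { assert (X : locally_2d (fun u _ => eta (xi u) = u) (Phi 0 0) 0).
    { rewrite Phi0. apply locally_axis_2d, X5. }
    apply (locally_2d_comp (fun u _ => eta (xi u) = u) Phi (fun _ _ => 0)) in X;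
      [|apply smooth_at_continuity, HPhi | apply continuity_2d_pt_const].
    near_and EY X. apply locally_2d_mono. intros u v [F G]. rewrite F. exact G. }
  assert (Dxi : ex_derive xi 0) by (apply locally_singleton in X1; exact (X1 1%nat)).
  assert (Deta : ex_derive eta 0) by (apply locally_singleton in X2; exact (X2 1%nat)).
  destruct (axis_division_pdu p B1 p0) as [p1 [Hp1 [P1 EP]]].
  destruct (axis_division_pdu q B2 q0) as [q1 [Hq1 [Q1 EQ]]].
  assert (HOP : bigO 3 (fun u => Phi u 0)).
  { apply bigO_ext with (fun u => eta (Y u 0)); [apply locally_axis in EPhi; exact EPhi|].
    apply bigO_comp; assumption. }
  assert (q10 : q1 0 0 = 0).
  { set (F := fun u => s1 * (u ^ (n - 1) * p1 u 0 ^ (n + 1)) + s2 * q1 u 0 ^ 2).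
    assert (F0 : F 0 = 0).
    { apply (bigO_leading 2).
      - apply (smooth_at_continuous_axis (fun u v => s1 * (u ^ (n - 1) * p1 u v ^ (n + 1)) + s2 * q1 u v ^ 2)).
        apply smooth_at_plus; apply smooth_at_scal; [apply smooth_at_mult|];
          apply smooth_at_pow; [apply smooth_at_fst | assumption..].
      - apply bigO_ext with (2 := HOP). generalize (filter_and _ _ EP EQ). apply filter_imp.
        intros u [X Y']. unfold Phi, F. rewrite X, Y', !Rpow_mult_distr.
        replace (u ^ (n + 1)) with (u ^ 2 * u ^ (n - 1)) by (rewrite <- pow_add; f_equal; lia).
        ring. }
    unfold F in F0. rewrite pow_i in F0 by lia.
    apply Rsqr_0_uniq. unfold Rsqr. destruct S2 as [T|T]; rewrite T in F0; lra. }
  destruct (axis_division_pdu q1 Hq1 q10) as [q2 [Hq2 [_ EQ2]]].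
  assert (EQ' : locally 0 (fun u => q u 0 = u ^ 2 * q2 u 0)).
  { generalize (filter_and _ _ EQ EQ2). apply filter_imp. intros u [X Y'].
    rewrite X, Y'. ring. }
  rewrite <- P1, <- Q1, q10 in J.
  exists xi, eta, s1, s2, p1, q2, (pdv p), (pdv q).
  repeat split; try assumption.
  - apply smooth_at_pdv, B1.
  - apply smooth_at_pdv, B2.
  - intros Z. apply J. rewrite Z. ring.
  - intros Z. apply J. rewrite Z. ring.
  - generalize (filter_and _ _ (locally_axis _ EY) (filter_and _ _ EP EQ')).
    apply filter_imp. intros u [A [B C]]. rewrite A. unfold Phi. rewrite B, C. reflexivity.
  - generalize (filter_and _ _ (locally_axis _ EPhi) (filter_and _ _ EP EQ')).
    apply filter_imp. intros u [A [B C]]. rewrite A. unfold Phi. rewrite B, C. reflexivity.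
  - intros m Hm.
    (* the v-derivative of [eta o Y = Phi] on the axis *)
    assert (HD : locally 0 (fun u => Derive eta (Y u 0) * pdv Y u 0 = pdv Phi u 0)).
    { assert (Xd : locally_2d (fun u _ => ex_derive eta u) (Y 0 0) 0).
      { rewrite Y0. apply locally_axis_2d. generalize X2. unfold smooth_germ1. apply filter_imp. intros y Hy. exact (Hy 1%nat). }
      apply (locally_2d_comp (fun u _ => ex_derive eta u) Y (fun _ _ => 0)) in Xd;
        [|apply smooth_at_continuity, HY | apply continuity_2d_pt_const].
      generalize (filter_and _ _ (locally_axis _ (locally_2d_nested _ _ _ EPhi))
        (filter_and _ _ (locally_axis _ Xd) (locally_axis _ (smooth_at_nested _ _ _ HY)))).
      apply filter_imp. intros u [A [B C]].
      symmetry. apply is_derive_unique.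
      apply (is_derive_ext_loc (fun v => eta (Y u v))).
      - exact (locally_2d_1d_const_x _ _ _ A).
      - evar_last.
        + apply (is_derive_comp eta (fun v => Y u v)).
          * apply Derive_correct, B.
          * apply smooth_at_is_derive_v, C.
        + unfold scal; simpl; unfold mult; simpl. ring. }
    assert (HB : bigO 0 (fun u => Derive eta (Y u 0))).
    { apply bigO_continuous. apply (continuous_comp (fun u => Y u 0) (Derive eta)).
      - apply smooth_at_continuous_axis, HY.
      - rewrite Y0. apply (ex_derive_continuous (Derive eta)).
        apply locally_singleton in X2. exact (X2 2%nat). }
    assert (HOv : bigO m (fun u => pdv Phi u 0)).
    { apply bigO_ext with (1 := HD). exact (bigO_mult 0 m _ _ HB Hm). }
    apply bigO_ext with (2 := HOv).
    generalize (filter_and _ _ (filter_and _ _ (locally_axis _ (smooth_at_nested _ _ _ B1))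
        (locally_axis _ (smooth_at_nested _ _ _ B2))) (filter_and _ _ EP EQ')).
    apply filter_imp. intros u [[A B] [C D]].
    apply is_derive_unique. unfold Phi. apply smooth_at_is_derive_v in A, B.
    rewrite <- C, <- D.
    apply (is_derive_plus (K := R_AbsRing) (V := R_NormedModule)).
    + apply (is_derive_scal (fun v => p u v ^ (n + 1))). evar_last.
      * apply (is_derive_pow (fun v => p u v)). exact A.
      * f_equal. f_equal. lia.
    + apply (is_derive_scal (fun v => q u v ^ 2)). evar_last.
      * apply (is_derive_pow (fun v => q u v)). exact B.
      * simpl. ring.
Qed.

(** Sufficiency is [A_singularity_of_jet].  For necessity orders are compared on
    the axis: an A_2 form has the exact order 3, because of the term p1^3 u^3, and
    an A_3 form has order at least 4.  In the A_3 case the coefficient of u^4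
    is p1^4 + q2^2 up to signs; the derivative transversal to the axis, being of
    order 3, forces q2 = 0, so that this coefficient is not zero. *)
Lemma A2_A3_criterion Y c q :
  smooth_at Y 0 0 -> smooth_at q 0 0 ->
  locally 0 (fun u => Y u 0 = c * u ^ 3 + u ^ 4 * q u 0) ->
  bigO 3 (fun u => pdv Y u 0) -> pdv (pdv Y) 0 0 <> 0 ->
  (A_singularity 2 Y <-> c <> 0) /\
  (A_singularity 3 Y <-> c = 0 /\ q 0 0 <> 0).
Proof.
  intros HY Hq EY HV HVV.
  assert (Y0 : Y 0 0 = 0) by (apply locally_singleton in EY; rewrite EY; ring).
  assert (HO3 : bigO 3 (fun u => Y u 0)).
  { apply bigO_ext with (fun u => u ^ 3 * (c + u * q u 0)).
    - revert EY. apply filter_imp. intros u A. rewrite A. ring.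
    - apply bigO_pow_mult.
      apply (smooth_at_continuous_axis (fun u v => c + u * q u v)).
      apply smooth_at_plus; [apply smooth_at_const|].
      apply smooth_at_mult; [apply smooth_at_fst | exact Hq]. }
  assert (HO4 : c = 0 -> bigO 4 (fun u => Y u 0)).
  { intros c0. apply bigO_ext with (fun u => u ^ 4 * q u 0).
    - revert EY. apply filter_imp. intros u A. rewrite A, c0. ring.
    - apply bigO_pow_mult, smooth_at_continuous_axis, Hq. }
  assert (Hpow : forall F k, smooth_at F 0 0 -> smooth_at (fun u v => u ^ k * F u v) 0 0).
  { intros F k HF. apply smooth_at_mult; [apply (smooth_at_pow (fun u _ => u)), smooth_at_fst | exact HF]. }
  split; split.
  - intros HA c0.
    destruct (A_singularity_axis 2 Y ltac:(lia) HY Y0 HA HO3) as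
      [xi [eta [s1 [s2 [p1 [q2 [pv [qv [Hx [x0 [He [e0 [S1 [S2 [Hp [Hq2 [_ [_ [N1 [_ [_ [Eeta _]]]]]]]]]]]]]]]]]]]]]].
    set (F := fun u v => s1 * p1 u v ^ 3 + s2 * (u ^ 1 * q2 u v ^ 2)).
    assert (F0 : F 0 0 = 0).
    { apply (bigO_leading 3 (fun u => F u 0)).
      - apply smooth_at_continuous_axis.
        apply smooth_at_plus; apply smooth_at_scal; [|apply (Hpow (fun u v => q2 u v ^ 2))];
          apply smooth_at_pow; assumption.
      - apply bigO_ext with (2 := bigO_comp 3 eta _ He e0 (HO4 c0)).
        revert Eeta. apply filter_imp. intros u A. rewrite A. unfold F. simpl. ring. }
    unfold F in F0. apply (pow_nonzero _ 3) in N1.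
    destruct S1 as [T|T]; rewrite T in F0; apply N1; lra.
  - intros Hc. apply (A_singularity_of_jet 2 Y (fun u v => c + u * q u v)); try assumption; try lia.
    + apply smooth_at_plus; [apply smooth_at_const|].
      apply smooth_at_mult; [apply smooth_at_fst | exact Hq].
    + revert EY. apply filter_imp. intros u A. rewrite A. ring.
    + rewrite Rmult_0_l, Rplus_0_r. exact Hc.
  - intros HA.
    destruct (A_singularity_axis 3 Y ltac:(lia) HY Y0 HA HO3) as
      [xi [eta [s1 [s2 [p1 [q2 [pv [qv [Hx [x0 [He [e0 [S1 [S2 [Hp [Hq2 [Hpv [Hqv [N1 [N2 [Exi [Eeta HE]]]]]]]]]]]]]]]]]]]]]].
    assert (c0 : c = 0).
    { assert (HO4' : bigO 4 (fun u => Y u 0)).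
      { apply bigO_ext with (fun u => xi (s1 * (u * p1 u 0) ^ (3 + 1) + s2 * (u ^ 2 * q2 u 0) ^ 2)).
        - revert Exi. apply filter_imp. intros u A. symmetry. exact A.
        - apply bigO_comp; try assumption.
          apply bigO_ext with (fun u => u ^ 4 * (s1 * p1 u 0 ^ 4 + s2 * q2 u 0 ^ 2)).
          + apply filter_forall. intros u. simpl. ring.
          + apply bigO_pow_mult.
            apply (smooth_at_continuous_axis (fun u v => s1 * p1 u v ^ 4 + s2 * q2 u v ^ 2)).
            apply smooth_at_plus; apply smooth_at_scal, smooth_at_pow; assumption. }
      set (F := fun u v => c + u * q u v).
      assert (F0 : F 0 0 = 0).
      { apply (bigO_leading 3 (fun u => F u 0)).
        - apply smooth_at_continuous_axis. apply smooth_at_plus; [apply smooth_at_const|].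
          apply smooth_at_mult; [apply smooth_at_fst | exact Hq].
        - apply bigO_ext with (2 := HO4'). revert EY. apply filter_imp.
          intros u A. rewrite A. unfold F. ring. }
      unfold F in F0. lra. }
    split; [exact c0|]. intros q0.
    assert (q20 : q2 0 0 = 0).
    { set (F := fun u v => s1 * (u ^ 1 * (4 * pv u v * p1 u v ^ 3)) + s2 * (2 * qv u v * q2 u v)).
      assert (F0 : F 0 0 = 0).
      { apply (bigO_leading 2 (fun u => F u 0)).
        - apply smooth_at_continuous_axis.
          apply smooth_at_plus; apply smooth_at_scal.
          + apply (Hpow (fun u v => 4 * pv u v * p1 u v ^ 3)).
            apply smooth_at_mult; [apply smooth_at_scal, Hpv | apply smooth_at_pow, Hp].
          + apply smooth_at_mult; [apply smooth_at_scal, Hqv | exact Hq2].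
        - apply bigO_ext with (2 := HE 3%nat HV). apply filter_forall. intros u. unfold F.
          simpl. ring. }
      unfold F in F0. rewrite pow_i in F0 by lia.
      assert (F1 : qv 0 0 * q2 0 0 = 0) by (destruct S2 as [T|T]; rewrite T in F0; lra).
      apply Rmult_integral in F1. destruct F1; [contradiction | assumption]. }
    assert (HO5 : bigO 5 (fun u => Y u 0)).
    { destruct (axis_division_pdu q Hq q0) as [q' [Hq' [_ Eq']]].
      apply bigO_ext with (fun u => u ^ 5 * q' u 0).
      - generalize (filter_and _ _ EY Eq'). apply filter_imp. intros u [A B].
        rewrite A, B, c0. ring.
      - apply bigO_pow_mult, smooth_at_continuous_axis, Hq'. }
    set (F := fun u v => s1 * p1 u v ^ 4 + s2 * q2 u v ^ 2).
    assert (F0 : F 0 0 = 0).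
    { apply (bigO_leading 4 (fun u => F u 0)).
      - apply smooth_at_continuous_axis.
        apply smooth_at_plus; apply smooth_at_scal, smooth_at_pow; assumption.
      - apply bigO_ext with (2 := bigO_comp 4 eta _ He e0 HO5).
        revert Eeta. apply filter_imp. intros u A. rewrite A. unfold F. simpl. ring. }
    unfold F in F0. rewrite q20, (pow_i 2) in F0 by lia. apply (pow_nonzero _ 4) in N1.
    destruct S1 as [T|T]; rewrite T in F0; apply N1; lra.
  - intros [c0 q0]. apply (A_singularity_of_jet 3 Y q); try assumption; try lia.
    revert EY. apply filter_imp. intros u A. rewrite A, c0. ring.
Qed.

(** * The jet of a germ v - s F *)
Lemma smooth_at_schwarz F x y :
  smooth_at F x y -> pdv (pdu F) x y = pdu (pdv F) x y.
Proof.
  intros HF. symmetry. apply (Schwarz F x y).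
  - generalize (smooth_at_nested _ _ _ HF). apply locally_2d_mono. intros u v H.
    repeat split.
    + eexists. apply smooth_at_is_derive_u, H.
    + eexists. apply smooth_at_is_derive_v, H.
    + eexists. apply (smooth_at_is_derive_u (pdv F)), smooth_at_pdv, H.
    + eexists. apply (smooth_at_is_derive_v (pdu F)), smooth_at_pdu, H.
  - apply (smooth_at_continuity (pdu (pdv F))), smooth_at_pdu, smooth_at_pdv, HF.
  - apply (smooth_at_continuity (pdv (pdu F))), smooth_at_pdv, smooth_at_pdu, HF.
Qed.

Lemma smooth_at_iter_pdu F n x y :
  smooth_at F x y -> smooth_at (fun u v => Derive_n (fun z => F z v) n u) x y.
Proof.
  intros HF. induction n as [|n IH]; simpl; [exact HF | exact (smooth_at_pdu _ _ _ IH)].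
Qed.

(** Leibniz' rule: near the origin the derivative of order n + 1 of [u g] is
    u g^(n+1) + (n + 1) g^(n). *)
Lemma Derive_n_axis_mult c G n :
  smooth_at G 0 0 ->
  Derive_n (fun u => c + u * G u 0) (S n) 0 = INR (S n) * Derive_n (fun u => G u 0) n 0.
Proof.
  intros HG. set (g := fun u => G u 0).
  assert (Hg : forall k, locally 0 (fun u => ex_derive (Derive_n g k) u)).
  { intros k. generalize (locally_axis _ (smooth_at_nested _ _ _ (smooth_at_iter_pdu G k 0 0 HG))).
    apply filter_imp. intros u H. eexists. apply smooth_at_is_derive_u in H. exact H. }
  assert (H : locally 0 (fun u => Derive_n (fun u => c + u * g u) (S n) u =
    u * Derive_n g (S n) u + INR (S n) * Derive_n g n u)).
  { induction n as [|n IH].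
    - generalize (Hg 0%nat). apply filter_imp. intros u A. simpl.
      apply is_derive_unique. evar_last.
      + apply (is_derive_plus (K := R_AbsRing) (V := R_NormedModule)).
        * apply (is_derive_const (K := R_AbsRing) (V := R_NormedModule)).
        * apply is_derive_id_mult, Derive_correct, A.
      + rewrite (plus_zero_l (G := R_NormedModule)). unfold g. simpl. ring.
    - apply locally_locally in IH.
      generalize (filter_and _ _ IH (filter_and _ _ (Hg n) (Hg (S n)))). apply filter_imp.
      intros u [A [B C]].
      change (Derive (Derive_n (fun u => c + u * g u) (S n)) u =
        u * Derive_n g (S (S n)) u + INR (S (S n)) * Derive_n g (S n) u).
      rewrite (Derive_ext_loc _ _ _ A). apply is_derive_unique. evar_last.
      + apply (is_derive_plus (K := R_AbsRing) (V := R_NormedModule)).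
        * apply is_derive_id_mult, Derive_correct, C.
        * apply (is_derive_scal (Derive_n g n)), Derive_correct, B.
      + unfold plus; simpl plus. rewrite (S_INR (S n)). simpl. ring. }
  apply locally_singleton in H. unfold g in *. rewrite H. ring.
Qed.

(** Iterating this step reads off Taylor coefficients as values at the origin of
    the successive quotients. *)
Lemma axis_taylor_step F :
  smooth_at F 0 0 ->
  exists F1, smooth_at F1 0 0 /\ locally 0 (fun u => F u 0 = F 0 0 + u * F1 u 0) /\
    forall n, Derive_n (fun u => F u 0) (S n) 0 = INR (S n) * Derive_n (fun u => F1 u 0) n 0.
Proof.
  intros HF. destruct (axis_division F HF) as [F1 [H1 E]]. exists F1. repeat split; try assumption.
  intros n. rewrite <- (Derive_n_axis_mult (F 0 0) F1 n H1). apply Derive_n_ext_loc, E.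
Qed.

Lemma bigO_2_is_derive (phi : R -> R) : bigO 2 phi -> is_derive phi 0 0.
Proof.
  intros [M H]. apply is_derive_Reals. intros eps Heps.
  assert (P0 : phi 0 = 0).
  { apply locally_singleton in H. rewrite Rabs_R0, pow_i, Rmult_0_r in H by lia.
    apply Rabs_eq_0. assert (Q := Rabs_pos (phi 0)). lra. }
  assert (HM : 0 < Rabs M + 1) by (assert (Q := Rabs_pos M); lra).
  destruct (filter_and _ _ H (locally_Rabs_lt _ (Rdiv_lt_0_compat _ _ Heps HM))) as [d Hd].
  exists d. intros y Hy Hyd. destruct (Hd y) as [A B].
  { unfold ball; simpl; unfold AbsRing_ball, abs, minus, plus, opp; simpl.
    rewrite Ropp_0, Rplus_0_r. exact Hyd. }
  rewrite Rplus_0_l, P0, !Rminus_0_r. unfold Rdiv. rewrite Rabs_mult, Rabs_inv.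
  assert (Hp : 0 < Rabs y) by (apply Rabs_pos_lt, Hy).
  apply Rmult_lt_reg_r with (Rabs y); [exact Hp|].
  rewrite Rmult_assoc, Rinv_l, Rmult_1_r by lra.
  apply Rle_lt_trans with (1 := A). simpl. rewrite Rmult_1_r, <- Rmult_assoc.
  apply Rmult_lt_compat_r; [exact Hp|].
  apply Rle_lt_trans with ((Rabs M + 1) * Rabs y).
  - apply Rmult_le_compat_r; [lra|]. assert (Q := Rle_abs M). lra.
  - replace eps with ((Rabs M + 1) * (eps / (Rabs M + 1))) by (field; lra).
    apply Rmult_lt_compat_l; assumption.
Qed.

Lemma bigO_1_of_ex_derive (phi : R -> R) : ex_derive phi 0 -> phi 0 = 0 -> bigO 1 phi.
Proof.
  intros H0 H. apply (bigO_comp 0 phi (fun u => u) H0 H).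
  apply bigO_ext with (2 := bigO_pow 1). apply filter_forall. intros u. simpl. ring.
Qed.

Lemma bigO_continuity_2d (c : R -> R -> R) :
  continuity_2d_pt c 0 0 -> bigO 0 (fun u => c u 0) /\ bigO 0 (fun v => c 0 v).
Proof.
  intros H. split; apply bigO_continuous.
  - apply continuity_2d_pt_continuous_l, H.
  - apply continuity_2d_pt_continuous_r, H.
Qed.

Lemma bigO_quadratic k l (e1 e2 e3 A B : R -> R) :
  (l <= k)%nat -> bigO 0 e1 -> bigO 0 e2 -> bigO 0 e3 -> bigO k A -> bigO l B ->
  bigO (l + l) (fun u => e1 u * B u ^ 2 + e2 u * (B u * A u) + e3 u * A u ^ 2).
Proof.
  intros L H1 H2 H3 HA HB.
  assert (HA' : bigO l A) by (apply bigO_le with k; assumption).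
  assert (SQ : forall D, bigO l D -> bigO (l + l) (fun u => D u ^ 2)).
  { intros D HD. apply bigO_ext with (fun u => D u * D u).
    - apply filter_forall. intros. ring.
    - apply bigO_mult; assumption. }
  apply (bigO_plus (l + l)); [apply (bigO_plus (l + l))|].
  - exact (bigO_mult 0 (l + l) e1 (fun u => B u ^ 2) H1 (SQ _ HB)).
  - exact (bigO_mult 0 (l + l) e2 (fun u => B u * A u) H2 (bigO_mult l l _ _ HB HA')).
  - exact (bigO_mult 0 (l + l) e3 (fun u => A u ^ 2) H3 (SQ _ HA')).
Qed.

(** The germ [F] stands for f_v, and the quadratic relation [EQ] between [s] and [F] is
    the one that the principal curvature imposes on the evolutoid. *)
Section HeightJet.
Variables (Y s F e1 e2 e3 : R -> R -> R).
Hypothesis HY : smooth_at Y 0 0.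
Hypothesis Hs : smooth_at s 0 0.
Hypothesis HF : smooth_at F 0 0.
Hypothesis EY : locally_2d (fun u v => Y u v = v - s u v * F u v) 0 0.
Hypothesis He1 : continuity_2d_pt e1 0 0.
Hypothesis He2 : continuity_2d_pt e2 0 0.
Hypothesis He3 : continuity_2d_pt e3 0 0.
Hypothesis EQ : locally_2d (fun u v => 1 - s u v * pdv F u v =
  e1 u v * pdu F u v ^ 2 + e2 u v * (pdu F u v * F u v) + e3 u v * F u v ^ 2) 0 0.
Hypothesis F0 : F 0 0 = 0.
Hypothesis Fu0 : pdu F 0 0 = 0.

Lemma height_pdv : locally_2d (fun u v =>
  pdv Y u v = (1 - s u v * pdv F u v) - pdv s u v * F u v) 0 0.
Proof using HY Hs HF EY.
  near_and (locally_2d_nested _ _ _ EY)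
    (locally_2d_and _ _ _ _ (smooth_at_nested _ _ _ Hs) (smooth_at_nested _ _ _ HF)).
  apply locally_2d_mono. intros u v [A [B C]]. apply is_derive_unique.
  apply (is_derive_ext_loc (fun z => z - s u z * F u z)).
  - apply locally_2d_1d_const_x in A. revert A. apply filter_imp. auto.
  - apply smooth_at_is_derive_v in B, C. evar_last.
    + apply (is_derive_minus (K := R_AbsRing) (V := R_NormedModule)).
      * apply (is_derive_id (K := R_AbsRing)).
      * apply (is_derive_mult (fun z => s u z) (fun z => F u z)); [exact B | exact C | exact Rmult_comm].
    + unfold minus, plus, opp, mult, one; simpl. ring.
Qed.

Lemma axis_bigO_1 G : smooth_at G 0 0 -> G 0 0 = 0 -> bigO 1 (fun u => G u 0).
Proof using.
  intros HG G0. apply bigO_1_of_ex_derive; [|exact G0].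
  eexists. apply smooth_at_is_derive_u, HG.
Qed.

(** By the relation [EQ], 1 - s F_v vanishes on the axis to twice the
    common order of [F_u] and [F]. *)
Lemma height_pdv_bigO k l :
  (l <= k)%nat -> bigO k (fun u => F u 0) -> bigO l (fun u => pdu F u 0) ->
  (k <= l + l)%nat -> bigO k (fun u => pdv Y u 0).
Proof using HY Hs HF EY He1 He2 He3 EQ.
  intros L HO HOu L2.
  apply bigO_ext with (fun u => (e1 u 0 * pdu F u 0 ^ 2 + e2 u 0 * (pdu F u 0 * F u 0)
    + e3 u 0 * F u 0 ^ 2) + (- pdv s u 0) * F u 0).
  - generalize (filter_and _ _ (locally_axis _ EQ) (locally_axis _ height_pdv)).
    apply filter_imp. intros u [A B]. rewrite B, A. ring.
  - apply bigO_plus.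
    + apply bigO_le with (1 := L2).
      apply (bigO_quadratic k l (fun u => e1 u 0) (fun u => e2 u 0) (fun u => e3 u 0)
        (fun u => F u 0) (fun u => pdu F u 0)); try assumption; apply bigO_continuity_2d; assumption.
    + apply (bigO_mult 0 k (fun u => - pdv s u 0)); [|exact HO].
      apply bigO_continuous.
      exact (smooth_at_continuous_axis (fun u v => - pdv s u v)
        (smooth_at_opp _ _ _ (smooth_at_pdv _ _ _ Hs))).
Qed.

Lemma height_axis_F : exists T2, smooth_at T2 0 0 /\
  locally 0 (fun u => F u 0 = u ^ 2 * T2 u 0) /\ pdu (pdu F) 0 0 = 2 * T2 0 0 /\
  forall n, Derive_n (fun u => F u 0) (S (S n)) 0 =
    INR (S (S n)) * INR (S n) * Derive_n (fun u => T2 u 0) n 0.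
Proof using HF F0 Fu0.
  destruct (axis_taylor_step F HF) as [T1 [H1 [E1 D1]]].
  destruct (axis_taylor_step T1 H1) as [T2 [H2 [E2 D2]]].
  assert (T10 : T1 0 0 = 0).
  { assert (Z := D1 0%nat). change (pdu F 0 0 = 1 * T1 0 0) in Z. lra. }
  exists T2. repeat split.
  - exact H2.
  - generalize (filter_and _ _ E1 E2). apply filter_imp. intros u [A B].
    rewrite A, B, F0, T10. ring.
  - assert (Z := D1 1%nat). rewrite D2 in Z.
    change (pdu (pdu F) 0 0 = (1 + 1) * (1 * T2 0 0)) in Z. lra.
  - intros n. rewrite D1, D2. ring.
Qed.

Lemma height_pdu_0 : pdu Y 0 0 = 0.
Proof using EY HF Hs F0 Fu0.
  destruct height_axis_F as [T2 [H2 [E2 _]]].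
  apply is_derive_unique. apply (bigO_2_is_derive (fun u => Y u 0)).
  apply bigO_ext with (fun u => u ^ 2 * (- s u 0 * T2 u 0)).
  - generalize (filter_and _ _ (locally_axis _ EY) E2). apply filter_imp.
    intros u [A B]. rewrite A, B. ring.
  - apply bigO_pow_mult.
    apply (smooth_at_continuous_axis (fun u v => - s u v * T2 u v)).
    apply smooth_at_mult; [apply smooth_at_opp, Hs | exact H2].
Qed.

Lemma height_pduu : pdu (pdu Y) 0 0 = - s 0 0 * pdu (pdu F) 0 0.
Proof using EY HF Hs F0 Fu0.
  destruct height_axis_F as [T2 [H2 [E2 [D2 _]]]].
  set (G := fun u v => - s u v * T2 u v).
  assert (HG : smooth_at G 0 0) by (apply smooth_at_mult; [apply smooth_at_opp, Hs | exact H2]).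
  set (G1 := fun u v => 0 + u * G u v).
  assert (HG1 : smooth_at G1 0 0).
  { apply smooth_at_plus; [apply smooth_at_const|]. apply smooth_at_mult; [apply smooth_at_fst | exact HG]. }
  change (Derive_n (fun u => Y u 0) 2 0 = - s 0 0 * pdu (pdu F) 0 0).
  rewrite (Derive_n_ext_loc _ (fun u => 0 + u * G1 u 0)).
  - rewrite Derive_n_axis_mult by exact HG1. unfold G1. rewrite Derive_n_axis_mult by exact HG.
    rewrite D2. simpl. unfold G. ring.
  - generalize (filter_and _ _ (locally_axis _ EY) E2). apply filter_imp.
    intros u [A B]. rewrite A, B. unfold G1, G. ring.
Qed.

Lemma height_pdv_0 : pdv Y 0 0 = 0.
Proof using HY Hs HF EY EQ F0 Fu0.
  assert (A := locally_2d_singleton _ _ _ EQ). assert (B := locally_2d_singleton _ _ _ height_pdv).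
  simpl in A, B. rewrite B, F0. rewrite Fu0, F0 in A. simpl in A. lra.
Qed.

Lemma height_pduv : pdv (pdu Y) 0 0 = 0.
Proof using HY Hs HF EY He1 He2 He3 EQ F0 Fu0.
  rewrite smooth_at_schwarz by exact HY.
  destruct height_axis_F as [T2 [H2 [E2 _]]].
  apply is_derive_unique, (bigO_2_is_derive (fun u => pdv Y u 0)).
  apply (height_pdv_bigO 2 1); try lia.
  - apply bigO_ext with (fun u => u ^ 2 * T2 u 0).
    + revert E2. apply filter_imp. auto.
    + apply bigO_pow_mult, smooth_at_continuous_axis, H2.
  - apply axis_bigO_1; [apply smooth_at_pdu, HF | exact Fu0].
Qed.

(** Along u = 0 the germ 1 - s F_v has order 2 by the relation [EQ], so only the
    term - s_v F contributes. *)
Lemma height_pdvv : pdv (pdv Y) 0 0 = - pdv s 0 0 * pdv F 0 0.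
Proof using HY Hs HF EY He1 He2 He3 EQ F0 Fu0.
  assert (Dq : is_derive (fun v => 1 - s 0 v * pdv F 0 v) 0 0).
  { apply bigO_2_is_derive.
    apply bigO_ext with (fun v => e1 0 v * pdu F 0 v ^ 2 + e2 0 v * (pdu F 0 v * F 0 v)
      + e3 0 v * F 0 v ^ 2).
    - assert (X := locally_2d_1d_const_x _ _ _ EQ). revert X. apply filter_imp.
      intros v A. symmetry. exact A.
    - apply (bigO_quadratic 1 1 (fun v => e1 0 v) (fun v => e2 0 v) (fun v => e3 0 v)
        (fun v => F 0 v) (fun v => pdu F 0 v)); try lia; try (apply bigO_continuity_2d; assumption);
        apply bigO_1_of_ex_derive; try assumption; eexists.
      + apply smooth_at_is_derive_v, HF.
      + apply (smooth_at_is_derive_v (pdu F)), smooth_at_pdu, HF. }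
  apply is_derive_unique.
  apply (is_derive_ext_loc (fun v => (1 - s 0 v * pdv F 0 v) - pdv s 0 v * F 0 v)).
  - assert (X := locally_2d_1d_const_x _ _ _ height_pdv). revert X. apply filter_imp.
    intros v A. symmetry. exact A.
  - evar_last.
    + apply (is_derive_minus (K := R_AbsRing) (V := R_NormedModule)); [exact Dq|].
      apply (is_derive_mult (fun z => pdv s 0 z) (fun z => F 0 z)); [| |exact Rmult_comm].
      * apply (smooth_at_is_derive_v (pdv s)), smooth_at_pdv, Hs.
      * apply smooth_at_is_derive_v, HF.
    + rewrite F0. unfold minus, plus, opp, mult; simpl. ring.
Qed.

Lemma height_pdv_bigO_3 : pdu (pdu F) 0 0 = 0 -> bigO 3 (fun u => pdv Y u 0).
Proof using HY Hs HF EY He1 He2 He3 EQ F0 Fu0.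
  intros Fuu0. destruct height_axis_F as [T2 [H2 [E2 [D2 _]]]].
  destruct (axis_division T2 H2) as [T3 [H3 E3]].
  assert (T20 : T2 0 0 = 0) by lra.
  assert (HFu := smooth_at_pdu _ _ _ HF).
  apply (height_pdv_bigO 3 2); try lia.
  - apply bigO_ext with (fun u => u ^ 3 * T3 u 0).
    + generalize (filter_and _ _ E2 E3). apply filter_imp. intros u [A B].
      rewrite A, B, T20. ring.
    + apply bigO_pow_mult, smooth_at_continuous_axis, H3.
  - destruct (axis_division_pdu _ HFu Fu0) as [G [HG [G0 EG]]].
    rewrite Fuu0 in G0. destruct (axis_division_pdu G HG G0) as [G1 [HG1 [_ EG1]]].
    apply bigO_ext with (fun u => u ^ 2 * G1 u 0).
    + generalize (filter_and _ _ EG EG1). apply filter_imp. intros u [A B].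
      rewrite A, B. ring.
    + apply bigO_pow_mult, smooth_at_continuous_axis, HG1.
Qed.

End HeightJet.

(** * The evolutoid of a graph *)
Definition area_factor (f : R -> R -> R) (u v : R) : R :=
  sqrt (1 + pdu f u v ^ 2 + pdv f u v ^ 2).


Lemma area_factor_pos f u v : 0 < area_factor f u v.
Proof. apply sqrt_lt_R0. assert (A := pow2_ge_0 (pdu f u v)). assert (B := pow2_ge_0 (pdv f u v)). lra. Qed.

Lemma area_factor_sq f u v : area_factor f u v ^ 2 = 1 + pdu f u v ^ 2 + pdv f u v ^ 2.
Proof.
  apply pow2_sqrt. assert (A := pow2_ge_0 (pdu f u v)). assert (B := pow2_ge_0 (pdv f u v)). lra.
Qed.

Lemma smooth_at_area_factor f x y : smooth_at f x y -> smooth_at (area_factor f) x y.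
Proof.
  intros Hf. apply (smooth_at_sqrt (fun u v => 1 + pdu f u v ^ 2 + pdv f u v ^ 2)).
  - assert (A := pow2_ge_0 (pdu f x y)). assert (B := pow2_ge_0 (pdv f x y)). lra.
  - apply smooth_at_plus; [apply smooth_at_plus; [apply smooth_at_const|]|];
      apply smooth_at_pow; [apply smooth_at_pdu | apply smooth_at_pdv]; exact Hf.
Qed.

Lemma Du_monge f u v : Du (monge f) u v = (1, 0, pdu f u v).
Proof.
  unfold Du, monge, c1, c2, c3; simpl. rewrite Derive_id, Derive_const. reflexivity.
Qed.

Lemma Dv_monge f u v : Dv (monge f) u v = (0, 1, pdv f u v).
Proof.
  unfold Dv, monge, c1, c2, c3; simpl. rewrite Derive_id, Derive_const. reflexivity.
Qed.

Lemma first_E_monge f u v : first_E (monge f) u v = 1 + pdu f u v ^ 2.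
Proof. unfold first_E, dot3. rewrite Du_monge. unfold c1, c2, c3; simpl. ring. Qed.

Lemma first_G_monge f u v : first_G (monge f) u v = 1 + pdv f u v ^ 2.
Proof. unfold first_G, dot3. rewrite Dv_monge. unfold c1, c2, c3; simpl. ring. Qed.

Lemma unit_normal_monge f u v :
  unit_normal (monge f) u v =
  (- (pdu f u v * / area_factor f u v), - (pdv f u v * / area_factor f u v), / area_factor f u v).
Proof.
  unfold unit_normal. rewrite Du_monge, Dv_monge.
  assert (E : norm3 (cross3 (1, 0, pdu f u v) (0, 1, pdv f u v)) = area_factor f u v).
  { unfold norm3, area_factor. f_equal. unfold dot3, cross3, c1, c2, c3; simpl. ring. }
  rewrite E. unfold scale3, cross3, c1, c2, c3; simpl. repeat f_equal; ring.
Qed.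

(** Writing the normal as (- f_u, - f_v, 1) J with J = 1 / W, the third
    component of the eigenvalue equation gives the derivative of [J] in the
    principal direction.  Eliminating it from the first two components leaves a
    linear system in the direction (a, b); its determinant vanishes. *)
Lemma principal_curvature_equation f u v k :
  smooth_at f u v -> is_principal_curvature (monge f) u v k ->
  let K := area_factor f u v * k in
  (pdu (pdu f) u v - K * (1 + pdu f u v ^ 2)) * (pdv (pdv f) u v - K * (1 + pdv f u v ^ 2)) =
  (pdu (pdv f) u v - K * (pdu f u v * pdv f u v)) ^ 2.
Proof.
  intros Hf [a [b [Hab H]]] K.
  set (J := fun u v => / area_factor f u v).
  assert (HW : area_factor f u v <> 0) by (assert (P := area_factor_pos f u v); lra).
  assert (HJ : smooth_at J u v) by (apply smooth_at_inv, smooth_at_area_factor; assumption).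
  assert (Hu := smooth_at_pdu _ _ _ Hf). assert (Hv := smooth_at_pdv _ _ _ Hf).
  assert (Dmu : forall F, smooth_at F u v ->
    Derive (fun t => - (F t v * J t v)) u = - (pdu F u v * J u v + F u v * pdu J u v)).
  { intros F HF. apply is_derive_unique. apply (is_derive_opp (fun t => F t v * J t v)).
    apply (is_derive_mult (fun t => F t v) (fun t => J t v));
      [apply smooth_at_is_derive_u; assumption.. | exact Rmult_comm]. }
  assert (Dmv : forall F, smooth_at F u v ->
    Derive (fun t => - (F u t * J u t)) v = - (pdv F u v * J u v + F u v * pdv J u v)).
  { intros F HF. apply is_derive_unique. apply (is_derive_opp (fun t => F u t * J u t)).
    apply (is_derive_mult (fun t => F u t) (fun t => J u t));
      [apply smooth_at_is_derive_v; assumption.. | exact Rmult_comm]. }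
  assert (Nu : Du (unit_normal (monge f)) u v =
    (- (pdu (pdu f) u v * J u v + pdu f u v * pdu J u v),
     - (pdu (pdv f) u v * J u v + pdv f u v * pdu J u v), pdu J u v)).
  { unfold Du. rewrite <- (Dmu _ Hu), <- (Dmu _ Hv).
    change (pdu J u v) with (Derive (fun t => J t v) u).
    f_equal; [f_equal|]; apply Derive_ext; intros t; rewrite unit_normal_monge; reflexivity. }
  assert (Nv : Dv (unit_normal (monge f)) u v =
    (- (pdv (pdu f) u v * J u v + pdu f u v * pdv J u v),
     - (pdv (pdv f) u v * J u v + pdv f u v * pdv J u v), pdv J u v)).
  { unfold Dv. rewrite <- (Dmv _ Hu), <- (Dmv _ Hv).
    change (pdv J u v) with (Derive (fun t => J u t) v).
    f_equal; [f_equal|]; apply Derive_ext; intros t; rewrite unit_normal_monge; reflexivity. }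
  rewrite Nu, Nv, Du_monge, Dv_monge, smooth_at_schwarz in H by exact Hf.
  unfold add3, scale3, c1, c2, c3 in H; simpl in H. injection H as H1 H2 H3.
  assert (EJ : area_factor f u v * J u v = 1) by (unfold J; field; exact HW).
  set (W := area_factor f u v) in *. set (j := J u v) in *.
  set (fu := pdu f u v) in *. set (fv := pdv f u v) in *.
  set (l := pdu (pdu f) u v) in *. set (m := pdu (pdv f) u v) in *.
  set (n := pdv (pdv f) u v) in *.
  set (ju := pdu J u v) in *. set (jv := pdv J u v) in *.
  assert (Q1 : (l - K * (1 + fu ^ 2)) * a + (m - K * (fu * fv)) * b = 0).
  { assert (X : (l * a + m * b) * j = k * a + k * fu * (a * fu + b * fv)).
    { replace (a * fu + b * fv) with (a * fu + b * fv + 0) by ring.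
      assert (Z : k * fu * (a * fu + b * fv) = - fu * (a * ju + b * jv)) by (rewrite H3; ring).
      rewrite Rplus_0_r, Z. lra. }
    assert (Y : (l * a + m * b) * (W * j) = W * (k * a + k * fu * (a * fu + b * fv)))
      by (rewrite <- X; ring).
    rewrite EJ in Y. unfold K. lra. }
  assert (Q2 : (m - K * (fu * fv)) * a + (n - K * (1 + fv ^ 2)) * b = 0).
  { assert (X : (m * a + n * b) * j = k * b + k * fv * (a * fu + b * fv)).
    { assert (Z : k * fv * (a * fu + b * fv) = - fv * (a * ju + b * jv)) by (rewrite H3; ring).
      rewrite Z. lra. }
    assert (Y : (m * a + n * b) * (W * j) = W * (k * b + k * fv * (a * fu + b * fv)))
      by (rewrite <- X; ring).
    rewrite EJ in Y. unfold K. lra. }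
  set (p := l - K * (1 + fu ^ 2)) in *. set (q := m - K * (fu * fv)) in *.
  set (r := n - K * (1 + fv ^ 2)) in *.
  apply Rminus_diag_uniq.
  assert (Za : a * (p * r - q ^ 2) = 0).
  { replace (a * (p * r - q ^ 2)) with (r * (p * a + q * b) - q * (q * a + r * b)) by ring.
    rewrite Q1, Q2. ring. }
  assert (Zb : b * (p * r - q ^ 2) = 0).
  { replace (b * (p * r - q ^ 2)) with (p * (q * a + r * b) - q * (p * a + q * b)) by ring.
    rewrite Q1, Q2. ring. }
  apply Rmult_integral in Za, Zb. destruct Za as [Za|Za]; [|exact Za].
  destruct Zb as [Zb|Zb]; [|exact Zb]. exfalso. apply Hab. congruence.
Qed.

(** This is the germ [s] for which the second coordinate of the evolutoid is
    [v - s f_v]. *)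
Definition evolutoid_shift (f kappa2 : R -> R -> R) (alpha u v : R) : R :=
  evolutoid_radius f kappa2 alpha u v * sin alpha / area_factor f u v.

Lemma evolutoid_coordinates f kappa2 alpha u v :
  sin alpha <> 0 ->
  let X := evolutoid f kappa2 alpha u v in
  let s := evolutoid_shift f kappa2 alpha u v in
  let c := cos alpha / sin alpha * (area_factor f u v / sqrt (1 + pdu f u v ^ 2)) in
  c1 X = u + s * (c - pdu f u v) /\ c2 X = v - s * pdv f u v /\
  c3 X = f u v + s * (c * pdu f u v + 1).
Proof.
  intros Hs X s c. subst X s c. unfold evolutoid, evolutoid_shift.
  rewrite unit_normal_monge, Du_monge, first_E_monge.
  set (r := evolutoid_radius f kappa2 alpha u v).
  assert (HW := area_factor_pos f u v).
  assert (HE : 0 < sqrt (1 + pdu f u v ^ 2)).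
  { apply sqrt_lt_R0. assert (A := pow2_ge_0 (pdu f u v)). lra. }
  set (W := area_factor f u v) in *. set (e := sqrt (1 + pdu f u v ^ 2)) in *.
  unfold monge, add3, scale3, c1, c2, c3; simpl.
  repeat split; field; repeat split; lra.
Qed.

(** The direction of the line joining the point of the surface to that of the
    evolutoid is a smooth unit vector, so its inner product with the
    displacement is the radius [r].  This yields smoothness of the shift although
    its definition involves [kappa2], which is only known to be continuous. *)
Lemma evolutoid_shift_smooth f kappa2 alpha :
  sin alpha <> 0 -> smooth_at f 0 0 ->
  (forall c, c = c1 \/ c = c2 \/ c = c3 ->
    smooth_at (fun u v => c (evolutoid f kappa2 alpha u v)) 0 0) ->
  smooth_at (evolutoid_shift f kappa2 alpha) 0 0.
Proof.
  intros Hs Hf HX.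
  set (C := fun u v => cos alpha / sin alpha * (area_factor f u v / sqrt (1 + pdu f u v ^ 2))).
  set (X := evolutoid f kappa2 alpha).
  assert (HW := smooth_at_area_factor _ _ _ Hf).
  assert (Hu := smooth_at_pdu _ _ _ Hf). assert (Hv := smooth_at_pdv _ _ _ Hf).
  assert (Hpos : 0 < 1 + pdu f 0 0 ^ 2) by (assert (A := pow2_ge_0 (pdu f 0 0)); lra).
  assert (HC : smooth_at C 0 0).
  { apply smooth_at_scal, smooth_at_div.
    - assert (P := sqrt_lt_R0 _ Hpos). lra.
    - exact HW.
    - apply (smooth_at_sqrt (fun u v => 1 + pdu f u v ^ 2)); [exact Hpos|].
      apply smooth_at_plus; [apply smooth_at_const | apply smooth_at_pow, Hu]. }
  apply smooth_at_ext with (fun u v =>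
    sin alpha ^ 2 * ((c1 (X u v) - u) * (C u v - pdu f u v) + (c2 (X u v) - v) * (- pdv f u v)
      + (c3 (X u v) - f u v) * (C u v * pdu f u v + 1)) / area_factor f u v ^ 2).
  - apply locally_2d_forall. intros u v.
    destruct (evolutoid_coordinates f kappa2 alpha u v Hs) as [E1 [E2 E3]].
    fold X in E1, E2, E3. fold (C u v) in E1, E3. rewrite E1, E2, E3.
    set (s := evolutoid_shift f kappa2 alpha u v).
    assert (HE : 0 < sqrt (1 + pdu f u v ^ 2)).
    { apply sqrt_lt_R0. assert (A := pow2_ge_0 (pdu f u v)). lra. }
    assert (HE2 : sqrt (1 + pdu f u v ^ 2) ^ 2 = 1 + pdu f u v ^ 2).
    { apply pow2_sqrt. assert (A := pow2_ge_0 (pdu f u v)). lra. }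
    assert (HP := area_factor_pos f u v). assert (HP2 := area_factor_sq f u v).
    assert (HC2 : sin alpha ^ 2 * (C u v ^ 2 * (1 + pdu f u v ^ 2)) =
      cos alpha ^ 2 * area_factor f u v ^ 2).
    { unfold C. set (e := sqrt (1 + pdu f u v ^ 2)) in *. rewrite <- HE2.
      field. split; lra. }
    assert (Htr : cos alpha ^ 2 = 1 - sin alpha ^ 2).
    { assert (T := sin2_cos2 alpha). unfold Rsqr in T. lra. }
    rewrite Htr in HC2.
    apply Rmult_eq_reg_r with (area_factor f u v ^ 2); [|nra].
    transitivity (s * (sin alpha ^ 2 * (C u v ^ 2 * (1 + pdu f u v ^ 2)) +
      sin alpha ^ 2 * (1 + pdu f u v ^ 2 + pdv f u v ^ 2))).
    + field. lra.
    + rewrite HC2, <- HP2. ring.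
  - assert (S1 := HX c1 ltac:(auto)). assert (S2 := HX c2 ltac:(auto)).
    assert (S3 := HX c3 ltac:(auto)). fold X in S1, S2, S3.
    apply smooth_at_div.
    + assert (P := area_factor_pos f 0 0). apply pow_nonzero. lra.
    + apply smooth_at_scal.
      apply smooth_at_plus; [apply smooth_at_plus|]; apply smooth_at_mult.
      * apply smooth_at_minus; [exact S1 | apply smooth_at_fst].
      * apply smooth_at_minus; assumption.
      * apply smooth_at_minus; [exact S2 | apply smooth_at_snd].
      * apply smooth_at_opp, Hv.
      * apply smooth_at_minus; assumption.
      * apply smooth_at_plus; [apply smooth_at_mult; assumption | apply smooth_at_const].
    + apply smooth_at_pow, HW.
Qed.

Lemma evolutoid_shift_equation f kappa2 alpha u v :
  sin alpha <> 0 -> smooth_at f u v ->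
  cos alpha * (2 * (pdv f u v * pdu (pdv f) u v)) - 2 * sin alpha *
    sqrt (1 + pdu f u v ^ 2) * (1 + pdv f u v ^ 2) * kappa2 u v <> 0 ->
  let s := evolutoid_shift f kappa2 alpha u v in
  s * (area_factor f u v * kappa2 u v) = 1 + s * area_factor f u v * (cos alpha / sin alpha) *
    (pdu (pdv f) u v * pdv f u v) / (sqrt (1 + pdu f u v ^ 2) * (1 + pdv f u v ^ 2)).
Proof.
  intros Hs Hf Hd s. subst s. unfold evolutoid_shift, evolutoid_radius.
  rewrite first_E_monge, first_G_monge.
  rewrite (Derive_ext (fun t => first_G (monge f) t v) (fun t => 1 + pdv f t v ^ 2))
    by (intros; apply first_G_monge).
  replace (Derive (fun t => 1 + pdv f t v ^ 2) u) with (2 * (pdv f u v * pdu (pdv f) u v)).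
  2: { symmetry. apply is_derive_unique. evar_last.
       - apply (is_derive_plus (K := R_AbsRing) (V := R_NormedModule)).
         + apply (is_derive_const (K := R_AbsRing) (V := R_NormedModule)).
         + apply (is_derive_pow (fun t => pdv f t v)), (smooth_at_is_derive_u (pdv f)).
           apply smooth_at_pdv, Hf.
       - rewrite (plus_zero_l (G := R_NormedModule)). simpl. ring. }
  assert (HW := area_factor_pos f u v).
  assert (HE : 0 < sqrt (1 + pdu f u v ^ 2)).
  { apply sqrt_lt_R0. assert (A := pow2_ge_0 (pdu f u v)). lra. }
  assert (HG : 0 < 1 + pdv f u v ^ 2) by (assert (A := pow2_ge_0 (pdv f u v)); lra).
  set (W := area_factor f u v) in *. set (e := sqrt (1 + pdu f u v ^ 2)) in *.
  set (G := 1 + pdv f u v ^ 2) in *. field. repeat split; lra.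
Qed.

(** The left-hand side splits as (1 - s K) + s (K - f_vv) with K = W kappa_2.  The
    first term is a multiple of f_uv f_v by the formula for the radius.  For the
    second, K - f_vv is - K f_v^2 minus f_vv - K G, and the eigenvalue equation
    expresses f_vv - K G as the quotient of (f_uv - K f_u f_v)^2 by D = f_uu - K E,
    which is k1 - k2 at the origin. *)
Lemma shift_defect f k1 k2 kappa2 alpha :
  smooth_at f 0 0 -> pdu f 0 0 = 0 -> pdv f 0 0 = 0 -> pdu (pdu f) 0 0 = k1 ->
  k2 <> 0 -> k1 <> k2 -> sin alpha <> 0 ->
  principal_curvature_branch (monge f) k2 kappa2 ->
  smooth_at (evolutoid_shift f kappa2 alpha) 0 0 ->
  exists e1 e2 e3 : R -> R -> R,
    continuity_2d_pt e1 0 0 /\ continuity_2d_pt e2 0 0 /\ continuity_2d_pt e3 0 0 /\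
    locally_2d (fun u v => 1 - evolutoid_shift f kappa2 alpha u v * pdv (pdv f) u v =
      e1 u v * pdu (pdv f) u v ^ 2 + e2 u v * (pdu (pdv f) u v * pdv f u v) +
      e3 u v * pdv f u v ^ 2) 0 0.
Proof.
  intros Hf fu0 fv0 fuu0 Hk2 Hk Hs [Hkap0 [Hkc Hkp]] Hsh.
  set (s := evolutoid_shift f kappa2 alpha) in *.
  set (W := area_factor f). set (K := fun u v => W u v * kappa2 u v).
  set (e := fun u v => sqrt (1 + pdu f u v ^ 2)).
  set (G := fun u v => 1 + pdv f u v ^ 2).
  set (D := fun u v => pdu (pdu f) u v - K u v * (1 + pdu f u v ^ 2)).
  set (den := fun u v => cos alpha * (2 * (pdv f u v * pdu (pdv f) u v)) -
    2 * sin alpha * e u v * G u v * kappa2 u v).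
  assert (Hu := smooth_at_pdu _ _ _ Hf). assert (Hv := smooth_at_pdv _ _ _ Hf).
  assert (W0 : W 0 0 = 1).
  { unfold W, area_factor. rewrite fu0, fv0, !pow_i, !Rplus_0_r by lia. apply sqrt_1. }
  assert (e0 : e 0 0 = 1) by (unfold e; rewrite fu0, pow_i, Rplus_0_r by lia; apply sqrt_1).
  assert (G0 : G 0 0 = 1) by (unfold G; rewrite fv0; ring).
  assert (K0 : K 0 0 = k2) by (unfold K; rewrite W0, Hkap0; ring).
  assert (D0 : D 0 0 <> 0).
  { unfold D. rewrite fuu0, K0, fu0, pow_i by lia. intros Z. apply Hk. lra. }
  assert (den0 : den 0 0 <> 0).
  { unfold den. rewrite fv0, e0, G0, Hkap0. intros Z. apply Hk2.
    apply Rmult_eq_reg_l with (sin alpha); [lra | exact Hs]. }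
  assert (Cs := smooth_at_continuity _ _ _ Hsh).
  assert (CW := smooth_at_continuity _ _ _ (smooth_at_area_factor _ _ _ Hf)). fold W in CW.
  assert (Ckap := locally_2d_singleton _ _ _ Hkc). simpl in Ckap.
  assert (CK : continuity_2d_pt K 0 0) by (apply continuity_2d_pt_mult; assumption).
  assert (Cu := smooth_at_continuity _ _ _ Hu). assert (Cv := smooth_at_continuity _ _ _ Hv).
  assert (Cuu := smooth_at_continuity _ _ _ (smooth_at_pdu _ _ _ Hu)).
  assert (Cuv := smooth_at_continuity _ _ _ (smooth_at_pdu _ _ _ Hv)).
  assert (CE : continuity_2d_pt (fun u v => 1 + pdu f u v ^ 2) 0 0).
  { apply smooth_at_continuity, smooth_at_plus; [apply smooth_at_const | apply smooth_at_pow, Hu]. }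
  assert (SE : smooth_at e 0 0).
  { apply (smooth_at_sqrt (fun u v => 1 + pdu f u v ^ 2)); [rewrite fu0; lra|].
    apply smooth_at_plus; [apply smooth_at_const | apply smooth_at_pow, Hu]. }
  assert (SG : smooth_at G 0 0).
  { apply smooth_at_plus; [apply smooth_at_const | apply smooth_at_pow, Hv]. }
  assert (Ce := smooth_at_continuity _ _ _ SE). assert (CG := smooth_at_continuity _ _ _ SG).
  assert (CD : continuity_2d_pt D 0 0).
  { apply continuity_2d_pt_minus; [exact Cuu | apply continuity_2d_pt_mult; assumption]. }
  assert (Cden : continuity_2d_pt den 0 0).
  { apply continuity_2d_pt_minus.
    - apply continuity_2d_pt_mult; [apply continuity_2d_pt_const|].
      apply continuity_2d_pt_mult; [apply continuity_2d_pt_const|].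
      apply continuity_2d_pt_mult; assumption.
    - repeat (apply continuity_2d_pt_mult; try assumption); apply continuity_2d_pt_const. }
  assert (CDi := continuity_2d_pt_inv _ _ _ CD D0).
  set (b := fun u v => s u v * W u v * (cos alpha / sin alpha) * / (e u v * G u v)).
  assert (Cb : continuity_2d_pt b 0 0).
  { apply continuity_2d_pt_mult.
    - repeat (apply continuity_2d_pt_mult; try assumption); apply continuity_2d_pt_const.
    - apply continuity_2d_pt_inv; [apply continuity_2d_pt_mult; assumption|].
      rewrite e0, G0. lra. }
  exists (fun u v => - (s u v * / D u v)).
  exists (fun u v => 2 * (s u v * K u v * pdu f u v * / D u v) - b u v).
  exists (fun u v => - (s u v * K u v) - s u v * K u v * K u v * pdu f u v * pdu f u v * / D u v).
  split; [|split; [|split]].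
  - apply continuity_2d_pt_opp, continuity_2d_pt_mult; assumption.
  - apply continuity_2d_pt_minus; [|exact Cb].
    apply continuity_2d_pt_mult; [apply continuity_2d_pt_const|].
    repeat (apply continuity_2d_pt_mult; try assumption).
  - apply continuity_2d_pt_minus; [apply continuity_2d_pt_opp|];
      repeat (apply continuity_2d_pt_mult; try assumption).
  - near_and (locally_2d_and _ _ _ _ Hkp (smooth_at_nested _ _ _ Hf))
      (locally_2d_and _ _ _ _ (continuity_2d_pt_neq_0 _ _ _ CD D0)
        (continuity_2d_pt_neq_0 _ _ _ Cden den0)).
    apply locally_2d_mono. intros u v [[H1 H2] [H3 H4]].
    assert (E1 := principal_curvature_equation f u v _ H2 H1). cbv zeta in E1.
    change (area_factor f u v * kappa2 u v) with (K u v) in E1. fold (D u v) in E1.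
    assert (E2 := evolutoid_shift_equation f kappa2 alpha u v Hs H2 H4). cbv zeta in E2.
    change (area_factor f u v * kappa2 u v) with (K u v) in E2. fold s in E2.
    change (area_factor f u v) with (W u v) in E2.
    fold (e u v) in E2. fold (G u v) in E2.
    assert (E2' : s u v * K u v = 1 + b u v * (pdu (pdv f) u v * pdv f u v)).
    { rewrite E2. unfold b, Rdiv. ring. }
    apply Rmult_eq_reg_r with (D u v); [|exact H3].
    transitivity (D u v * (1 - s u v * K u v - s u v * K u v * pdv f u v ^ 2) -
      s u v * (D u v * (pdv (pdv f) u v - K u v * (1 + pdv f u v ^ 2)))); [ring|].
    rewrite E1. transitivity (D u v * (- (b u v * (pdu (pdv f) u v * pdv f u v))
      - s u v * K u v * pdv f u v ^ 2) -
      s u v * (pdu (pdv f) u v - K u v * (pdu f u v * pdv f u v)) ^ 2).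
    + replace (1 - s u v * K u v) with (- (b u v * (pdu (pdv f) u v * pdv f u v)))
        by (rewrite E2'; ring). ring.
    + field. exact H3.
Qed.

(** At the origin the factors of the shift in the first and third coordinates of
    the evolutoid are stationary in [v], as is [f]; if the shift were stationary
    too, the v-derivative of the evolutoid would vanish. *)
Lemma regular_shift_pdv f kappa2 alpha :
  smooth_at f 0 0 -> pdu f 0 0 = 0 -> pdv f 0 0 = 0 -> pdu (pdv f) 0 0 = 0 ->
  sin alpha <> 0 -> smooth_at (evolutoid_shift f kappa2 alpha) 0 0 ->
  pdv (fun u v => c2 (evolutoid f kappa2 alpha u v)) 0 0 = 0 ->
  regular_at (evolutoid f kappa2 alpha) 0 0 ->
  pdv (evolutoid_shift f kappa2 alpha) 0 0 <> 0.
Proof.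
  intros Hf fu0 fv0 fuv0 Hs Hsh HY Hreg Z.
  set (s := evolutoid_shift f kappa2 alpha) in *.
  assert (Ds := smooth_at_is_derive_v _ _ _ Hsh). rewrite Z in Ds.
  assert (DA : is_derive (fun v => pdu f 0 v) 0 0).
  { evar_last; [apply (smooth_at_is_derive_v (pdu f)), smooth_at_pdu, Hf|].
    rewrite smooth_at_schwarz by exact Hf. exact fuv0. }
  assert (DB := smooth_at_is_derive_v _ _ _ (smooth_at_pdv _ _ _ Hf)).
  assert (DA2 : is_derive (fun v => 1 + pdu f 0 v ^ 2) 0 0).
  { evar_last.
    - apply (is_derive_plus (K := R_AbsRing) (V := R_NormedModule)).
      + apply (is_derive_const (K := R_AbsRing) (V := R_NormedModule)).
      + apply (is_derive_pow (fun v => pdu f 0 v)), DA.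
    - rewrite fu0, (plus_zero_l (G := R_NormedModule)). simpl. ring. }
  assert (DAB2 : is_derive (fun v => 1 + pdu f 0 v ^ 2 + pdv f 0 v ^ 2) 0 0).
  { evar_last.
    - apply (is_derive_plus (K := R_AbsRing) (V := R_NormedModule)); [exact DA2|].
      apply (is_derive_pow (fun v => pdv f 0 v)), DB.
    - rewrite fv0, (plus_zero_l (G := R_NormedModule)). simpl. ring. }
  set (C := fun v => cos alpha / sin alpha * (area_factor f 0 v / sqrt (1 + pdu f 0 v ^ 2))).
  assert (DC : is_derive C 0 0).
  { evar_last.
    - apply (is_derive_scal (fun v => area_factor f 0 v / sqrt (1 + pdu f 0 v ^ 2))).
      apply (is_derive_div (fun v => area_factor f 0 v)).
      + apply (is_derive_sqrt (fun v => 1 + pdu f 0 v ^ 2 + pdv f 0 v ^ 2)); [exact DAB2|].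
        rewrite fu0, fv0. lra.
      + apply (is_derive_sqrt (fun v => 1 + pdu f 0 v ^ 2)); [exact DA2 | rewrite fu0; lra].
      + rewrite fu0, pow_i, Rplus_0_r, sqrt_1 by lia. lra.
    - unfold Rdiv. ring. }
  assert (Dmult : forall a b : R -> R, is_derive a 0 0 -> is_derive b 0 0 ->
    is_derive (fun v => a v * b v) 0 0).
  { intros a b Ha Hb. evar_last.
    - apply (is_derive_mult a b); [exact Ha | exact Hb | exact Rmult_comm].
    - unfold plus, mult; simpl. ring. }
  assert (DX : Dv (evolutoid f kappa2 alpha) 0 0 = zero3).
  { unfold Dv, zero3. f_equal; [f_equal; [|exact HY]|].
    - rewrite (Derive_ext _ (fun v => 0 + s 0 v * (C v - pdu f 0 v)))
        by (intros v; apply evolutoid_coordinates, Hs).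
      apply is_derive_unique. evar_last.
      + apply (is_derive_plus (K := R_AbsRing) (V := R_NormedModule)).
        * apply (is_derive_const (K := R_AbsRing) (V := R_NormedModule)).
        * apply Dmult; [exact Ds|]. evar_last.
          -- apply (is_derive_minus (K := R_AbsRing) (V := R_NormedModule)); [exact DC | exact DA].
          -- unfold minus, plus, opp; simpl. ring.
      + apply (plus_zero_l (G := R_NormedModule)).
    - rewrite (Derive_ext _ (fun v => f 0 v + s 0 v * (C v * pdu f 0 v + 1)))
        by (intros v; apply evolutoid_coordinates, Hs).
      apply is_derive_unique. evar_last.
      + apply (is_derive_plus (K := R_AbsRing) (V := R_NormedModule)).
        * apply smooth_at_is_derive_v, Hf.
        * apply Dmult; [exact Ds|]. evar_last.
          -- apply (is_derive_plus (K := R_AbsRing) (V := R_NormedModule)).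
             ++ apply Dmult; [exact DC | exact DA].
             ++ apply (is_derive_const (K := R_AbsRing) (V := R_NormedModule)).
          -- apply (plus_zero_l (G := R_NormedModule)).
      + rewrite fv0. apply (plus_zero_l (G := R_NormedModule)). }
  destruct (Hreg 0 1) as [_ H1]; [|lra].
  rewrite DX. unfold add3, scale3, zero3, c1, c2, c3; simpl. repeat f_equal; ring.
Qed.

(** The tangent plane is parallel to the xz-plane, so the unit normal is (0, nu, 0)
    and the second fundamental form is [nu] times the Hessian of the second coordinate. *)
Lemma parabolic_hessian X :
  regular_at X 0 0 -> parabolic_at X 0 0 ->
  let Y := fun u v => c2 (X u v) in
  pdu Y 0 0 = 0 -> pdv Y 0 0 = 0 ->
  pdu (pdu Y) 0 0 * pdv (pdv Y) 0 0 - pdv (pdu Y) 0 0 ^ 2 = 0.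
Proof.
  intros Hreg Hpar Y Yu0 Yv0.
  unfold parabolic_at, gauss_curvature, second_L, second_M, second_N, unit_normal,
    first_E, first_F, first_G in Hpar.
  set (xu := Derive (fun t => c1 (X t 0)) 0). set (zu := Derive (fun t => c3 (X t 0)) 0).
  set (xv := Derive (fun t => c1 (X 0 t)) 0). set (zv := Derive (fun t => c3 (X 0 t)) 0).
  assert (EU : Du X 0 0 = (xu, 0, zu)).
  { unfold Du. f_equal. f_equal. exact Yu0. }
  assert (EV : Dv X 0 0 = (xv, 0, zv)).
  { unfold Dv. f_equal. f_equal. exact Yv0. }
  rewrite EU, EV in Hpar. set (d := zu * xv - xu * zv).
  assert (Hd : d <> 0).
  { intros d0. unfold regular_at in Hreg. rewrite EU, EV in Hreg.
    assert (H : forall a b, a * xu + b * xv = 0 -> a * zu + b * zv = 0 -> a = 0 /\ b = 0).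
    { intros a b Hx Hz. apply Hreg. unfold add3, scale3, zero3, c1, c2, c3; simpl.
      rewrite Hx, Hz. repeat f_equal. ring. }
    unfold d in d0. destruct (H xv (- xu)) as [X1 X2]; [ring | lra |].
    destruct (H zv (- zu)) as [X3 X4]; [lra | ring |].
    destruct (H 1 0) as [X5 _]; nra. }
  set (nu := / norm3 (cross3 (xu, 0, zu) (xv, 0, zv)) * d).
  assert (Hnu : nu <> 0).
  { unfold nu. apply Rmult_integral_contrapositive_currified; [|exact Hd].
    apply Rinv_neq_0_compat. unfold norm3, dot3, cross3, c1, c2, c3; simpl.
    apply Rgt_not_eq, sqrt_lt_R0.
    apply Rlt_le_trans with (d * d); [nra | right; unfold d; ring]. }
  assert (EN : scale3 (/ norm3 (cross3 (xu, 0, zu) (xv, 0, zv))) (cross3 (xu, 0, zu) (xv, 0, zv))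
    = (0, nu, 0)).
  { unfold nu, d, scale3, cross3, c1, c2, c3; simpl. repeat f_equal; ring. }
  rewrite EN in Hpar.
  assert (L : forall w, dot3 w (0, nu, 0) = c2 w * nu).
  { intros w. unfold dot3, c1, c2, c3; simpl. ring. }
  rewrite !L in Hpar.
  change (c2 (Du (Du X) 0 0)) with (pdu (pdu Y) 0 0) in Hpar.
  change (c2 (Dv (Du X) 0 0)) with (pdv (pdu Y) 0 0) in Hpar.
  change (c2 (Dv (Dv X) 0 0)) with (pdv (pdv Y) 0 0) in Hpar.
  apply Rmult_eq_reg_r with (nu ^ 2 / d ^ 2).
  - rewrite Rmult_0_l. apply eq_trans with (2 := Hpar). clear Hpar.
    unfold dot3, c1, c2, c3; simpl.
    replace ((xu * xu + 0 * 0 + zu * zu) * (xv * xv + 0 * 0 + zv * zv) -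
      (xu * xv + 0 * 0 + zu * zv) * ((xu * xv + 0 * 0 + zu * zv) * 1)) with (d * d)
      by (unfold d; ring).
    field. exact Hd.
  - apply Rmult_integral_contrapositive_currified; [apply pow_nonzero, Hnu|].
    apply Rinv_neq_0_compat, pow_nonzero, Hd.
Qed.

(** Near the base point X = psi o k, and [psi] is a graph, so the coordinates of [X]
    are smooth even though [X] involves the merely continuous [kappa2]. *)
Lemma monge_parametrization_height X psi :
  monge_parametrization_xz X psi ->
  (forall c, c = c1 \/ c = c2 \/ c = c3 -> smooth_at (fun u v => c (X u v)) 0 0) /\
  exists h k, diffeo_germ2 h k /\
    locally_2d (fun x y => height_function psi normal0 x y = c2 (X (fst (h x y)) (snd (h x y)))) 0 0 /\
    locally_2d (fun u v => c2 (X u v) = height_function psi normal0 (fst (k u v)) (snd (k u v))) 0 0.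
Proof.
  intros [[g [Hg [_ [_ [_ Epsi]]]]] [h [k [D EX]]]].
  assert (D' := diffeo_germ2_sym _ _ D).
  assert (EXk : locally_2d (fun u v => X u v = psi (fst (k u v)) (snd (k u v))) 0 0).
  { near_and (locally_2d_diffeo _ _ _ D' EX) (proj2 (proj2 (proj2 (proj2 (proj2 D))))).
    apply locally_2d_mono. intros u v [A B]. rewrite A, B. reflexivity. }
  assert (EG : locally_2d (fun u v => X u v =
    add3 (X 0 0) (fst (k u v), g (fst (k u v)) (snd (k u v)), snd (k u v))) 0 0).
  { near_and EXk (locally_2d_diffeo _ _ _ D' Epsi). apply locally_2d_mono.
    intros u v [A B]. rewrite A. exact B. }
  apply smooth_germ2_iff in Hg.
  assert (Ht : forall x y, height_function psi normal0 x y = c2 (psi x y)).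
  { intros x y. unfold height_function, dot3, normal0, c1, c2, c3; simpl. ring. }
  split.
  - destruct (proj1 D') as [K1 K2]. apply smooth_germ2_iff in K1, K2.
    intros c Hc. destruct Hc as [Hc|[Hc|Hc]]; subst c.
    + apply smooth_at_ext with (fun u v => c1 (X 0 0) + fst (k u v)).
      * revert EG. apply locally_2d_mono. intros u v E. rewrite E. reflexivity.
      * apply smooth_at_plus; [apply smooth_at_const | exact K1].
    + apply smooth_at_ext with (fun u v => c2 (X 0 0) + g (fst (k u v)) (snd (k u v))).
      * revert EG. apply locally_2d_mono. intros u v E. rewrite E. reflexivity.
      * apply smooth_at_plus; [apply smooth_at_const|].
        apply (smooth_at_diffeo g _ _ D'), Hg.
    + apply smooth_at_ext with (fun u v => c3 (X 0 0) + snd (k u v)).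
      * revert EG. apply locally_2d_mono. intros u v E. rewrite E. reflexivity.
      * apply smooth_at_plus; [apply smooth_at_const | exact K2].
  - exists h, k. split; [exact D|]. split.
    + revert EX. apply locally_2d_mono. intros x y E. rewrite Ht, E. reflexivity.
    + revert EXk. apply locally_2d_mono. intros u v E. rewrite Ht, E. reflexivity.
Qed.

Lemma monge_expansion_derivatives f k1 k2 a :
  monge_expansion f k1 k2 a ->
  pdu f 0 0 = 0 /\ pdv f 0 0 = 0 /\ pdu (pdu f) 0 0 = k1 /\ pdu (pdv f) 0 0 = 0 /\
  pdv (pdv f) 0 0 = k2 /\
  forall i j, (3 <= i + j)%nat -> partial_derive i j f 0 0 = a i j.
Proof.
  assert (F : forall i j, INR (fact i) * INR (fact j) <> 0).
  { intros i j. apply Rmult_integral_contrapositive_currified; apply INR_fact_neq_0. }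
  intros [_ [H10 [H01 [H20 [H11 [H02 H]]]]]].
  assert (Z : forall i j x, taylor_coef f i j = x ->
    partial_derive i j f 0 0 = x * (INR (fact i) * INR (fact j))).
  { intros i j x E. rewrite <- E. unfold taylor_coef. field. split; apply INR_fact_neq_0. }
  apply Z in H10, H01, H20, H11, H02. simpl INR in *.
  change (pdu f 0 0 = 0 * (1 * 1)) in H10. change (pdv f 0 0 = 0 * (1 * 1)) in H01.
  change (pdu (pdu f) 0 0 = k1 / 2 * ((1 + 1) * 1)) in H20.
  change (pdu (pdv f) 0 0 = 0 * (1 * 1)) in H11.
  change (pdv (pdv f) 0 0 = k2 / 2 * (1 * (1 + 1))) in H02.
  repeat split; try lra.
  intros i j L. specialize (Z i j _ (H i j L)). rewrite Z. field.
  split; apply INR_fact_neq_0.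
Qed.

(** * The singularities of the height function *)
Theorem theorem3p8 :
  forall (f : R -> R -> R) (k1 k2 : R) (a : nat -> nat -> R)
         (kappa2 : R -> R -> R) (alpha : R) (psi : R -> R -> R3),
    smooth_germ2 f ->
    monge_expansion f k1 k2 a ->
    k1 * k2 <> 0 ->
    k2 < k1 ->
    ~ (k1 = 0 /\ k2 = 0) ->
    principal_curvature_branch (monge f) k2 kappa2 ->
    0 < alpha < PI / 2 ->
    regular_at (evolutoid f kappa2 alpha) 0 0 ->
    monge_parametrization_xz (evolutoid f kappa2 alpha) psi ->
    parabolic_at (evolutoid f kappa2 alpha) 0 0 ->
    asymptotic_direction (evolutoid f kappa2 alpha) 0 0 (0, 0, 1) ->
    (A_singularity 2 (height_function psi normal0) <-> a 3%nat 1%nat <> 0) /\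
    (A_singularity 3 (height_function psi normal0) <->
       a 3%nat 1%nat = 0 /\ a 4%nat 1%nat <> 0).
Proof.
  intros f k1 k2 a kappa2 alpha psi Hf Hexp Hk12 Hlt _ Hbr Halpha Hreg Hpsi Hpar _.
  apply smooth_germ2_iff in Hf.
  destruct (monge_expansion_derivatives _ _ _ _ Hexp) as [fu0 [fv0 [fuu0 [fuv0 [_ Ha]]]]].
  assert (Hs : sin alpha <> 0) by (apply Rgt_not_eq, sin_gt_0; lra).
  assert (Hk2 : k2 <> 0) by (intros E; apply Hk12; rewrite E; ring).
  destruct (monge_parametrization_height _ _ Hpsi) as [HX [h [k [D [Eh Ek]]]]].
  assert (Hsh := evolutoid_shift_smooth f kappa2 alpha Hs Hf HX).
  destruct (shift_defect f k1 k2 kappa2 alpha Hf fu0 fv0 fuu0 Hk2 ltac:(lra) Hs Hbr Hsh)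
    as [e1 [e2 [e3 [He1 [He2 [He3 EQ]]]]]].
  set (Y := fun u v => c2 (evolutoid f kappa2 alpha u v)) in *.
  set (s := evolutoid_shift f kappa2 alpha) in *.
  assert (HY : smooth_at Y 0 0) by (apply HX; auto).
  assert (Hv := smooth_at_pdv _ _ _ Hf). set (F := pdv f) in *.
  assert (EY : locally_2d (fun u v => Y u v = v - s u v * F u v) 0 0).
  { apply locally_2d_forall. intros u v. apply evolutoid_coordinates, Hs. }
  assert (Yu := height_pdu_0 Y s F Hsh Hv EY fv0 fuv0).
  assert (Yv := height_pdv_0 Y s F e1 e2 e3 HY Hsh Hv EY EQ fv0 fuv0).
  assert (Yuu := height_pduu Y s F Hsh Hv EY fv0 fuv0).
  assert (Yuv := height_pduv Y s F e1 e2 e3 HY Hsh Hv EY He1 He2 He3 EQ fv0 fuv0).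
  assert (Yvv := height_pdvv Y s F e1 e2 e3 HY Hsh Hv EY He1 He2 He3 EQ fv0 fuv0).
  assert (EQ0 : 1 = s 0 0 * pdv F 0 0).
  { assert (E := locally_2d_singleton _ _ _ EQ). simpl in E. rewrite fv0, fuv0 in E. lra. }
  assert (Hsv := regular_shift_pdv f kappa2 alpha Hf fu0 fv0 fuv0 Hs Hsh Yv Hreg). fold s in Hsv.
  assert (HYvv : pdv (pdv Y) 0 0 <> 0).
  { rewrite Yvv. intros Z. apply Hsv. apply Rmult_eq_reg_r with (pdv F 0 0); [lra|].
    intros Z'. rewrite Z' in EQ0. lra. }
  assert (s0 : s 0 0 <> 0) by (intros Z; rewrite Z in EQ0; lra).
  assert (Fuu0 : pdu (pdu F) 0 0 = 0).
  { assert (H := parabolic_hessian _ Hreg Hpar Yu Yv). fold Y in H. rewrite Yuv, Yuu in H.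
    apply Rmult_eq_reg_l with (s 0 0); [|exact s0].
    apply Rmult_eq_reg_r with (pdv (pdv Y) 0 0); [|exact HYvv]. lra. }
  assert (HO := height_pdv_bigO_3 Y s F e1 e2 e3 HY Hsh Hv EY He1 He2 He3 EQ fv0 fuv0 Fuu0).
  destruct (height_axis_F F Hv fv0 fuv0) as [T2 [HT2 [E2 [D2 R2]]]].
  destruct (axis_taylor_step T2 HT2) as [T3 [HT3 [E3 R3]]].
  destruct (axis_taylor_step T3 HT3) as [T4 [HT4 [E4 R4]]].
  destruct (axis_division s Hsh) as [s1 [Hs1 Es1]].
  assert (T20 : T2 0 0 = 0) by lra.
  assert (A31 : a 3%nat 1%nat = 6 * T3 0 0).
  { rewrite <- (Ha 3%nat 1%nat) by lia.
    change (partial_derive 3 1 f 0 0) with (Derive_n (fun u => F u 0) 3 0).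
    rewrite R2, R3. simpl. ring. }
  assert (A41 : a 4%nat 1%nat = 24 * T4 0 0).
  { rewrite <- (Ha 4%nat 1%nat) by lia.
    change (partial_derive 4 1 f 0 0) with (Derive_n (fun u => F u 0) 4 0).
    rewrite R2, R3, R4. simpl. ring. }
  (* Y(u,0) = - s u^3 (T3(0) + u T4) with s = s(0) + u s1, so this is the quotient
     by u^4 of what is left beyond the cubic term *)
  set (q := fun u v => - (T3 0 0 * s1 u v + s u v * T4 u v)).
  assert (Hq : smooth_at q 0 0).
  { apply smooth_at_opp, smooth_at_plus; [apply smooth_at_scal, Hs1 | apply smooth_at_mult; assumption]. }
  destruct (A2_A3_criterion Y (- (s 0 0 * T3 0 0)) q HY Hq) as [C2 C3]; [|exact HO|exact HYvv|].
  { generalize (filter_and _ _ (filter_and _ _ (locally_axis _ EY) Es1)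
      (filter_and _ _ E2 (filter_and _ _ E3 E4))).
    apply filter_imp. intros u [[P1 P2] [P3 [P4 P5]]].
    rewrite P1, P3, P4, P5, T20. unfold q.
    transitivity (- (s u 0 * u ^ 3 * T3 0 0) - u ^ 4 * s u 0 * T4 u 0); [ring|].
    rewrite P2 at 1. ring. }
  (* the height and [Y] differ by the change of parameters of the evolutoid *)
  assert (Hiff : forall n, A_singularity n (height_function psi normal0) <-> A_singularity n Y).
  { intros n. split.
    - apply (A_singularity_precomp n _ _ k h (diffeo_germ2_sym _ _ D) Ek).
    - apply (A_singularity_precomp n _ _ h k D Eh). }
  rewrite !Hiff, C2, C3, A31, A41.
  assert (Z3 : - (s 0 0 * T3 0 0) = 0 <-> 6 * T3 0 0 = 0).
  { split; intros Z; [|replace (T3 0 0) with 0 by lra; ring].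
    assert (Z' : s 0 0 * T3 0 0 = 0) by lra. apply Rmult_integral in Z'.
    destruct Z' as [Z'|Z']; [contradiction | rewrite Z'; ring]. }
  split; [rewrite Z3; reflexivity|]. rewrite Z3.
  split; intros [Z N]; (split; [exact Z|]); intros Z'; apply N; unfold q in *;
    replace (T3 0 0) with 0 in * by lra.
  - replace (T4 0 0) with 0 by lra. ring.
  - assert (Z4 : s 0 0 * T4 0 0 = 0) by lra. apply Rmult_integral in Z4.
    destruct Z4 as [Z4|Z4]; [contradiction | rewrite Z4; ring].
Qed.
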